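(* Let $\alpha>0$, $0<p<\infty$, and let $\psi$ and $g$ be entire functions on $\mathbb{C}$. Then the following are equivalent: (i) $V_{(g,\psi)}:\mathcal{F}_\alpha^\infty\to\mathcal{F}_\alpha^p$ is bounded; (ii) $V_{(g,\psi)}:\mathcal{F}_\alpha^\infty\to\mathcal{F}_\alpha^p$ is compact; (iii) $B_{(\psi,\alpha)}(|g|^p)\in L^1(\mathbb{C},dm)$. Moreover, if $V_{(g,\psi)}$ is bounded, then $$\|V_{(g,\psi)}\|^p\simeq\int_{\mathbb{C}}B_{(\psi,\alpha)}(|g|^p)(w)\,dm(w).$$
   Context: $dm$ is Lebesgue measure on $\mathbb{C}$. For $\alpha>0$ and $0<p<\infty$, the Fock space $\mathcal{F}_\alpha^p$ consists of the entire functions $f$ with $\|f\|_{(p,\alpha)}^p=\frac{\alpha p}{2\pi}\int_{\mathbb{C}}|f(z)|^pe^{-\frac{\alpha p}{2}|z|^2}dm(z)<\infty$; $\mathcal{F}_\alpha^\infty$ consists of the entire functions $f$ with $\|f\|_{(\infty,\alpha)}=\sup_{z\in\mathbb{C}}|f(z)|e^{-\frac{\alpha}{2}|z|^2}<\infty$. For entire $g,\psi,f$: $V_{(g,\psi)}f(z)=\int_0^zf(\psi(w))g'(w)\,dw$. Let $k_{(w,\alpha)}(z)=e^{\alpha\langle z,w\rangle-\alpha|w|^2/2}$ with $\langle z,w\rangle=z\overline{w}$ (the normalized reproducing kernel of $\mathcal{F}_\alpha^2$), and $$B_{(\psi,\alpha)}(|g|^p)(w)=\int_{\mathbb{C}}\frac{|k_{(w,\alpha)}(\psi(z))g'(z)|^p}{\big((1+|z|)e^{\frac{\alpha}{2}|z|^2}\big)^p}\,dm(z).$$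 $\|T\|$ is the operator norm $\sup\{\|Tf\|:\|f\|\le1\}$. $U\simeq V$ means $C^{-1}V\le U\le CV$ for a constant $C>0$ depending only on $p$ and $\alpha$ (not on $g,\psi$). *)

(* Defs.v *)
From HB Require Import structures.
From mathcomp Require Import all_boot all_order all_algebra.
From mathcomp Require Import complex.
From mathcomp Require Import all_classical all_reals all_analysis.

Set Implicit Arguments.
Unset Strict Implicit.
Unset Printing Implicit Defensive.

Import Order.TTheory GRing.Theory Num.Theory.
Import numFieldNormedType.Exports.

Local Open Scope classical_set_scope.
Local Open Scope ring_scope.
Local Open Scope complex_scope.

Section ComplexPlane.
Variable R : realType.
Local Notation C := (R[i]).

(* The library norm [`|z|] on [R[i]] is valued in [R[i]]. *)
Definition cabs (z : C) : R := complex.Re `|z|.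

Definition cexp (z : C) : C :=
  (expR (complex.Re z))%:C * (cos (complex.Im z) +i* sin (complex.Im z)).

(* [R[i]^o] carries the norm topology; derivability along [1] over the scalar
   field [R[i]] is complex differentiability. *)
Definition entire (f : C -> C) : Prop :=
  forall z : C, derivable (f : R[i]^o -> R[i]^o) z 1.

Definition cderiv (f : C -> C) (z : C) : C :=
  derive1 (f : R[i]^o -> R[i]^o) z.

(* [C] is identified with [R * R], and dm with the product Lebesgue measure. *)
Local Notation dm := (@lebesgue_measure R \x @lebesgue_measure R)%E.

Definition of_pair (u : R * R) : C := u.1 +i* u.2.

Definition integralC (F : C -> \bar R) : \bar R :=
  (\int[dm]_u F (of_pair u))%E.

Definition L1C (F : C -> \bar R) : Prop :=
  dm.-integrable setT (F \o of_pair).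

(* Integral of [h] along the segment from [0] to [z], parametrized by
   [t |-> t z]; for entire [h] the path is irrelevant by Cauchy's theorem. *)
Definition path_integral (h : C -> C) (z : C) : C :=
  let k (t : R) : C := h (t%:C * z) * z in
  (\int[@lebesgue_measure R]_(t in `[0, 1]) complex.Re (k t)) +i*
  (\int[@lebesgue_measure R]_(t in `[0, 1]) complex.Im (k t)).

End ComplexPlane.

Section Operators.
Variable R : realType.
Local Notation C := (R[i]).
Implicit Types (N M : (C -> C) -> \bar R) (T : (C -> C) -> (C -> C)).

(* The space of entire functions [f] with finite (quasi-)norm [N f]. *)
Definition entire_space N : set (C -> C) :=
  [set f | entire f /\ (N f < +oo)%E].

Definition bounded_op N M T : Prop :=
  (forall f, entire_space N f -> entire_space M (T f)) /\
  exists K : R, forall f, entire_space N f -> (M (T f) <= K%:E * N f)%E.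

(* Sequential form: the image of every norm-bounded sequence has a subsequence
   converging in the target. It also makes sense for the quasi-norms with
   exponent [p < 1]. *)
Definition compact_op N M T : Prop :=
  (forall f, entire_space N f -> entire_space M (T f)) /\
  forall (f : nat -> C -> C) (K : R),
    (forall n, entire_space N (f n) /\ (N (f n) <= K%:E)%E) ->
    exists2 s : nat -> nat, {homo s : m n / (m < n)%N} &
    exists2 h, entire_space M h &
      M (fun z => T (f (s n)) z - h z) @[n --> \oo] --> 0%E.

Definition op_norm N M T : \bar R :=
  ereal_sup [set M (T f) | f in [set f | entire_space N f /\ (N f <= 1)%E]].

End Operators.

Section Fock.
Variable R : realType.
Local Notation C := (R[i]).
Variable alpha : R.

Definition fock_norm (p : R) (f : C -> C) : \bar R :=
  (((alpha * p / (2 * pi))%:E *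
    integralC (fun z => (cabs (f z) `^ p *
                expR (- (alpha * p / 2) * cabs z ^+ 2))%:E)) `^ p^-1)%E.

Definition fock_norm_oo (f : C -> C) : \bar R :=
  ereal_sup (range (fun z : C =>
    (cabs (f z) * expR (- (alpha / 2) * cabs z ^+ 2))%:E)).

Definition volterra (g psi f : C -> C) : C -> C :=
  path_integral (fun w => f (psi w) * cderiv g w).

Definition fock_kernel (w z : C) : C :=
  cexp (alpha%:C * (z * conjc w) - (alpha * cabs w ^+ 2 / 2)%:C).

Definition berezin (psi g : C -> C) (p : R) (w : C) : \bar R :=
  integralC (fun z =>
    (cabs (fock_kernel w (psi z) * cderiv g z) `^ p /
     ((1 + cabs z) * expR (alpha / 2 * cabs z ^+ 2)) `^ p)%:E).

End Fock.

(* Main.v *)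
(** Put [a = alpha p / 2] and
      [J = int |g'|^p e^(a |psi|^2) (1 + |z|)^(-p) e^(-a |z|^2) dm]   ([mass] below).
    Since [|k_w(zeta)|^p = e^(a |zeta|^2 - a |zeta - w|^2)], Tonelli and the Gaussian
    integral give [int B dm = const J], so that (iii) means [J < oo].  For an entire [F]
    vanishing at [0], the integrals of [|F|^p e^(-a |z|^2)] and of
    [|F'|^p (1 + |z|)^(-p) e^(-a |z|^2)] are comparable (Littlewood-Paley).  Applied to
    [F = V f] with [|f| <= e^(alpha |z|^2 / 2)], this bounds [||V||^p] by [const J], and
    compactness follows from Montel's theorem and dominated convergence.
    Conversely, two finite sums of Gaussian exponentials, shifted by half a period, have norm
    at most [1], and at each point of a horizontal strip one of them is at least
    [const e^(alpha |z|^2 / 2)]; adding the two estimates for [V] gives [J <= const ||V||^p] as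
    the strips grow.  A subsequence of these sums serves as well, which handles (ii). *)

Require Import Defs.
From HB Require Import structures.
From mathcomp Require Import all_boot all_order all_algebra.
From mathcomp Require Import complex zify ring lra.
From mathcomp Require Import all_classical all_reals all_analysis.
From mathcomp Require Import measurable_realfun.
Import Order.TTheory GRing.Theory Num.Theory.
Import numFieldNormedType.Exports.
Local Open Scope classical_set_scope.
Local Open Scope ring_scope.

Set Implicit Arguments.
Unset Strict Implicit.
Unset Printing Implicit Defensive.

(** * Complex modulus and complex derivatives *)

(** The natural length at [z] is [1 / (1 + |z|)]: over such a distance [|z|^2] changes by a bounded
    amount, so the Gaussian weight is constant up to a factor. This is where [(1 + |z|)^(-p)] comes
    from, and both Littlewood-Paley bounds are local comparisons at this scale. For [p < 1] there is
    neither convexity nor a triangle inequality; the sub-mean value inequality for [|f|^p], valid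
    for every [p > 0], takes their place. Bounding [F] by [F'] is the harder direction, since
    integrating [F'] along rays is no local operation; it is replaced by a single short displacement
    towards the origin and an absorption argument. One test function could not replace the two sums:
    an entire function with modulus at least [const e^(alpha |z|^2 / 2)] on the whole plane would
    have no zeros, and its reciprocal would be entire and tend to [0], against Liouville's
    theorem. *)

Lemma eq_leW (disp : Order.disp_t) (T : porderType disp) (x y : T) : x = y -> (x <= y)%O.
Proof. by move->. Qed.

Section Cabs.
Variable R : realType.
Local Notation C := (R[i]).
Implicit Types (z w : C) (x y : R).

Lemma cabs_normc z : cabs z = ComplexField.Normc.normc z.
Proof. by rewrite /cabs normc_def; case: z. Qed.

Lemma normcC z : `|z| = (cabs z)%:C%C.
Proof. by rewrite /cabs normc_def. Qed.

Lemma cabs_ge0 z : 0 <= cabs z.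
Proof. by rewrite -(@ler0c R) -normcC normr_ge0. Qed.
#[local] Hint Extern 0 (is_true (0 <= cabs _)) => solve [apply: cabs_ge0] : core.

Lemma cabs0 : cabs (0 : C) = 0.
Proof. by rewrite /cabs normr0. Qed.

Lemma cabs_eq0 z : cabs z = 0 -> z = 0.
Proof. by move=> h; apply/eqP; rewrite -normr_eq0 normcC h. Qed.

Lemma cabs_gt0 z : z != 0 -> 0 < cabs z.
Proof.
by move=> z0; rewrite lt_neqAle cabs_ge0 andbT eq_sym; apply: contra z0 => /eqP/cabs_eq0/eqP.
Qed.

Lemma cabsM z w : cabs (z * w) = cabs z * cabs w.
Proof. by rewrite !cabs_normc ComplexField.Normc.normcM. Qed.

Lemma cabsV z : cabs z^-1 = (cabs z)^-1.
Proof. by rewrite !cabs_normc ComplexField.Normc.normcV. Qed.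

Lemma cabsN z : cabs (- z) = cabs z.
Proof. by rewrite /cabs normrN. Qed.

Lemma cabsB z w : cabs (z - w) = cabs (w - z).
Proof. by rewrite /cabs distrC. Qed.

Lemma cabsD z w : cabs (z + w) <= cabs z + cabs w.
Proof. by rewrite -lecR rmorphD -!normcC ler_normD. Qed.

Lemma cabsBD z w : cabs (z - w) <= cabs z + cabs w.
Proof. by rewrite -(cabsN w) cabsD. Qed.

Lemma cabs_sqr z : cabs z ^+ 2 = complex.Re z ^+ 2 + complex.Im z ^+ 2.
Proof.
rewrite /cabs normc_def /= sqr_sqrtr //; exact: addr_ge0 (sqr_ge0 _) (sqr_ge0 _).
Qed.

Lemma cabs_real x : cabs (x%:C)%C = `|x|.
Proof. by rewrite /cabs normc_def /= expr0n addr0 sqrtr_sqr. Qed.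

Lemma Re_le_cabs z : `|complex.Re z| <= cabs z.
Proof. by rewrite -lecR -normcC normc_ge_Re. Qed.

Lemma Im_le_cabs z : `|complex.Im z| <= cabs z.
Proof.
have := cabs_sqr z; have := cabs_ge0 z; move: (cabs z) => c c0 E.
rewrite -(@ler_pXn2r _ 2) ?nnegrE // real_normK ?num_real // E; have := sqr_ge0 (complex.Re z); lra.
Qed.

Lemma cabs_le z : cabs z <= `|complex.Re z| + `|complex.Im z|.
Proof.
have := cabs_sqr z; have := cabs_ge0 z; move: (cabs z) => c c0 E.
rewrite -(@ler_pXn2r _ 2) ?nnegrE ?addr_ge0 // E.
rewrite sqrrD !real_normK ?num_real //.
have : 0 <= `|complex.Re z| * `|complex.Im z| by rewrite mulr_ge0.
lra.
Qed.

Lemma cabsi : cabs ('i%C : C) = 1.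
Proof. by rewrite /cabs normc_def /= expr0n add0r expr1n sqrtr1. Qed.

Lemma complexP z w : complex.Re z = complex.Re w -> complex.Im z = complex.Im w -> z = w.
Proof. by case: z => a b; case: w => c d /= -> ->. Qed.

End Cabs.
#[global] Hint Extern 0 (is_true (0 <= cabs _)) => solve [apply: cabs_ge0] : core.

Section CDer.
Variable R : realType.
Local Notation C := (R[i]).
Implicit Types (z w d : C) (f g : C -> C).

(** Complex differentiability through real moduli, so that estimates are inequalities in the ordered
    field [R]. Multiplying by [cabs h] instead of dividing by it admits [h = 0]. *)
Definition cder f z d := forall e : R, 0 < e -> exists2 r : R, 0 < r &
  forall h : C, cabs h < r -> cabs (f (z + h) - f z - d * h) <= e * cabs h.

Lemma cder_derive f z d :
  (fun h : (R[i] : numFieldType) =>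
     h^-1 *: (((f : R[i]^o -> R[i]^o) \o shift z) (h *: (1 : R[i]^o)) - f z))
    @ 0^' --> (d : R[i]^o) <-> cder f z d.
Proof.
split.
  move=> /cvgrPdist_le H e e0.
  have e0' : (0 : R[i]) < (e%:C)%C by rewrite ltcR.
  have := H _ e0'; rewrite /dnbhs /= /within /= => -[r /= r0 Hr].
  have rE : r = ((complex.Re r)%:C)%C.
    by move: r0; rewrite ltcE => /= /andP[/eqP i0 _]; apply: complexP.
  have r0' : 0 < complex.Re r by move: r0; rewrite rE ltcR.
  exists (complex.Re r) => // h hr.
  have [->|h0] := eqVneq h 0; first by rewrite addr0 mulr0 subrr subr0 cabs0 mulr0.
  have := Hr h; rewrite /ball /= sub0r normrN normcC rE ltcR => /(_ hr h0).
  rewrite normcC lecR /GRing.scale /= mulr1 => Hh.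
  have -> : f (z + h) - f z - d * h = - ((d - h^-1 * (f (h + z) - f z)) * h).
    by rewrite (addrC h z); field.
  by rewrite cabsN cabsM ler_pM2r // cabs_gt0.
move=> H; apply/cvgrPdist_le => e e0.
have eE : e = ((complex.Re e)%:C)%C.
  by move: e0; rewrite ltcE => /= /andP[/eqP i0 _]; apply: complexP.
have e0' : 0 < complex.Re e by move: e0; rewrite eE ltcR.
have [r r0 Hr] := H _ e0'.
rewrite /dnbhs /within /=; exists (r%:C)%C; first by rewrite /= ltcR.
move=> h; rewrite /ball /= sub0r normrN normcC ltcR => hr h0.
rewrite eE normcC lecR /GRing.scale /= mulr1.
rewrite -(@ler_pM2r _ (cabs h)) ?cabs_gt0 //.
rewrite -cabsM.
have -> : (d - h^-1 * (f (h + z) - f z)) * h = - (f (z + h) - f z - d * h).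
  by rewrite (addrC h z); field.
by rewrite cabsN Hr.
Qed.

Lemma cder_cderiv f z d : cder f z d -> cderiv f z = d.
Proof.
move/cder_derive => H; rewrite /cderiv derive1E /derive.
have HH : hausdorff_space (R[i]^o : normedModType (R[i] : numFieldType)) by exact: norm_hausdorff.
exact: (cvg_lim HH H).
Qed.

Lemma entireP f : entire f <-> forall z, exists d, cder f z d.
Proof.
split=> H z.
  by have := H z; rewrite /derivable => /cvg_ex[d /cder_derive ?]; exists d.
have [d /cder_derive H1] := H z; apply/cvg_ex; by exists d.
Qed.

Lemma entire_cder f : entire f -> forall z, cder f z (cderiv f z).
Proof. by move=> /entireP H z; have [d Hd] := H z; rewrite (cder_cderiv Hd). Qed.

Lemma cder_entire f df : (forall z, cder f z (df z)) -> entire f.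
Proof. by move=> H; apply/entireP => z; exists (df z). Qed.

Lemma cder_cst c z : cder (fun=> c) z 0.
Proof. by move=> e e0; exists 1 => // h _; rewrite subrr mul0r subr0 cabs0 mulr_ge0 // ltW. Qed.

Lemma cder_id z : cder id z 1.
Proof.
move=> e e0; exists 1 => // h _.
have -> : z + h - z - 1 * h = 0 by ring.
by rewrite cabs0 mulr_ge0 // ltW.
Qed.

Lemma cder_lip f z d : cder f z d -> exists2 r : R, 0 < r &
  forall h : C, cabs h < r -> cabs (f (z + h) - f z) <= (cabs d + 1) * cabs h.
Proof.
move=> /(_ 1 ltr01) [r r0 H]; exists r => // h /H {}H.
have -> : f (z + h) - f z = (f (z + h) - f z - d * h) + d * h by ring.
by apply: le_trans (cabsD _ _) _; rewrite cabsM mulrDl addrC lerD2l.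
Qed.

Lemma cderD f g z a b : cder f z a -> cder g z b -> cder (fun x => f x + g x) z (a + b).
Proof.
move=> Hf Hg e e0.
have e20 : 0 < e / 2 by lra.
have [r1 r10 H1] := Hf _ e20; have [r2 r20 H2] := Hg _ e20.
exists (Num.min r1 r2); first by rewrite lt_min r10.
move=> h; rewrite lt_min => /andP[/H1 {}H1 /H2 {}H2].
have -> : f (z + h) + g (z + h) - (f z + g z) - (a + b) * h =
  (f (z + h) - f z - a * h) + (g (z + h) - g z - b * h) by ring.
by apply: le_trans (cabsD _ _) _; lra.
Qed.

Lemma cderM f g z a b : cder f z a -> cder g z b ->
  cder (fun x => f x * g x) z (a * g z + f z * b).
Proof.
move=> Hf Hg e e0.
have [r0 r00 H0] := cder_lip Hg.
set A := cabs (g z) + cabs (f z) + cabs a + 1.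
have A0 : 0 < A by rewrite /A ltr_wpDl // !addr_ge0.
set B := cabs b + 1; have B0 : 0 < B by rewrite /B ltr_wpDl.
have e20 : 0 < e / (3 * A) by rewrite divr_gt0 // mulr_gt0.
have e21 : 0 < e / (3 * A * B) by rewrite divr_gt0 // !mulr_gt0.
have [r1 r10 H1] := Hf _ e20; have [r2 r20 H2] := Hg _ e20.
have [r3 r30 H3] := cder_lip Hf.
exists (Num.min (Num.min r0 (e / (3 * A * B))) (Num.min (Num.min r1 r2) r3)).
  by rewrite !lt_min r00 r10 r20 r30 e21.
move=> h; rewrite !lt_min => /andP[/andP[/H0 {}H0 h1] /andP[/andP[/H1 {}H1 /H2 {}H2] /H3 {}H3]].
(* The last term is a product of two increments, hence of second order; the bound [e / (3 A B)] on
   [h] takes care of it. *)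
have -> : f (z + h) * g (z + h) - f z * g z - (a * g z + f z * b) * h =
  (f (z + h) - f z - a * h) * g z + f z * (g (z + h) - g z - b * h)
  + (f (z + h) - f z) * (g (z + h) - g z) by ring.
have [hE|h0] := eqVneq h 0.
  by rewrite hE !addr0 !subrr !mulr0 !subr0 !mul0r !mulr0 !addr0 cabs0 mulr0.
have ch := cabs_gt0 h0.
have T1 : cabs ((f (z + h) - f z - a * h) * g z) <= e / 3 * cabs h.
  rewrite cabsM.
  have /le_trans : cabs (f (z + h) - f z - a * h) * cabs (g z) <= e / (3 * A) * cabs h * A.
    by apply: ler_pM => //; rewrite /A -!addrA lerDl !addr_ge0.
  apply; apply: eq_leW; field; lra.
have T2 : cabs (f z * (g (z + h) - g z - b * h)) <= e / 3 * cabs h.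
  rewrite cabsM mulrC.
  have /le_trans : cabs (g (z + h) - g z - b * h) * cabs (f z) <= e / (3 * A) * cabs h * A.
    apply: ler_pM => //; rewrite /A; have := cabs_ge0 (g z); have := cabs_ge0 a; lra.
  apply; apply: eq_leW; field; lra.
have T3 : cabs ((f (z + h) - f z) * (g (z + h) - g z)) <= e / 3 * cabs h.
  rewrite cabsM.
  have aA : cabs a + 1 <= A by rewrite /A; have := cabs_ge0 (g z); have := cabs_ge0 (f z); lra.
  have /le_trans : cabs (f (z + h) - f z) * cabs (g (z + h) - g z) <=
     (A * cabs h) * (B * (e / (3 * A * B))).
    apply: ler_pM => //; first by apply: le_trans H3 _; rewrite ler_pM2r.
    by apply: le_trans H0 _; rewrite ler_pM2l // ltW.
  apply; apply: eq_leW; field; lra.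
apply: le_trans (cabsD _ _) _; apply: le_trans (lerD (cabsD _ _) T3) _.
lra.
Qed.

Lemma cder_ext f g z d : f =1 g -> cder f z d -> cder g z d.
Proof. by move=> /funext ->. Qed.

Lemma cderZ c f z a : cder f z a -> cder (fun x => c * f x) z (c * a).
Proof. by move=> H; have := cderM (cder_cst c z) H; rewrite mul0r add0r. Qed.

Lemma cderN f z a : cder f z a -> cder (fun x => - f x) z (- a).
Proof.
by move=> /(cderZ (-1)); rewrite mulN1r; apply: cder_ext => x; rewrite mulN1r.
Qed.

Lemma cderB f g z a b : cder f z a -> cder g z b -> cder (fun x => f x - g x) z (a - b).
Proof. by move=> Hf Hg; apply: cderD => //; apply: cderN. Qed.

Lemma cder_comp f g z a b : cder f (g z) a -> cder g z b ->
  cder (fun x => f (g x)) z (a * b).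
Proof.
move=> Hf Hg e e0.
have [r0 r00 H0] := cder_lip Hg.
set A := cabs a + 1; have A0 : 0 < A by rewrite /A ltr_wpDl.
set B := cabs b + 1; have B0 : 0 < B by rewrite /B ltr_wpDl.
have e1 : 0 < e / (2 * B) by rewrite divr_gt0 // mulr_gt0.
have e2 : 0 < e / (2 * A) by rewrite divr_gt0 // mulr_gt0.
have [r1 r10 H1] := Hf _ e1; have [r2 r20 H2] := Hg _ e2.
exists (Num.min (Num.min r0 r2) (r1 / B)); first by rewrite !lt_min r00 r20 divr_gt0.
move=> h; rewrite !lt_min => /andP[/andP[/H0 {}H0 /H2 {}H2]].
rewrite ltr_pdivlMr // mulrC => hr1.
set k := g (z + h) - g z in H0.
have := H1 k (le_lt_trans H0 hr1).
have -> : g z + k = g (z + h) by rewrite /k; ring.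
move=> {}H1.
have -> : f (g (z + h)) - f (g z) - a * b * h =
  (f (g (z + h)) - f (g z) - a * k) + a * (g (z + h) - g z - b * h) by rewrite /k; ring.
have T1 : e / (2 * B) * cabs k <= e / 2 * cabs h.
  apply: le_trans (ler_wpM2l (ltW e1) H0) _.
  apply: eq_leW; rewrite -/B; field; lra.
have T2 : cabs (a * (g (z + h) - g z - b * h)) <= e / 2 * cabs h.
  rewrite cabsM.
  have /le_trans : cabs a * cabs (g (z + h) - g z - b * h) <= A * (e / (2 * A) * cabs h).
    by apply: ler_pM => //; rewrite /A lerDl.
  apply; apply: eq_leW; field; lra.
by apply: le_trans (cabsD _ _) _; lra.
Qed.

Lemma cderV z : z != 0 -> cder (fun x => x^-1) z (- (z^-1 ^+ 2)).
Proof.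
move=> z0 e e0.
have cz := cabs_gt0 z0.
exists (Num.min (cabs z / 2) (e * cabs z ^+ 3 / 2)).
  by rewrite lt_min !divr_gt0 // mulr_gt0 // exprn_gt0.
move=> h; rewrite lt_min => /andP[h1 h2].
have zh : cabs z / 2 <= cabs (z + h).
  have := cabsD (z + h) (- h); rewrite addrK cabsN; lra.
have zh0 : z + h != 0.
  by apply/eqP => E; move: zh; rewrite E cabs0; lra.
have -> : (z + h)^-1 - z^-1 - - z^-1 ^+ 2 * h = h * h * ((z + h)^-1 * z^-1 * z^-1) by field; apply/andP.
rewrite !cabsM !cabsV.
have c1 : (cabs (z + h))^-1 <= 2 / cabs z.
  have zp : 0 < cabs (z + h) by apply: lt_le_trans zh; rewrite divr_gt0.
  by rewrite -[2 / _]invrK invf_div lef_pV2 ?posrE ?divr_gt0.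
rewrite mulrAC; apply: ler_wpM2r => //.
apply: le_trans (_ : cabs h * (2 / cabs z / cabs z / cabs z) <= _).
  by apply: ler_wpM2l => //; rewrite !ler_pM2r ?invr_gt0.
apply: le_trans (ler_wpM2r _ (ltW h2)) _.
  by rewrite !divr_ge0 // ltW.
apply: eq_leW; field; lra.
Qed.

Lemma cder_shift f z c d : cder f (z + c) d -> cder (fun x => f (x + c)) z d.
Proof.
move=> H; rewrite -[d]mulr1; apply: (@cder_comp f (fun x => x + c)) => //.
by rewrite -[1]addr0; apply: cderD; [exact: cder_id | exact: cder_cst].
Qed.

Lemma cder_scale f z c d : cder f (c * z) d -> cder (fun x => f (c * x)) z (d * c).
Proof.
move=> H; apply: (@cder_comp f (fun x => c * x)) => //.
by rewrite -[X in cder _ _ X]mulr1; apply: cderZ; exact: cder_id.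
Qed.

End CDer.

(** * Cauchy's theorem and estimates on rectangles *)

Section Cint.
Variable R : realType.
Local Notation C := (R[i]).
Local Notation mu := (@lebesgue_measure R).
Implicit Types (a b c x : R) (k l : R -> C).

(** Componentwise, so that [path_integral] is by conversion the case of the interval [[0, 1]]. *)
Definition cint a b k : C :=
  ((\int[mu]_(x in `[a, b]) complex.Re (k x)) +i*
  (\int[mu]_(x in `[a, b]) complex.Im (k x)))%C.

Definition cintegrable a b k :=
  mu.-integrable `[a, b] (EFin \o (@complex.Re R \o k)) /\
  mu.-integrable `[a, b] (EFin \o (@complex.Im R \o k)).

Definition ccontinuous k x := forall e : R, 0 < e -> exists2 r : R, 0 < r &
  forall t : R, `|t| < r -> cabs (k (x + t) - k x) <= e.

Lemma ccontinuous_fun k x (p : C -> R) :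
  (forall z w, `|p z - p w| <= cabs (z - w)) ->
  ccontinuous k x -> {for x, continuous (p \o k)}.
Proof.
move=> Hp H; apply/cvgrPdist_le => e e0.
have [r r0 Hr] := H _ e0.
exists r => //= t; rewrite /ball /= distrC => xt.
apply: le_trans (Hp _ _) _; rewrite cabsB.
by have := Hr (t - x) xt; rewrite subrKC.
Qed.

Lemma ler_add2 (u v m : R) : u <= m -> v <= m -> v + u <= 2 * m.
Proof. by lra. Qed.

Lemma ReB_le (z w : C) : `|complex.Re z - complex.Re w| <= cabs (z - w).
Proof. by case: z => p q; case: w => p' q'; apply: (Re_le_cabs (Complex (p - p') (q - q'))). Qed.

Lemma ImB_le (z w : C) : `|complex.Im z - complex.Im w| <= cabs (z - w).
Proof. by case: z => p q; case: w => p' q'; apply: (Im_le_cabs (Complex (p - p') (q - q'))). Qed.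

Lemma cabsB_le (z w : C) : `|cabs z - cabs w| <= cabs (z - w).
Proof. by rewrite ler_norml; have := cabsD (z - w) w; have := cabsD (w - z) z;
 rewrite !subrK (cabsB w z); lra. Qed.

Lemma ccontinuous_integrable a b k (p : C -> R) :
  (forall z w, `|p z - p w| <= cabs (z - w)) ->
  (forall x, a <= x <= b -> ccontinuous k x) ->
  mu.-integrable `[a, b] (EFin \o (p \o k)).
Proof.
move=> Hp H; apply: continuous_compact_integrable; first exact: segment_compact.
apply: continuous_in_subspaceT => x; rewrite inE /= in_itv /= => xab.
by apply: ccontinuous_fun => //; exact: H.
Qed.

Lemma ccontinuous_cintegrable a b k :
  (forall x, a <= x <= b -> ccontinuous k x) -> cintegrable a b k.
Proof.
by move=> H; split; apply: ccontinuous_integrable => //; [exact: ReB_le|exact: ImB_le].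
Qed.

Lemma cintegrableD a b k l : cintegrable a b k -> cintegrable a b l ->
  cintegrable a b (fun x => k x + l x).
Proof.
move=> [k1 k2] [l1 l2]; split.
- rewrite (_ : EFin \o _ = (EFin \o (@complex.Re R \o k)) \+ (EFin \o (@complex.Re R \o l)))%E.
    by apply: integrableD.
  by apply/funext => x /=; case: (k x) => ? ?; case: (l x).
- rewrite (_ : EFin \o _ = (EFin \o (@complex.Im R \o k)) \+ (EFin \o (@complex.Im R \o l)))%E.
    by apply: integrableD.
  by apply/funext => x /=; case: (k x) => ? ?; case: (l x).
Qed.

Lemma cintD a b k l : cintegrable a b k -> cintegrable a b l ->
  cint a b (fun x => k x + l x) = cint a b k + cint a b l.
Proof.
move=> [k1 k2] [l1 l2]; apply: complexP => /=.
  rewrite -RintegralD //; apply: eq_Rintegral => x _.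
  by case: (k x) => ? ?; case: (l x).
rewrite -RintegralD //; apply: eq_Rintegral => x _.
by case: (k x) => ? ?; case: (l x).
Qed.

Lemma cintegrableM a b k (c : C) : cintegrable a b k ->
  cintegrable a b (fun x => c * k x).
Proof.
case: c => c1 c2 [k1 k2]; split.
- rewrite (_ : EFin \o _ = (fun x => c1%:E * (EFin \o (@complex.Re R \o k)) x) \-
     (fun x => c2%:E * (EFin \o (@complex.Im R \o k)) x))%E.
    by apply: integrableB => //; apply: integrableZl.
  by apply/funext => x /=; case: (k x).
- rewrite (_ : EFin \o _ = (fun x => c1%:E * (EFin \o (@complex.Im R \o k)) x) \+
     (fun x => c2%:E * (EFin \o (@complex.Re R \o k)) x))%E.
    by apply: integrableD => //; apply: integrableZl.
  by apply/funext => x /=; case: (k x) => u v /=; rewrite -!EFinM -EFinD.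
Qed.

Lemma cintM a b k (c : C) : cintegrable a b k ->
  cint a b (fun x => c * k x) = c * cint a b k.
Proof.
case: c => c1 c2 [k1 k2].
have Z r h : mu.-integrable `[a, b] (EFin \o h) ->
    mu.-integrable `[a, b] (EFin \o (fun x => r * h x)).
  move=> ih; rewrite (_ : EFin \o _ = (fun x => r%:E * (EFin \o h) x)%E) //.
  exact: integrableZl.
apply: complexP => /=.
  rewrite -!RintegralZl // -RintegralB //; try exact: Z.
  by apply: eq_Rintegral => x _; case: (k x).
rewrite -!RintegralZl // -RintegralD //; try exact: Z.
by apply: eq_Rintegral => x _; case: (k x).
Qed.

Lemma cintB a b k l : cintegrable a b k -> cintegrable a b l ->
  cint a b (fun x => k x - l x) = cint a b k - cint a b l.
Proof.
move=> ik il.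
have -> : (fun x => k x - l x) = (fun x => k x + (-1) * l x).
  by apply/funext => x; rewrite mulN1r.
by rewrite cintD // ?cintM ?mulN1r //; exact: cintegrableM.
Qed.

Lemma cintegrableB a b k l : cintegrable a b k -> cintegrable a b l ->
  cintegrable a b (fun x => k x - l x).
Proof.
move=> ik il.
have -> : (fun x => k x - l x) = (fun x => k x + (-1) * l x).
  by apply/funext => x; rewrite mulN1r.
by apply: cintegrableD => //; exact: cintegrableM.
Qed.

Lemma ccontinuous_cst (z : C) x : ccontinuous (fun=> z) x.
Proof. by move=> e e0; exists 1 => // t _; rewrite subrr cabs0 ltW. Qed.

Lemma cintegrable_cst a b (z : C) : cintegrable a b (fun=> z).
Proof. by apply: ccontinuous_cintegrable => x _; exact: ccontinuous_cst. Qed.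

Lemma mu_itv a b : a <= b -> mu `[a, b] = (b - a)%:E.
Proof.
move=> ab; rewrite lebesgue_measure_itv /= lte_fin; case: ltP => //= ba.
by rewrite (@le_anti _ _ a b) ?subrr // ab.
Qed.

Lemma cint_cst a b (z : C) : a <= b -> cint a b (fun=> z) = (b - a)%:C%C * z.
Proof.
move=> ab.
have E : fine (mu `[a, b]) = b - a by rewrite mu_itv.
by case: z => z1 z2; rewrite /cint /= !Rintegral_cst // E; apply: complexP => /=; ring.
Qed.

(** The factor [2] arises from bounding the real and the imaginary part separately. *)
Lemma cint_bound a b k M : a <= b -> cintegrable a b k ->
  (forall x, a <= x <= b -> cabs (k x) <= M) ->
  cabs (cint a b k) <= 2 * M * (b - a).
Proof.
move=> ab [k1 k2] H.
have E : fine (mu `[a, b]) = b - a by rewrite mu_itv.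
have B (p : C -> R) : (forall z, `|p z| <= cabs z) ->
    mu.-integrable `[a, b] (EFin \o (p \o k)) ->
    `| \int[mu]_(x in `[a, b]) p (k x)| <= M * (b - a).
  move=> Hp ik; apply: le_trans (le_normr_Rintegral _ ik) _ => //.
  rewrite -E -Rintegral_cst //; apply: le_Rintegral => //.
  - rewrite (_ : EFin \o _ = abse \o (EFin \o (p \o k))) //.
    exact: integrable_abse.
  - apply: (@ccontinuous_integrable _ _ (fun=> (M%:C)%C) (@complex.Re R)) => [|x _].
      exact: ReB_le.
    exact: ccontinuous_cst.
  - by move=> x /=; rewrite in_itv /= => xab; apply: le_trans (Hp _) _; exact: H.
apply: le_trans (cabs_le _) _ => /=.
rewrite ?[2 * M * _]mulrA -?mulrA; apply: ler_add2; [exact: (B _ (@Im_le_cabs R) k2)|exact: (B _ (@Re_le_cabs R) k1)].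
Qed.

Lemma cint_le a b k : cintegrable a b k ->
  mu.-integrable `[a, b] (EFin \o (@cabs R \o k)) ->
  cabs (cint a b k) <= 2 * \int[mu]_(x in `[a, b]) cabs (k x).
Proof.
move=> [k1 k2] ic.
have B (p : C -> R) : (forall z, `|p z| <= cabs z) ->
    mu.-integrable `[a, b] (EFin \o (p \o k)) ->
    `| \int[mu]_(x in `[a, b]) p (k x)| <= \int[mu]_(x in `[a, b]) cabs (k x).
  move=> Hp ik; apply: le_trans (le_normr_Rintegral _ ik) _ => //.
  apply: le_Rintegral => //.
  rewrite (_ : EFin \o _ = abse \o (EFin \o (p \o k))) //.
    exact: integrable_abse.
  by move=> x _; exact: Hp.
apply: (le_trans (cabs_le (cint a b k))) => /=.
apply: ler_add2; [exact: (B _ (@Im_le_cabs R) k2)|exact: (B _ (@Re_le_cabs R) k1)].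
Qed.

Lemma cint_split a b c k : a <= b <= c -> cintegrable a c k ->
  cint a c k = cint a b k + cint b c k.
Proof.
move=> /andP[ab bc] [k1 k2].
have S (p : R -> R) : mu.-integrable `[a, c] (EFin \o p) ->
   \int[mu]_(x in `[a, c]) p x = \int[mu]_(x in `[a, b]) p x + \int[mu]_(x in `[b, c]) p x.
  move=> ip.
  have := Rintegral_itvB ip (x := b); rewrite !bnd_simp => /(_ ab bc) E.
  rewrite Rintegral_itv_obnd_cbnd in E.
    by rewrite -E; ring.
  apply: integrableS ip => //; apply: subset_itv; rewrite bnd_simp //.
by apply: complexP => /=; apply: S.
Qed.

Lemma eq_cint a b k l : (forall x, a <= x <= b -> k x = l x) -> cint a b k = cint a b l.
Proof.
by move=> H; apply: complexP => /=; apply: eq_Rintegral => x; rewrite inE /= in_itv /= => /H ->.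
Qed.

End Cint.

(** * Goursat's theorem for rectangles *)

Section Goursat.
Variable R : realType.
Local Notation C := (R[i]).
Implicit Types (a b c d x y s e : R) (k : C -> C).

Definition pt x y : C := (x +i* y)%C.

Lemma cder_ccontinuous_h k x y D : cder k (pt x y) D -> ccontinuous (fun t => k (pt t y)) x.
Proof.
move=> H e e0; have [r r0 Hr] := cder_lip H.
have A0 : 0 < cabs D + 1 by rewrite ltr_wpDl.
exists (Num.min r (e / (cabs D + 1))); first by rewrite lt_min r0 divr_gt0.
move=> t; rewrite lt_min ltr_pdivlMr // => /andP[t1 t2].
have := Hr (pt t 0).
have -> : pt x y + pt t 0 = pt (x + t) y by apply: complexP => /=; rewrite ?addr0.
have -> : cabs (pt t 0) = `|t| by exact: cabs_real.
by move=> /(_ t1) /le_trans; apply; rewrite mulrC ltW.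
Qed.

Lemma cder_ccontinuous_v k x y D : cder k (pt x y) D -> ccontinuous (fun t => k (pt x t)) y.
Proof.
move=> H e e0; have [r r0 Hr] := cder_lip H.
have A0 : 0 < cabs D + 1 by rewrite ltr_wpDl.
exists (Num.min r (e / (cabs D + 1))); first by rewrite lt_min r0 divr_gt0.
move=> t; rewrite lt_min ltr_pdivlMr // => /andP[t1 t2].
have := Hr (pt 0 t).
have -> : pt x y + pt 0 t = pt x (y + t) by apply: complexP => /=; rewrite ?addr0.
have -> : cabs (pt 0 t) = `|t|.
  by rewrite (_ : pt 0 t = 'i%C * (t%:C)%C) ?cabsM ?cabsi ?mul1r ?cabs_real //; apply: complexP => /=; ring.
by move=> /(_ t1) /le_trans; apply; rewrite mulrC ltW.
Qed.

(** The integral along the boundary of [[a, b] x [c, d]], counterclockwise, with opposite sides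
    paired. *)
Definition rint k a b c d : C :=
  cint a b (fun x => k (pt x c)) - cint a b (fun x => k (pt x d)) +
  'i%C * (cint c d (fun y => k (pt b y)) - cint c d (fun y => k (pt a y))).

Definition holo_on k a b c d := forall x y, a <= x <= b -> c <= y <= d ->
  exists D, cder k (pt x y) D.

Lemma holo_h k a b c d y : holo_on k a b c d -> c <= y <= d ->
  cintegrable a b (fun x => k (pt x y)).
Proof.
move=> H ycd; apply: ccontinuous_cintegrable => x xab.
by have [D] := H _ _ xab ycd; exact: cder_ccontinuous_h.
Qed.

Lemma holo_v k a b c d x : holo_on k a b c d -> a <= x <= b ->
  cintegrable c d (fun y => k (pt x y)).
Proof.
move=> H xab; apply: ccontinuous_cintegrable => y ycd.
by have [D] := H _ _ xab ycd; exact: cder_ccontinuous_v.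
Qed.

Lemma rint_splitx k a e b c d : a <= e <= b -> c <= d ->
  cintegrable a b (fun x => k (pt x c)) -> cintegrable a b (fun x => k (pt x d)) ->
  rint k a b c d = rint k a e c d + rint k e b c d.
Proof.
move=> ab cd ic id; rewrite /rint (cint_split ab ic) (cint_split ab id).
by ring.
Qed.

Lemma rint_splity k a b c e d : a <= b -> c <= e <= d ->
  cintegrable c d (fun y => k (pt a y)) -> cintegrable c d (fun y => k (pt b y)) ->
  rint k a b c d = rint k a b c e + rint k a b e d.
Proof.
move=> ab cd ia ib; rewrite /rint (cint_split cd ia) (cint_split cd ib).
by ring.
Qed.

Lemma holo_sub k a b c d a' b' c' d' : a <= a' -> b' <= b -> c <= c' -> d' <= d ->
  holo_on k a b c d -> holo_on k a' b' c' d'.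
Proof. by move=> h1 h2 h3 h4 H x y /andP[? ?] /andP[? ?]; apply: H; apply/andP; split; lra. Qed.

(** Near the point, [k] differs from an affine function by a small multiple of the distance, and
    affine functions have boundary integral zero. With opposite sides paired, the affine part
    becomes a constant on each pair. *)
Lemma rint_small k x y D e : 0 < e -> cder k (pt x y) D ->
  exists2 r : R, 0 < r & forall a b c d s, b - a <= s -> d - c <= s -> s < r ->
    a <= x <= b -> c <= y <= d ->
    holo_on k a b c d ->
    cabs (rint k a b c d) <= e * s ^+ 2.
Proof.
move=> e0 H.
(* A difference of opposite sides is at most [e s / 4], and each pair then contributes at most
   [2 (e s / 4) s], half of the target. *)
have e1 : 0 < e / 16 by rewrite divr_gt0.
have [r r0 Hr] := H _ e1.
exists (r / 2); first by rewrite divr_gt0.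
move=> a b c d s bas dcs sr /andP[ax xb] /andP[cy yd] hk.
have near u v : a <= u <= b -> c <= v <= d ->
   cabs (k (pt u v) - k (pt x y) - D * (pt u v - pt x y)) <= e / 16 * (2 * s).
  move=> /andP[au ub] /andP[cv vd].
  have l : cabs (pt u v - pt x y) <= 2 * s.
    apply: le_trans (cabs_le _) _ => /=.
    have -> : 2 * s = s + s by ring.
    by apply: lerD; rewrite ler_norml; lra.
  have := Hr (pt u v - pt x y); rewrite subrKC => /(_ (le_lt_trans l _)).
  move=> /(_ ltac:(lra)) /le_trans; apply; apply: ler_wpM2l => //; lra.
have ab : a <= b by lra.
have cd : c <= d by lra.
have ac : c <= c <= d by rewrite lexx.
have ac' : c <= d <= d by rewrite lexx andbT.
have aa : a <= a <= b by rewrite lexx.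
have aa' : a <= b <= b by rewrite lexx andbT.
set S := ((b - a)%:C)%C; set T := ((d - c)%:C)%C.
have E1 : cint a b (fun u => k (pt u c)) - cint a b (fun u => k (pt u d)) =
  cint a b (fun u => k (pt u c) - k (pt u d) + 'i%C * T * D) - S * ('i%C * T * D).
  rewrite cintD ?cint_cst //; last 2 first.
  - by apply: cintegrableB; [apply: holo_h hk _|apply: holo_h hk _].
  - exact: cintegrable_cst.
  rewrite cintB //; [|exact: holo_h hk _|exact: holo_h hk _].
  by rewrite -/S; ring.
have E2 : cint c d (fun v => k (pt b v)) - cint c d (fun v => k (pt a v)) =
  cint c d (fun v => k (pt b v) - k (pt a v) + - S * D) + T * S * D.
  rewrite cintD ?cint_cst //; last 2 first.
  - by apply: cintegrableB; [apply: holo_v hk _|apply: holo_v hk _].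
  - exact: cintegrable_cst.
  rewrite cintB //; [|exact: holo_v hk _|exact: holo_v hk _].
  by rewrite -/T; ring.
rewrite /rint E1 E2.
(* The two contributions of the linear part, [- i S T D] and [i T S D], cancel. *)
have -> (X Y : C) : X - S * ('i%C * T * D) + 'i%C * (Y + T * S * D) = X + 'i%C * Y by ring.
apply: le_trans (cabsD _ _) _; rewrite cabsM cabsi mul1r.
have B1 : cabs (cint a b (fun u => k (pt u c) - k (pt u d) + 'i%C * T * D)) <=
   2 * (e / 16 * (2 * s) + e / 16 * (2 * s)) * (b - a).
  apply: cint_bound => //.
    apply: cintegrableD; last exact: cintegrable_cst.
    by apply: cintegrableB; [apply: holo_h hk _|apply: holo_h hk _].
  move=> u ua.
  have -> : k (pt u c) - k (pt u d) + 'i%C * T * D =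
    (k (pt u c) - k (pt x y) - D * (pt u c - pt x y)) -
    (k (pt u d) - k (pt x y) - D * (pt u d - pt x y)).
    have -> : pt u d = pt u c + 'i%C * T by apply: complexP => /=; ring.
    by ring.
  by apply: le_trans (cabsBD _ _) _; apply: lerD; apply: near.
have B2 : cabs (cint c d (fun v => k (pt b v) - k (pt a v) + - S * D)) <=
   2 * (e / 16 * (2 * s) + e / 16 * (2 * s)) * (d - c).
  apply: cint_bound => //.
    apply: cintegrableD; last exact: cintegrable_cst.
    by apply: cintegrableB; [apply: holo_v hk _|apply: holo_v hk _].
  move=> u ua.
  have -> : k (pt b u) - k (pt a u) + - S * D =
    (k (pt b u) - k (pt x y) - D * (pt b u - pt x y)) -
    (k (pt a u) - k (pt x y) - D * (pt a u - pt x y)).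
    have -> : pt b u = pt a u + S by apply: complexP => /=; ring.
    by ring.
  by apply: le_trans (cabsBD _ _) _; apply: lerD; apply: near.
apply: le_trans (lerD B1 B2) _.
have W : 0 <= 2 * (e / 16 * (2 * s) + e / 16 * (2 * s)).
  by apply: mulr_ge0 => //; apply: addr_ge0; apply: mulr_ge0; lra.
apply: le_trans (lerD (ler_wpM2l W bas) (ler_wpM2l W dcs)) _.
by apply: eq_leW; field.
Qed.

(* Of the four quarters of a rectangle, one carries at least a quarter of the integral. *)
Lemma rint_quarter k a b c d M : a <= b -> c <= d -> holo_on k a b c d ->
  4 * M <= cabs (rint k a b c d) ->
  exists p : bool * bool,
    let a' := if p.1 then (a + b) / 2 else a in
    let c' := if p.2 then (c + d) / 2 else c in
    M <= cabs (rint k a' (a' + (b - a) / 2) c' (c' + (d - c) / 2)).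
Proof.
move=> ab cd hk HM.
have am : a <= (a + b) / 2 <= b by apply/andP; split; lra.
have cm : c <= (c + d) / 2 <= d by apply/andP; split; lra.
have /andP[am1 am2] := am; have /andP[cm1 cm2] := cm.
have ea : a <= a <= b by rewrite lexx.
have eb : a <= b <= b by rewrite lexx andbT.
have ec : c <= c <= d by rewrite lexx.
have ed : c <= d <= d by rewrite lexx andbT.
have hL : holo_on k a ((a + b) / 2) c d by apply: holo_sub hk.
have hR : holo_on k ((a + b) / 2) b c d by apply: holo_sub hk.
have E : rint k a b c d =
   (rint k a ((a + b) / 2) c ((c + d) / 2) + rint k a ((a + b) / 2) ((c + d) / 2) d) +
   (rint k ((a + b) / 2) b c ((c + d) / 2) + rint k ((a + b) / 2) b ((c + d) / 2) d).
  rewrite (rint_splitx am cd (holo_h hk ec) (holo_h hk ed)).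
  rewrite (rint_splity am1 cm) ?(rint_splity am2 cm) //; by apply: holo_v hk _.
have EB : (a + b) / 2 + (b - a) / 2 = b by field.
have EA : a + (b - a) / 2 = (a + b) / 2 by field.
have ED : (c + d) / 2 + (d - c) / 2 = d by field.
have EC : c + (d - c) / 2 = (c + d) / 2 by field.
apply: contrapT => /forallNP H.
have := H (false, false); have := H (false, true); have := H (true, false); have := H (true, true).
rewrite /= EA EB EC ED => /negP; rewrite -ltNge => h1 /negP; rewrite -ltNge => h2.
move=> /negP; rewrite -ltNge => h3 /negP; rewrite -ltNge => h4.
move: HM; rewrite E => HM.
have := le_trans HM (le_trans (cabsD _ _) (lerD (cabsD _ _) (cabsD _ _))).
by move: h1 h2 h3 h4; clear; lra.
Qed.

(** Repeated bisection keeps rectangles whose integral is at least [M / 4^n]. They shrink to a point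
    of the rectangle, and there differentiability, through [rint_small], yields a bound half as
    large. *)
Theorem goursat k a b c d : a <= b -> c <= d -> holo_on k a b c d -> rint k a b c d = 0.
Proof.
move=> ab cd hk; apply: cabs_eq0; apply/eqP; rewrite eq_le cabs_ge0 andbT leNgt.
apply/negP => M0.
set M := cabs (rint k a b c d) in M0.
pose w n : R := (b - a) / 2 ^+ n; pose v n : R := (d - c) / 2 ^+ n.
have w0 n : 0 <= w n by rewrite divr_ge0 ?exprn_ge0 // subr_ge0.
have v0 n : 0 <= v n by rewrite divr_ge0 ?exprn_ge0 // subr_ge0.
have wS n : w n.+1 = w n / 2 by rewrite /w exprS; field; rewrite expf_neq0.
have vS n : v n.+1 = v n / 2 by rewrite /v exprS; field; rewrite expf_neq0.
pose P n (q : R * R) := [/\ a <= q.1, q.1 + w n <= b, c <= q.2, q.2 + v n <= d &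
   M / 4 ^+ n <= cabs (rint k q.1 (q.1 + w n) q.2 (q.2 + v n))].
have step n q : P n q -> exists q', P n.+1 q' /\
   [/\ q.1 <= q'.1, q'.1 + w n.+1 <= q.1 + w n, q.2 <= q'.2 & q'.2 + v n.+1 <= q.2 + v n].
  case: q => q1 q2 [/= h1 h2 h3 h4 h5].
  have hk' : holo_on k q1 (q1 + w n) q2 (q2 + v n) by apply: holo_sub hk.
  have E4 : 4 * (M / 4 ^+ n.+1) = M / 4 ^+ n by rewrite exprS; field; rewrite expf_neq0.
  rewrite -E4 in h5.
  have [||p] := rint_quarter _ _ hk' h5; rewrite ?lerDl //.
  have -> : (q1 + w n - q1) / 2 = w n.+1 by rewrite wS; field.
  have -> : (q2 + v n - q2) / 2 = v n.+1 by rewrite vS; field.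
  move=> /= Hp.
  exists ((if p.1 then (q1 + (q1 + w n)) / 2 else q1), (if p.2 then (q2 + (q2 + v n)) / 2 else q2)).
  have := w0 n; have := v0 n => v0n w0n.
  have A1 : q1 <= (if p.1 then (q1 + (q1 + w n)) / 2 else q1) by case: (p.1); move: w0n v0n; clear; lra.
  have A2 : (if p.1 then (q1 + (q1 + w n)) / 2 else q1) + w n.+1 <= q1 + w n.
    by rewrite wS; case: (p.1); move: w0n v0n; clear; lra.
  have A3 : q2 <= (if p.2 then (q2 + (q2 + v n)) / 2 else q2) by case: (p.2); move: w0n v0n; clear; lra.
  have A4 : (if p.2 then (q2 + (q2 + v n)) / 2 else q2) + v n.+1 <= q2 + v n.
    by rewrite vS; case: (p.2); move: w0n v0n; clear; lra.
  split; last by split.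
  split => //=; [exact: le_trans A1|exact: le_trans A2 _|exact: le_trans A3|exact: le_trans A4 _].
have P0 : P 0%N (a, c).
  rewrite /P /= /w /v !expr0 !divr1 !subrKC; split => //; exact: lexx.
have [f [f0 fS]] : exists f : nat -> R * R, f 0%N = (a, c) /\
   forall n, P n (f n) -> P n.+1 (f n.+1) /\ [/\ (f n).1 <= (f n.+1).1,
     (f n.+1).1 + w n.+1 <= (f n).1 + w n, (f n).2 <= (f n.+1).2 &
     (f n.+1).2 + v n.+1 <= (f n).2 + v n].
  have ch (nq : nat * (R * R)) : exists q', P nq.1 nq.2 -> P nq.1.+1 q' /\
   [/\ nq.2.1 <= q'.1, q'.1 + w nq.1.+1 <= nq.2.1 + w nq.1, nq.2.2 <= q'.2 &
     q'.2 + v nq.1.+1 <= nq.2.2 + v nq.1].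
    have [/step[q' Hq]|nP] := pselect (P nq.1 nq.2); first by exists q'.
    by exists nq.2.
  have [g Hg] := choice ch.
  exists (fix F n := if n is m.+1 then g (m, F m) else (a, c)); split => // n Pn.
  exact: (Hg (n, _) Pn).
have Pf n : P n (f n) by elim: n => [|n IH]; [rewrite f0|have [] := fS _ IH].
have fmono n m : (f n).1 <= (f (n + m)%N).1 /\ (f (n + m)%N).1 + w (n + m)%N <= (f n).1 + w n /\ (f n).2 <= (f (n + m)%N).2 /\ (f (n + m)%N).2 + v (n + m)%N <= (f n).2 + v n.
  elim: m => [|m IHm]; first by rewrite addn0 !lexx.
  have [i1 [i2 [i3 i4]]] := IHm.
  rewrite addnS; have [_ [j1 j2 j3 j4]] := fS _ (Pf (n + m)%N).
  split; first exact: le_trans j1.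
  split; first exact: le_trans i2.
  by split; [exact: le_trans j3|exact: le_trans i4].
have fle n m : (f m).1 <= (f n).1 + w n /\ (f m).2 <= (f n).2 + v n.
  have [k1 [k2 [k3 k4]]] := fmono m (maxn n m - m)%N.
  have [l1 [l2 [l3 l4]]] := fmono n (maxn n m - n)%N.
  rewrite !subnKC ?leq_maxl ?leq_maxr // in k1 k2 k3 k4 l1 l2 l3 l4.
  split; [apply: le_trans k1 _; apply: le_trans l2 | apply: le_trans k3 _; apply: le_trans l4];
  by rewrite lerDl.
(* The common point of the nested rectangles is given by the suprema of the lower left corners: by
   [fle], no lower end exceeds any upper end. *)
have hs (h : nat -> R) (u : nat -> R) : (forall n m, h m <= h n + u n) ->
    forall n, h n <= sup (range h) <= h n + u n.
  move=> H n; apply/andP; split.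
    apply: ub_le_sup; last by exists n.
    by exists (h 0%N + u 0%N) => _ [m _ <-].
  by apply: ge_sup; [exists (h 0%N), 0%N|move=> _ [m _ <-]].
set x := sup (range (fun n => (f n).1)); set y := sup (range (fun n => (f n).2)).
have Hx n : (f n).1 <= x <= (f n).1 + w n by apply: (hs (fun n => (f n).1)) => i j; have [] := fle i j.
have Hy n : (f n).2 <= y <= (f n).2 + v n by apply: (hs (fun n => (f n).2)) => i j; have [] := fle i j.
have xab : a <= x <= b.
  have /andP[X1 X2] := Hx 0%N; rewrite f0 /= /w expr0 divr1 subrKC in X1 X2; by rewrite X1.
have ycd : c <= y <= d.
  have /andP[X1 X2] := Hy 0%N; rewrite f0 /= /v expr0 divr1 subrKC in X1 X2; by rewrite X1.
have [D HD] := hk _ _ xab ycd.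
(* The summand [1] makes [S] positive for a degenerate rectangle as well. *)
set S := (b - a) + (d - c) + 1.
have S0 : 0 < S by rewrite /S; move: ab cd; clear; lra.
(* With this choice [e (S / 2^n)^2] is half of [M / 4^n]. *)
have e0 : 0 < M / (2 * S ^+ 2) by rewrite divr_gt0 // mulr_gt0 // exprn_gt0.
have [r r0 Hr] := rint_small e0 HD.
have [n Hn] : exists n, S / 2 ^+ n < r.
  have /filter_ex[n Hn] := near_infty_natSinv_expn_lt (PosNum (divr_gt0 r0 S0)).
  exists n; move: Hn => /=.
  by rewrite ltr_pdivlMr // mulrC mul1r.
have [h1 h2 h3 h4 h5] := Pf n.
have := Hr (f n).1 ((f n).1 + w n) (f n).2 ((f n).2 + v n) (S / 2 ^+ n) _ _ Hn (Hx n) (Hy n).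
have pn : (0 : R) < 2 ^+ n by rewrite exprn_gt0.
rewrite !(addrC _ (w n)) !(addrC _ (v n)) !addrK => Hs.
have := Hs _ _ _.
rewrite !(addrC (w n)) !(addrC (v n)) => {}Hs.
have wl : w n <= S / 2 ^+ n by rewrite ler_pM2r ?invr_gt0 // /S; move: cd; clear; lra.
have vl : v n <= S / 2 ^+ n by rewrite ler_pM2r ?invr_gt0 // /S; move: ab; clear; lra.
have := Hs wl vl (holo_sub h1 h2 h3 h4 hk).
move/(le_trans h5).
have -> : M / (2 * S ^+ 2) * (S / 2 ^+ n) ^+ 2 = M / 4 ^+ n / 2.
  rewrite (_ : (4 : R) ^+ n = 2 ^+ n * 2 ^+ n); first by field; apply/andP; split; apply: lt0r_neq0.
  by rewrite -exprMn; congr (_ ^+ _); ring.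
have : 0 < M / 4 ^+ n by rewrite divr_gt0 // exprn_gt0.
by clear; lra.
Qed.

End Goursat.

(** * Cauchy's formula on rectangles, as a lower bound *)

Section CauchyRectangle.
Variable R : realType.
Local Notation C := (R[i]).
Local Notation mu := (@lebesgue_measure R).
Implicit Types (a b c d x y s e : R) (k phi : C -> C).

Lemma rint_bound k a b c d M : a <= b -> c <= d ->
  cintegrable a b (fun x => k (pt x c)) -> cintegrable a b (fun x => k (pt x d)) ->
  cintegrable c d (fun y => k (pt a y)) -> cintegrable c d (fun y => k (pt b y)) ->
  (forall x y, a <= x <= b -> c <= y <= d -> (x == a) || (x == b) || (y == c) || (y == d) ->
     cabs (k (pt x y)) <= M) ->
  cabs (rint k a b c d) <= 4 * M * (b - a) + 4 * M * (d - c).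
Proof.
move=> ab cd i1 i2 i3 i4 H.
have B1 : cabs (cint a b (fun x => k (pt x c))) <= 2 * M * (b - a).
  by apply: cint_bound => // x xab; apply: H; rewrite ?lexx ?eqxx ?orbT.
have B2 : cabs (cint a b (fun x => k (pt x d))) <= 2 * M * (b - a).
  by apply: cint_bound => // x xab; apply: H; rewrite ?lexx ?eqxx ?orbT ?andbT.
have B3 : cabs (cint c d (fun y => k (pt a y))) <= 2 * M * (d - c).
  by apply: cint_bound => // x xab; apply: H; rewrite ?lexx ?eqxx ?orbT.
have B4 : cabs (cint c d (fun y => k (pt b y))) <= 2 * M * (d - c).
  by apply: cint_bound => // x xab; apply: H; rewrite ?lexx ?eqxx ?orbT ?andbT.
rewrite /rint; apply: (le_trans (cabsD _ _)); rewrite cabsM cabsi mul1r.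
apply: (le_trans (lerD (cabsBD _ _) (cabsBD _ _))).
by move: B1 B2 B3 B4; clear; lra.
Qed.

Definition holo_off k (z : C) := forall w, w != z -> exists D, cder k w D.

Lemma holo_off_h k a b x1 x2 y : holo_off k (pt a b) -> y != b ->
  cintegrable x1 x2 (fun x => k (pt x y)).
Proof.
move=> H yb; apply: ccontinuous_cintegrable => x _.
have [|D] := H (pt x y); first by apply: contra yb => /eqP[_ ->].
exact: cder_ccontinuous_h.
Qed.

Lemma holo_off_v k a b y1 y2 x : holo_off k (pt a b) -> x != a ->
  cintegrable y1 y2 (fun y => k (pt x y)).
Proof.
move=> H xa; apply: ccontinuous_cintegrable => y _.
have [|D] := H (pt x y); first by apply: contra xa => /eqP[-> _].
exact: cder_ccontinuous_v.
Qed.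

(** What surrounds the small square is cut into four rectangles that avoid the singular point; by
    Goursat's theorem each contributes zero. *)
Lemma rint_shrink k a b x1 x2 y1 y2 s : holo_off k (pt a b) -> 0 < s ->
  x1 <= a - s -> a + s <= x2 -> y1 <= b - s -> b + s <= y2 ->
  rint k x1 x2 y1 y2 = rint k (a - s) (a + s) (b - s) (b + s).
Proof.
move=> H s0 h1 h2 h3 h4.
have G x x' y y' : x <= x' -> y <= y' -> ~~ ((x <= a <= x') && (y <= b <= y')) ->
   rint k x x' y y' = 0.
  move=> xx yy nab; apply: goursat => // u v ux vy; apply: H.
  by apply: contra nab => /eqP[<- <-]; rewrite ux.
have n1 : y1 != b by apply/eqP; lra.
have n2 : y2 != b by apply/eqP; lra.
have n3 : a - s != a by apply/eqP; lra.
have n4 : a + s != a by apply/eqP; lra.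
rewrite (@rint_splitx _ _ _ (a - s)) //; [|lra|lra|exact: holo_off_h H n1|exact: holo_off_h H n2].
rewrite G; [|lra|lra|by apply/negP => /andP[/andP[? ?] _]; lra].
rewrite (@rint_splitx _ _ _ (a + s)) //; [|lra|lra|exact: holo_off_h H n1|exact: holo_off_h H n2].
rewrite (G (a + s)); [|lra|lra|by apply/negP => /andP[/andP[? ?] _]; lra].
rewrite (@rint_splity _ _ _ _ _ (b - s)) //; [|lra|lra|exact: holo_off_v H n3|exact: holo_off_v H n4].
rewrite G; [|lra|lra|by apply/negP => /andP[_ /andP[? ?]]; lra].
rewrite (@rint_splity _ _ _ _ _ (b + s)) //; [|lra|lra|exact: holo_off_v H n3|exact: holo_off_v H n4].
rewrite (G _ _ (b + s)); [|lra|lra|by apply/negP => /andP[_ /andP[? ?]]; lra].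
by rewrite add0r addr0 add0r addr0.
Qed.

Lemma rintB k l a b c d (u : C) :
  cintegrable a b (fun x => k (pt x c)) -> cintegrable a b (fun x => k (pt x d)) ->
  cintegrable c d (fun y => k (pt a y)) -> cintegrable c d (fun y => k (pt b y)) ->
  cintegrable a b (fun x => l (pt x c)) -> cintegrable a b (fun x => l (pt x d)) ->
  cintegrable c d (fun y => l (pt a y)) -> cintegrable c d (fun y => l (pt b y)) ->
  rint (fun w => k w - u * l w) a b c d = rint k a b c d - u * rint l a b c d.
Proof.
move=> k1 k2 k3 k4 l1 l2 l3 l4; rewrite /rint.
rewrite !cintB ?cintM //; try exact: cintegrableM.
by ring.
Qed.

Lemma pt_surj (z : C) : z = pt (complex.Re z) (complex.Im z).
Proof. by case: z. Qed.

Lemma holo_off_inv (z : C) : holo_off (fun w => (w - z)^-1) z.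
Proof.
move=> w wz; have wz0 : w - z != 0 by rewrite subr_eq0.
eexists; apply: (@cder_comp _ (fun w => w^-1) (fun w => w - z)); first exact: cderV.
by apply: cderB; [exact: cder_id|exact: cder_cst].
Qed.

Lemma holo_offM k l (z : C) : holo_off k z -> holo_off l z -> holo_off (fun w => k w * l w) z.
Proof.
move=> Hk Hl w wz; have [D HD] := Hk _ wz; have [E HE] := Hl _ wz.
by eexists; apply: cderM; [exact: HD|exact: HE].
Qed.

Lemma holo_offB k l (z : C) : holo_off k z -> holo_off l z -> holo_off (fun w => k w - l w) z.
Proof.
move=> Hk Hl w wz; have [D HD] := Hk _ wz; have [E HE] := Hl _ wz.
by eexists; apply: cderB; [exact: HD|exact: HE].
Qed.

Lemma holo_off_cst (c z : C) : holo_off (fun=> c) z.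
Proof. by move=> w _; exists 0; exact: cder_cst. Qed.

(* A lower bound for [|2 pi i|]; it suffices for the estimates below and spares the evaluation
   of the integral. *)
Lemma rint_inv a b s : 0 < s ->
  4 <= cabs (rint (fun w => (w - pt a b)^-1) (a - s) (a + s) (b - s) (b + s)).
Proof.
move=> s0; have H := @holo_off_inv (pt a b).
have n1 : b - s != b by apply/eqP; lra.
have n2 : b + s != b by apply/eqP; lra.
have n3 : a - s != a by apply/eqP; lra.
have n4 : a + s != a by apply/eqP; lra.
rewrite /rint -!cintB; try by [exact: holo_off_h H _|exact: holo_off_v H _].
set I1 := cint _ _ _; set I2 := cint _ _ _.
apply: le_trans (Im_le_cabs _); apply: le_trans (ler_norm _).
have nz u v : pt u v - pt a b = pt (u - a) (v - b) by apply: complexP.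
have low (q : R) (p : C -> R) (F : R -> C) : (forall z w, `|p z - p w| <= cabs (z - w)) ->
   (forall x, ccontinuous F x) ->
   (forall x, q - s <= x <= q + s -> s^-1 <= p (F x)) ->
   2 <= \int[mu]_(x in `[q - s, q + s]) p (F x).
  move=> Hp cF Hx.
  have -> : 2 = \int[mu]_(x in `[q - s, q + s]) s^-1.
    have E : fine (mu `[q - s, q + s]) = 2 * s.
      by rewrite lebesgue_measure_itv /= lte_fin ltrD2l gtrN //=; ring.
    by rewrite Rintegral_cst // E; field; rewrite lt0r_neq0.
  apply: le_Rintegral => //.
  - have := cintegrable_cst (q - s) (q + s) ((s^-1)%:C)%C; by case.
  - by apply: ccontinuous_integrable.
have cc F1 F2 x : ccontinuous F1 x -> ccontinuous F2 x -> ccontinuous (fun t => F1 t - F2 t : C) x.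
  move=> c1 c2 e e0; have e20 : 0 < e / 2 by lra.
  have [r1 r10 h1] := c1 _ e20; have [r2 r20 h2] := c2 _ e20.
  exists (Num.min r1 r2); first by rewrite lt_min r10.
  move=> t; rewrite lt_min => /andP[/h1 {}h1 /h2 {}h2].
  have -> : F1 (x + t) - F2 (x + t) - (F1 x - F2 x) = (F1 (x + t) - F1 x) - (F2 (x + t) - F2 x) by ring.
  by apply: le_trans (cabsBD _ _) _; lra.
have ch y x : y != b -> ccontinuous (fun x => (pt x y - pt a b)^-1) x.
  move=> yb; have [|D HD] := H (pt x y); first by apply: contra yb => /eqP[_ ->].
  exact: cder_ccontinuous_h HD.
have cv y x : x != a -> ccontinuous (fun y => (pt x y - pt a b)^-1) y.
  move=> yb; have [|D HD] := H (pt x y); first by apply: contra yb => /eqP[-> _].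
  exact: cder_ccontinuous_v HD.
have invE u v : (pt u v : C)^-1 = pt (u / (u ^+ 2 + v ^+ 2)) (- (v / (u ^+ 2 + v ^+ 2))) by [].
(* On either pair of opposite sides the relevant part of the integrand is [2 s / (t^2 + s^2)], which
   is at least [1 / s]; over a length [2 s] each pair gives at least [2]. *)
have bnd t : - s <= t <= s -> s^-1 <= (s / (t ^+ 2 + s ^+ 2)) * 2.
  move=> /andP[t1 t2].
  have ts : t ^+ 2 <= s ^+ 2 by have : 0 <= (s - t) * (s + t) by [apply: mulr_ge0; lra]; move: t1; clear; lra.
  have p0 : 0 < t ^+ 2 + s ^+ 2 by rewrite ltr_wpDl ?sqr_ge0 // exprn_gt0.
  rewrite -(@ler_pM2r _ (t ^+ 2 + s ^+ 2)) // mulrAC divfK ?lt0r_neq0 //.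
  rewrite -(@ler_pM2l _ s) // mulrA divff ?lt0r_neq0 // mul1r; move: ts; clear; lra.
have L1 : 2 <= complex.Im I1.
  apply: (low a (@complex.Im R)) => [z w|x|x /andP[x1 x2]]; first exact: ImB_le.
    by apply: cc; exact: ch.
  rewrite !nz !invE /=.
  have -> : b - s - b = - s by ring.
  have -> : b + s - b = s by ring.
  rewrite sqrrN mulNr opprK -mulr2n -mulr_natr; apply: bnd; lra.
have L2 : 2 <= complex.Re I2.
  apply: (low b (@complex.Re R)) => [z w|x|x /andP[x1 x2]]; first exact: ReB_le.
    by apply: cc; exact: cv.
  rewrite !nz !invE /=.
  have -> : a - s - a = - s by ring.
  have -> : a + s - a = s by ring.
  rewrite sqrrN mulNr opprK -mulr2n -mulr_natr addrC; apply: bnd; lra.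
have -> : complex.Im (I1 + 'i%C * I2) = complex.Im I1 + complex.Re I2.
  by case: I1 {L1} => ? ?; case: I2 {L2} => ? ? /=; ring.
by move: L1 L2; clear; lra.
Qed.

Lemma boundary_far a b s x y : 0 < s ->
  (x == a - s) || (x == a + s) || (y == b - s) || (y == b + s) -> s <= cabs (pt x y - pt a b).
Proof.
move=> s0; have re := Re_le_cabs (pt x y - pt a b); have im := Im_le_cabs (pt x y - pt a b).
have sN : `|- s| = s by rewrite normrN gtr0_norm.
case/orP => [/orP[/orP[]|]|] /eqP E; [apply: le_trans re|apply: le_trans re|apply: le_trans im|apply: le_trans im];
  by rewrite E /= addrAC subrr add0r ?sN ?gtr0_norm.
Qed.

(** The integral of [(phi w - L) / (w - z)] vanishes, since it can be moved to arbitrarily small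
    squares; what remains is [L] times the integral of [1 / (w - z)]. It is used with a difference
    quotient for [phi], where [L] is a derivative, and with [phi] entire, where [L] is its value at
    the point. *)
Lemma cauchy_rect phi (L : C) a b x1 x2 y1 y2 :
  holo_off phi (pt a b) ->
  (forall e, 0 < e -> exists2 r : R, 0 < r & forall w, w != pt a b ->
     cabs (w - pt a b) < r -> cabs (phi w - L) <= e) ->
  x1 < a -> a < x2 -> y1 < b -> b < y2 ->
  4 * cabs L <= cabs (rint (fun w => phi w * (w - pt a b)^-1) x1 x2 y1 y2).
Proof.
move=> H lim xa ax yb by_.
set z := pt a b.
have Hi := @holo_off_inv z.
have Hp := holo_offM H Hi.
pose s1 := Num.min (Num.min (a - x1) (x2 - a)) (Num.min (b - y1) (y2 - b)).
have s10 : 0 < s1 by rewrite !lt_min !subr_gt0 xa ax yb.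
have HK : holo_off (fun w => phi w * (w - z)^-1 - L * (w - z)^-1) z.
  by apply: holo_offB => //; apply: holo_offM => //; exact: holo_off_cst.
have sh k s : holo_off k z -> 0 < s -> s <= s1 -> rint k x1 x2 y1 y2 = rint k (a - s) (a + s) (b - s) (b + s).
  move=> Hk s0; rewrite !le_min => /andP[/andP[? ?] /andP[? ?]].
  by apply: rint_shrink => //; lra.
have K0 : rint (fun w => phi w * (w - z)^-1 - L * (w - z)^-1) x1 x2 y1 y2 = 0.
  apply: cabs_eq0; apply/eqP; rewrite eq_le cabs_ge0 andbT leNgt; apply/negP => M0.
  set M := cabs _ in M0.
  (* On a square of half-side [s] the integrand is then at most [M / (32 s)], and [rint_bound] gives
     [M / 2]. *)
  have M160 : 0 < M / 32 by rewrite divr_gt0.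
  have [r r0 Hr] := lim _ M160.
  pose s := Num.min s1 (r / 3).
  have s0 : 0 < s by rewrite lt_min s10 divr_gt0.
  have ss1 : s <= s1 by rewrite ge_min lexx.
  have sr : s <= r / 3 by rewrite ge_min lexx orbT.
  have n1 : b - s != b by apply/eqP; lra.
  have n2 : b + s != b by apply/eqP; lra.
  have n3 : a - s != a by apply/eqP; lra.
  have n4 : a + s != a by apply/eqP; lra.
  have : M <= 4 * (M / 32 / s) * (a + s - (a - s)) + 4 * (M / 32 / s) * (b + s - (b - s)).
    rewrite {1}/M (sh _ _ HK s0 ss1); apply: rint_bound; rewrite ?lerD2l ?lerBlDr; try lra.
    - exact: holo_off_h HK n1.
    - exact: holo_off_h HK n2.
    - exact: holo_off_v HK n3.
    - exact: holo_off_v HK n4.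
    move=> x y /andP[xx xx'] /andP[yy yy'] bd.
    have sle : s <= cabs (pt x y - z) by exact: boundary_far.
    have les : cabs (pt x y - z) < r.
      apply: le_lt_trans (cabs_le _) _ => /=.
      have l1 : `|x - a| <= s by rewrite ler_norml; lra.
      have l2 : `|y - b| <= s by rewrite ler_norml; lra.
      lra.
    rewrite -mulrBl cabsM cabsV; apply: ler_pM => //; rewrite ?invr_ge0 //.
      apply: Hr => //; apply/eqP => E; move: sle; rewrite E subrr cabs0; lra.
    by rewrite lef_pV2 // posrE // (lt_le_trans s0).
  have -> : 4 * (M / 32 / s) * (a + s - (a - s)) + 4 * (M / 32 / s) * (b + s - (b - s)) = M / 2.
    by field; rewrite lt0r_neq0.
  by move: M0; clear; lra.
have n1 : y1 != b by rewrite lt_eqF.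
have n2 : y2 != b by rewrite gt_eqF.
have n3 : x1 != a by rewrite lt_eqF.
have n4 : x2 != a by rewrite gt_eqF.
rewrite rintB in K0; try by [exact: holo_off_h Hp _|exact: holo_off_v Hp _|exact: holo_off_h Hi _|exact: holo_off_v Hi _].
move/eqP: K0; rewrite subr_eq0 => /eqP ->.
rewrite cabsM mulrC; apply: ler_wpM2l => //.
by rewrite (sh _ s1) //; exact: rint_inv.
Qed.

End CauchyRectangle.

(** * Cauchy estimates, quantitative Taylor bounds, and differentiability of the derivative *)

Section CauchyEstimates.
Variable R : realType.
Local Notation C := (R[i]).
Local Notation mu := (@lebesgue_measure R).
Implicit Types (f df : C -> C) (z w h : C).

(** [cauchy_rect] for the difference quotient at [z], on the square of half-side [s = r / 2], which
    lies in the disk of radius [r]. On its boundary the quotient over [w - z] is at most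
    [2 M / s^2], so that [4 |f'(z)| <= 64 M / r]. *)
Lemma cauchy_estimate f df z (r M : R) : 0 < r -> (forall w, cder f w (df w)) ->
  (forall w, cabs (w - z) <= r -> cabs (f w) <= M) -> cabs (df z) <= 16 * M / r.
Proof.
move=> r0 Hf HM.
set a := complex.Re z; set b := complex.Im z.
have zE : z = pt a b by exact: pt_surj.
pose s := r / 2; have s0 : 0 < s by rewrite divr_gt0.
have M0 : 0 <= M by apply: le_trans (HM z _) => //; rewrite subrr cabs0 ltW.
pose phi w := (f w - f z) * (w - z)^-1.
have Hphi : holo_off phi (pt a b).
  rewrite -zE; apply: holo_offM; last exact: holo_off_inv.
  apply: holo_offB; last exact: holo_off_cst.
  by move=> w _; exists (df w).
have lim e : 0 < e -> exists2 r : R, 0 < r & forall w, w != pt a b ->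
     cabs (w - pt a b) < r -> cabs (phi w - df z) <= e.
  move=> e0; have [d d0 Hd] := Hf z e e0; exists d => // w.
  rewrite -zE => wz /Hd; rewrite subrKC => H.
  have wz0 : w - z != 0 by rewrite subr_eq0.
  rewrite -(@ler_pM2r _ (cabs (w - z))) ?cabs_gt0 // -cabsM.
  by rewrite (_ : (phi w - df z) * (w - z) = f w - f z - df z * (w - z)) // /phi; field.
have sq x : x - s < x by rewrite gtrBl.
have sq' x : x < x + s by rewrite ltrDl.
have := cauchy_rect Hphi lim (sq a) (sq' a) (sq b) (sq' b).
have Hp : holo_off (fun w => phi w * (w - pt a b)^-1) (pt a b).
  by apply: holo_offM => //; exact: holo_off_inv.
have n1 : b - s != b by rewrite lt_eqF.
have n2 : b + s != b by rewrite gt_eqF.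
have n3 : a - s != a by rewrite lt_eqF.
have n4 : a + s != a by rewrite gt_eqF.
have B : cabs (rint (fun w => phi w * (w - pt a b)^-1) (a - s) (a + s) (b - s) (b + s)) <=
   4 * (2 * M / s / s) * (a + s - (a - s)) + 4 * (2 * M / s / s) * (b + s - (b - s)).
  apply: rint_bound; rewrite ?lerD2l ?lerBlDr; try by (move: s0; clear; lra).
  - exact: holo_off_h Hp n1.
  - exact: holo_off_h Hp n2.
  - exact: holo_off_v Hp n3.
  - exact: holo_off_v Hp n4.
  move=> x y /andP[xx xx'] /andP[yy yy'] bd; rewrite -zE.
  have sle : s <= cabs (pt x y - z) by rewrite zE; exact: boundary_far.
  have les : cabs (pt x y - z) <= r.
    rewrite zE; apply: le_trans (cabs_le _) _ => /=.
    have l1 : `|x - a| <= s by rewrite ler_norml; move: xx xx'; clear; lra.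
    have l2 : `|y - b| <= s by rewrite ler_norml; move: yy yy'; clear; lra.
    by rewrite /s in l1 l2; move: l1 l2; clear; lra.
  have iv : (cabs (pt x y - z))^-1 <= s^-1 by rewrite lef_pV2 // posrE // (lt_le_trans s0).
  rewrite /phi !cabsM !cabsV; apply: ler_pM; rewrite ?invr_ge0 ?mulr_ge0 ?invr_ge0 //.
  apply: ler_pM; rewrite ?invr_ge0 //.
  apply: le_trans (cabsBD _ _) _; rewrite mulr2n mulrDl mul1r; apply: lerD; apply: HM => //.
  by rewrite subrr cabs0 ltW.
move=> /le_trans/(_ B).
have -> : 4 * (2 * M / s / s) * (a + s - (a - s)) + 4 * (2 * M / s / s) * (b + s - (b - s)) = 4 * (16 * M / r).
  by rewrite /s; field; rewrite lt0r_neq0.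
by rewrite ler_pM2l.
Qed.

Lemma real_is_derive (u : R -> R) (t d : R) :
  (forall e : R, 0 < e -> exists2 r : R, 0 < r & forall s : R, `|s| < r -> `|u (t + s) - u t - d * s| <= e * `|s|) ->
  is_derive t 1 u d.
Proof.
move=> H.
have Hc : (fun h : R => h^-1 *: (((u : R^o -> R^o) \o shift t) (h *: (1 : R^o)) - u t)) @ 0^' --> (d : R^o).
  apply/cvgrPdist_le => e e0; have [r r0 Hr] := H e e0.
  exists r => // h; rewrite /ball /= sub0r normrN => hr h0.
  rewrite /GRing.scale /= mulr1 -(@ler_pM2r _ `|h|) ?normr_gt0 // -normrM.
  rewrite (_ : (d - h^-1 * (u (h + t) - u t)) * h = - (u (t + h) - u t - d * h)); last first.
    by rewrite (addrC h t); field.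
  by rewrite normrN Hr.
apply: DeriveDef; first by apply/cvg_ex; exists d.
by apply: cvg_lim.
Qed.

(** [p] is to be the real or the imaginary part. *)
Lemma cder_line f df z h (p : C -> R) (t : R) : (forall w, cder f w (df w)) ->
  (forall w, `|p w| <= cabs w) -> (forall w w', p (w - w') = p w - p w') ->
  (forall (s : R) w, p (w * (s%:C)%C) = p w * s) ->
  is_derive t 1 (fun s => p (f (z + (s%:C)%C * h))) (p (df (z + (t%:C)%C * h) * h)).
Proof.
move=> Hf Hp pB pZ; apply: real_is_derive => e e0.
have e1 : 0 < e / (cabs h + 1) by rewrite divr_gt0 // ltr_wpDl.
have [r r0 Hr] := Hf (z + (t%:C)%C * h) _ e1.
have A0 : 0 < cabs h + 1 by rewrite ltr_wpDl.
exists (r / (cabs h + 1)); first by rewrite divr_gt0.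
move=> s; rewrite ltr_pdivlMr // => sr.
rewrite -pZ -!pB.
have E : (((t + s)%:C)%C * h : C) = (t%:C)%C * h + (s%:C)%C * h by rewrite rmorphD mulrDl.
have cs : cabs ((s%:C)%C * h) <= `|s| * (cabs h + 1).
  by rewrite cabsM cabs_real ler_wpM2l // lerDl.
have := Hr ((s%:C)%C * h) (le_lt_trans cs sr).
rewrite E addrA (mulrC (s%:C)%C h) mulrA => H.
apply: le_trans (Hp _) _; apply: le_trans H _.
rewrite (mulrC h); apply: le_trans (ler_wpM2l (ltW e1) cs) _.
by rewrite mulrCA divfK ?lt0r_neq0 // mulrC.
Qed.

Lemma is_derive_within (u du : R -> R) (a b : R) : (forall t : R, is_derive t 1 u (du t)) ->
  {within `[a, b], continuous u}.
Proof.
move=> H; apply: continuous_subspaceT => t.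
by apply: differentiable_continuous; apply/derivable1_diffP; case: (H t).
Qed.

Lemma cder_line_Re f df z h (t : R) : (forall w, cder f w (df w)) ->
  is_derive t 1 (fun s => complex.Re (f (z + (s%:C)%C * h))) (complex.Re (df (z + (t%:C)%C * h) * h)).
Proof.
move=> Hf; apply: (@cder_line f df z h (@complex.Re R)) => //.
- exact: Re_le_cabs.
- by case=> ? ?; case.
- by move=> s; case=> u v /=; rewrite mulr0 subr0.
Qed.

Lemma cder_line_Im f df z h (t : R) : (forall w, cder f w (df w)) ->
  is_derive t 1 (fun s => complex.Im (f (z + (s%:C)%C * h))) (complex.Im (df (z + (t%:C)%C * h) * h)).
Proof.
move=> Hf; apply: (@cder_line f df z h (@complex.Im R)) => //.
- exact: Im_le_cabs.
- by case=> ? ?; case.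
- by move=> s; case=> u v /=; rewrite mulr0 add0r.
Qed.

(** The real mean value theorem is applied to the real and the imaginary part; their intermediate
    points differ, whence the factor [2]. *)
Lemma mean_value f df z h (M : R) : (forall w, cder f w (df w)) ->
  (forall t : R, 0 <= t <= 1 -> cabs (df (z + (t%:C)%C * h)) <= M) ->
  cabs (f (z + h) - f z) <= 2 * M * cabs h.
Proof.
move=> Hf HM.
have D1 t := cder_line_Re z h t Hf; have D2 t := cder_line_Im z h t Hf.
have [c1 c1I E1] := MVT_segment ler01 (fun t _ => D1 t) (@is_derive_within _ _ 0 1 D1).
have [c2 c2I E2] := MVT_segment ler01 (fun t _ => D2 t) (@is_derive_within _ _ 0 1 D2).
move: E1 E2; rewrite !mul1r !mul0r !addr0 subr0 !mulr1 => E1 E2.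
apply: le_trans (cabs_le _) _.
have -> : complex.Re (f (z + h) - f z) = complex.Re (f (z + h)) - complex.Re (f z).
  by case: (f _) => ? ?; case: (f _).
have -> : complex.Im (f (z + h) - f z) = complex.Im (f (z + h)) - complex.Im (f z).
  by case: (f (z + h)) => ? ?; case: (f _).
rewrite E1 E2 (_ : 2 * M * cabs h = M * cabs h + M * cabs h); last by ring.
rewrite !in_itv /= in c1I c2I.
by apply: lerD; [apply: le_trans (Re_le_cabs _) _|apply: le_trans (Im_le_cabs _) _];
  rewrite cabsM; apply: ler_wpM2r => //; exact: HM.
Qed.

Lemma cabs_line z w h (t r : R) : 0 <= t <= 1 -> cabs (z - w) <= r ->
  cabs (z + (t%:C)%C * h - w) <= r + cabs h.
Proof.
move=> /andP[t0 t1] zw.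
rewrite addrAC; apply: le_trans (cabsD _ _) _; apply: lerD => //.
by rewrite cabsM cabs_real ger0_norm // ler_piMl.
Qed.

Section Local.
Variables (f df : C -> C) (z : C) (M : R).
Hypothesis Hf : forall w, cder f w (df w).
Hypothesis HM : forall w, cabs (w - z) <= 4 -> cabs (f w) <= M.

(** Here and in the next two lemmas one unit of the radius [4] is spent on a Cauchy estimate of
    radius [1] or on an increment of size at most [1]. The constants depend on [M] only, so the
    bounds are uniform over families with a common [M]. *)
Lemma local_df w : cabs (w - z) <= 3 -> cabs (df w) <= 16 * M.
Proof.
move=> wz; rewrite -[leRHS]divr1; apply: (cauchy_estimate ltr01 Hf) => u uw.
apply: HM; rewrite (_ : u - z = (u - w) + (w - z)); last by ring.
by apply: le_trans (cabsD _ _) _; lra.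
Qed.

Lemma local_lip w h : cabs (w - z) <= 2 -> cabs h <= 1 -> cabs (f (w + h) - f w) <= 32 * M * cabs h.
Proof.
move=> wz h1; have -> : 32 * M = 2 * (16 * M) by ring.
apply: (mean_value Hf) => t t01; apply: local_df.
by have := cabs_line h t01 wz; lra.
Qed.

(** The Cauchy estimate is applied to [x |-> f (x + h) - f x], so that no second derivative is
    involved. *)
Lemma local_dlip w h : cabs (w - z) <= 1 -> cabs h <= 1 -> cabs (df (w + h) - df w) <= 16 * (32 * M) * cabs h.
Proof.
move=> wz h1.
have D u : cder (fun x => f (x + h) - f x) u (df (u + h) - df u).
  by apply: cderB => //; apply: cder_shift.
have -> : 16 * (32 * M) * cabs h = 16 * (32 * M * cabs h) / 1 by rewrite divr1; ring.
apply: (@cauchy_estimate (fun x => f (x + h) - f x) (fun u => df (u + h) - df u)) => // u uw.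
apply: local_lip => //; rewrite (_ : u - z = (u - w) + (w - z)); last by ring.
by apply: le_trans (cabsD _ _) _; lra.
Qed.

Lemma local_taylor w h : cabs (w - z) <= 1 -> cabs h <= 1 ->
  cabs (f (w + h) - f w - df w * h) <= 2 * (16 * (32 * M)) * cabs h ^+ 2.
Proof.
move=> wz h1.
have D u : cder (fun x => f x - df w * x) u (df u - df w).
  by apply: cderB => //; rewrite -[X in cder _ _ X]mulr1; apply: cderZ; exact: cder_id.
have -> : f (w + h) - f w - df w * h = (f (w + h) - df w * (w + h)) - (f w - df w * w) by ring.
have -> : 2 * (16 * (32 * M)) * cabs h ^+ 2 = 2 * (16 * (32 * M) * cabs h) * cabs h by ring.
apply: (mean_value D) => t /andP[t0 t1].
have ct : cabs ((t%:C)%C * h) <= cabs h by rewrite cabsM cabs_real ger0_norm // ler_piMl.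
have M0 : 0 <= M by apply: (le_trans (cabs_ge0 (f w))); apply: HM; apply: (le_trans wz); rewrite ler1n.
apply: le_trans (local_dlip wz _) _; first exact: le_trans h1.
by apply: ler_wpM2l => //; rewrite !mulr_ge0.
Qed.

End Local.

Lemma cder_quadratic f z d (A r : R) : 0 < r ->
  (forall h, cabs h < r -> cabs (f (z + h) - f z - d * h) <= A * cabs h ^+ 2) -> cder f z d.
Proof.
move=> r0 H e e0.
have B0 : 0 < `|A| + 1 by rewrite ltr_wpDl.
exists (Num.min r (e / (`|A| + 1))); first by rewrite lt_min r0 divr_gt0.
move=> h; rewrite lt_min ltr_pdivlMr // => /andP[/H {}H hr].
apply: le_trans H _; rewrite expr2 mulrA; apply: ler_wpM2r => //.
apply: le_trans (ltW hr); rewrite mulrC; apply: ler_wpM2l => //.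
by apply: le_trans (ler_norm _) _; rewrite lerDl.
Qed.

Lemma entire_continuous (f : C -> C) : entire f -> continuous (fun u : R * R => cabs (f (of_pair u))).
Proof.
move=> /entire_cder Hf.
move=> [x y]; apply/cvgrPdist_le => e e0 /=.
have [d d0 Hd] := cder_lip (Hf (of_pair (x, y))).
set D := cabs (cderiv _ _) in Hd.
have D0 : 0 < D + 1 by rewrite ltr_wpDl // cabs_ge0.
pose s := Num.min (d / 2) (e / (D + 1) / 2).
have s0 : 0 < s by rewrite lt_min !divr_gt0.
exists (ball (x : R^o) s, ball (y : R^o) s) => /=; first by split; exact: nbhsx_ballx.
move=> u [/= u1 u2].
have {}u1 : `|x - u.1| < s by [].
have {}u2 : `|y - u.2| < s by [].
have cu : cabs (of_pair u - of_pair (x, y)) < d /\ cabs (of_pair u - of_pair (x, y)) <= e / (D + 1).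
  have := cabs_le (of_pair u - of_pair (x, y)) => /=.
  rewrite (distrC u.1) (distrC u.2).
  move: u1 u2; rewrite !lt_min => /andP[a1 a2] /andP[b1 b2] c; split.
    by move: a1 b1 c; clear; lra.
  by move: a2 b2 c; clear; lra.
rewrite distrC; apply: le_trans (cabsB_le _ _) _.
have := Hd _ cu.1; rewrite subrKC => /le_trans; apply.
by rewrite mulrC -ler_pdivlMr //; exact: cu.2.
Qed.

Lemma entire_bounded f (r : R) : entire f -> exists2 M, 0 <= M & forall w, cabs w <= r -> cabs (f w) <= M.
Proof.
move=> ef; have [r0|r0] := ltP r 0.
  by exists 0 => // w; have := cabs_ge0 w; move=> h1 h2; have := le_trans h1 h2; rewrite leNgt r0.
pose g (u : R * R) := cabs (f (of_pair u)).
pose A := (`[- r, r] `*` `[- r, r])%classic : set (R * R).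
have cg : continuous g by exact: entire_continuous.
have [|||c _ Hc] := @compact_EVT_max _ R g A.
- by exists (0, 0); split => /=; rewrite in_itv /=; apply/andP; split; lra.
- by apply: compact_setX; exact: segment_compact.
- exact: continuous_subspaceT.
exists (g c); first exact: cabs_ge0.
move=> w wr; rewrite [w]pt_surj; apply: (Hc (complex.Re w, complex.Im w)).
by rewrite inE; split => /=; rewrite in_itv /= -ler_norml; apply: le_trans wr;
  [exact: Re_le_cabs|exact: Im_le_cabs].
Qed.

Lemma entire_bounded_at f z (r : R) : entire f ->
  exists2 M, 0 <= M & forall w, cabs (w - z) <= r -> cabs (f w) <= M.
Proof.
move=> ef; have [M M0 HM] := @entire_bounded f (cabs z + r) ef; exists M => // w wz; apply: HM.
by have := cabsD (w - z) z; rewrite subrK; lra.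
Qed.

(** The limit is the supremum of the lower bounds [u n - A / (n + 1)]. *)
Lemma cauchy_harmonic (u : nat -> R) (A : R) : 0 <= A ->
  (forall n m, `|u n - u m| <= A * (n.+1%:R^-1 + m.+1%:R^-1)) ->
  exists l, forall n, `|u n - l| <= A * n.+1%:R^-1.
Proof.
move=> A0 H.
pose v n := u n - A * n.+1%:R^-1.
have vle n m : v m <= u n + A * n.+1%:R^-1.
  have := H m n; rewrite ler_norml /v mulrDr => /andP[_].
  by move: (A * _) (A * _) => a b; lra.
exists (sup (range v)) => n; rewrite ler_norml; apply/andP; split.
  have : sup (range v) <= u n + A * n.+1%:R^-1.
    by apply: ge_sup; [exists (v 0%N), 0%N|move=> _ [m _ <-]].
  by move: (A * _) => a; lra.
have : v n <= sup (range v).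
  apply: ub_le_sup; last by exists n.
  by exists (u 0%N + A * 1%:R^-1) => _ [m _ <-].
by rewrite /v; move: (A * _) => a; lra.
Qed.

(** Near [z] the difference quotients [q h] of [f] are within [O(|h|)] of [f'], uniformly. By the
    Cauchy estimate their derivatives [dq h], which are the difference quotients of [f'], then form
    a Cauchy family at [z], with an error linear in the increments. *)
Theorem entire_cderiv f : entire f -> entire (cderiv f).
Proof.
move=> ef; have Hf := entire_cder ef.
set df := cderiv f in Hf *.
apply/entireP => z.
have [M M0 HM] := entire_bounded_at z 4 ef.
pose q h w := (f (w + h) - f w) * h^-1.
pose dq h w := (df (w + h) - df w) * h^-1.
have Dq h w : cder (q h) w (dq h w).
  rewrite /q /dq; apply: cder_ext (fun x => mulrC _ _) _; rewrite mulrC; apply: cderZ.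
  by apply: cderB => //; apply: cder_shift.
have qd h w : h != 0 -> cabs h <= 1 -> cabs (w - z) <= 1 -> cabs (q h w - df w) <= 2 * (16 * (32 * M)) * cabs h.
  move=> h0 h1 wz; rewrite -(@ler_pM2r _ (cabs h)) ?cabs_gt0 // -cabsM.
  rewrite (_ : (q h w - df w) * h = f (w + h) - f w - df w * h); last by rewrite /q; field.
  by rewrite -(mulrA _ (cabs h)) -expr2; apply: (local_taylor Hf HM).
have qq h k : h != 0 -> k != 0 -> cabs h <= 1 -> cabs k <= 1 ->
    cabs (dq h z - dq k z) <= 16 * (2 * (16 * (32 * M))) * (cabs h + cabs k).
  move=> h0 k0 h1 k1.
  have -> : 16 * (2 * (16 * (32 * M))) * (cabs h + cabs k) = 16 * (2 * (16 * (32 * M)) * (cabs h + cabs k)) / 1.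
    by rewrite divr1; ring.
  apply: (@cauchy_estimate (fun w => q h w - q k w) (fun w => dq h w - dq k w)) => //.
    by move=> w; apply: cderB.
  move=> w wz.
  have -> : q h w - q k w = (q h w - df w) - (q k w - df w) by ring.
  by apply: le_trans (cabsBD _ _) _; rewrite mulrDr; apply: lerD; apply: qd.
set A := 16 * (2 * (16 * (32 * M))) in qq.
have A0 : 0 <= A by rewrite !mulr_ge0.
pose hn n : C := (n.+1%:R^-1%:C)%C.
have chn n : cabs (hn n) = n.+1%:R^-1 by rewrite cabs_real ger0_norm.
have hn0 n : hn n != 0.
  by apply/eqP => E; have := chn n; rewrite E cabs0 => /esym/eqP; rewrite invr_eq0 pnatr_eq0.
have hn1 n : cabs (hn n) <= 1 by rewrite chn invf_le1 ?ltr0n // ler1n.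
have cq n m : cabs (dq (hn n) z - dq (hn m) z) <= A * (n.+1%:R^-1 + m.+1%:R^-1).
  by rewrite -!chn; apply: qq.
have [l1 H1] := cauchy_harmonic A0 (fun n m => le_trans (ReB_le _ _) (cq n m)).
have [l2 H2] := cauchy_harmonic A0 (fun n m => le_trans (ImB_le _ _) (cq n m)).
exists (pt l1 l2); apply: (@cder_quadratic _ _ _ (4 * A) 1) => // h h1.
have [->|h0] := eqVneq h 0.
  by rewrite addr0 mulr0 subrr subr0 cabs0 expr0n /= mulr0.
have ch := cabs_gt0 h0.
(* Comparing with an increment [1 / (n + 1) < |h|] makes both errors below at most [2 A |h|]. *)
have /filter_ex[n Hn] := near_infty_natSinv_lt (PosNum ch).
rewrite /= in Hn.
have -> : df (z + h) - df z - pt l1 l2 * h = (dq h z - pt l1 l2) * h by rewrite /dq mulrBl divfK.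
rewrite cabsM expr2 mulrA; apply: ler_wpM2r => //.
have -> : dq h z - pt l1 l2 = (dq h z - dq (hn n) z) + (dq (hn n) z - pt l1 l2) by ring.
apply: le_trans (cabsD _ _) _.
have T1 : cabs (dq h z - dq (hn n) z) <= A * (cabs h + cabs h).
  apply: le_trans (qq _ _ h0 (hn0 n) (ltW h1) (hn1 n)) _.
  by apply: ler_wpM2l => //; rewrite lerD2l chn ltW.
have T2 : cabs (dq (hn n) z - pt l1 l2) <= A * cabs h + A * cabs h.
  apply: le_trans (cabs_le _) _.
  have Hn' : A * n.+1%:R^-1 <= A * cabs h by rewrite ler_wpM2l // ltW.
  have := le_trans (H1 n) Hn'; have := le_trans (H2 n) Hn'.
  by case: (dq (hn n) z) => ? ? /=; exact: (fun a b => lerD b a).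
by apply: le_trans (lerD T1 T2) _; move: A0; clear; lra.
Qed.

End CauchyEstimates.

(** * Primitives of entire functions *)

Section Primitive.
Variable R : realType.
Local Notation C := (R[i]).
Implicit Types (f h g : C -> C) (z w : C).

Lemma entire_ccontinuous_line f z : entire f -> forall t : R, ccontinuous (fun t => f ((t%:C)%C * z)) t.
Proof.
move=> ef t e e0.
have [r r0 Hr] := cder_lip (entire_cder (ef) ((t%:C)%C * z)).
set D := cabs (cderiv _ _) in Hr.
have D0 : 0 < D + 1 by rewrite ltr_wpDl // cabs_ge0.
have Z0 : 0 < cabs z + 1 by rewrite ltr_wpDl.
exists (Num.min (r / (cabs z + 1)) (e / (D + 1) / (cabs z + 1))).
  by rewrite lt_min !divr_gt0.
move=> s; rewrite lt_min !ltr_pdivlMr // => /andP[s1 s2].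
have cs : cabs ((s%:C)%C * z) <= `|s| * (cabs z + 1).
  by rewrite cabsM cabs_real ler_wpM2l // lerDl.
rewrite rmorphD mulrDl; apply: le_trans (Hr _ (le_lt_trans cs s1)) _.
rewrite mulrC; apply: le_trans (ler_wpM2r (ltW D0) cs) _; exact: ltW.
Qed.

Lemma entire_ccontinuous_real f : entire f -> forall t : R, ccontinuous (fun t => f (t%:C)%C) t.
Proof.
move=> ef t e e0; have [r r0 Hr] := entire_ccontinuous_line 1 ef t e0.
by exists r => // s /Hr; rewrite !mulr1.
Qed.

Lemma cint_FTC g dg : (forall w, cder g w (dg w)) -> entire dg ->
  cint 0 1 (fun t => dg (t%:C)%C) = g 1 - g 0.
Proof.
move=> Hg edg.
have cc t : ccontinuous (fun t => dg (t%:C)%C) t.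
  exact: entire_ccontinuous_real.
have D1 (t : R) : is_derive t 1 (fun s : R => complex.Re (g (s%:C)%C)) (complex.Re (dg (t%:C)%C)).
  have := cder_line_Re 0 1 t Hg; rewrite add0r !mulr1.
  by rewrite (_ : (fun s => _) = (fun s : R => complex.Re (g (s%:C)%C))) //; apply/funext => s; rewrite mulr1 add0r.
have D2 (t : R) : is_derive t 1 (fun s : R => complex.Im (g (s%:C)%C)) (complex.Im (dg (t%:C)%C)).
  have := cder_line_Im 0 1 t Hg; rewrite add0r !mulr1.
  by rewrite (_ : (fun s => _) = (fun s : R => complex.Im (g (s%:C)%C))) //; apply/funext => s; rewrite mulr1 add0r.
have F (u du : R -> R) : (forall t : R, is_derive t 1 u (du t)) -> continuous du ->
   Rintegral (@lebesgue_measure R) `[0, 1] du = u 1 - u 0.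
  move=> Hu cu; have cu' : continuous u.
    by move=> t; apply: differentiable_continuous; apply/derivable1_diffP; case: (Hu t).
  rewrite /Rintegral (@continuous_FTC2 _ du u) //.
  - exact: continuous_subspaceT.
  - split; first by move=> t _; case: (Hu t).
      by apply: cvg_at_right_filter; exact: cu'.
    by apply: cvg_at_left_filter; exact: cu'.
  - by move=> t _; rewrite derive1E; case: (Hu t).
apply: complexP => /=.
  rewrite (F _ _ D1) /=; first by case: (g 1) => ? ?; case: (g 0).
  by move=> t; apply: (@ccontinuous_fun _ _ _ (@complex.Re R)) (cc t); exact: ReB_le.
rewrite (F _ _ D2) /=; first by case: (g 1) => ? ?; case: (g 0).
by move=> t; apply: (@ccontinuous_fun _ _ _ (@complex.Im R)) (cc t); exact: ImB_le.
Qed.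

Lemma entireM f g : entire f -> entire g -> entire (fun z => f z * g z).
Proof.
move=> /entire_cder Hf /entire_cder Hg.
by apply: (@cder_entire _ _ (fun z => cderiv f z * g z + f z * cderiv g z)) => z; apply: cderM.
Qed.

Lemma entireD f g : entire f -> entire g -> entire (fun z => f z + g z).
Proof.
move=> /entire_cder Hf /entire_cder Hg.
by apply: (@cder_entire _ _ (fun z => cderiv f z + cderiv g z)) => z; apply: cderD.
Qed.

Lemma entireB f g : entire f -> entire g -> entire (fun z => f z - g z).
Proof.
move=> /entire_cder Hf /entire_cder Hg.
by apply: (@cder_entire _ _ (fun z => cderiv f z - cderiv g z)) => z; apply: cderB.
Qed.

Lemma entire_comp f g : entire f -> entire g -> entire (fun z => f (g z)).
Proof.
move=> /entire_cder Hf /entire_cder Hg.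
by apply: (@cder_entire _ _ (fun z => cderiv f (g z) * cderiv g z)) => z; apply: cder_comp.
Qed.

Lemma entire_cst (c : C) : entire (fun=> c).
Proof. by apply: (@cder_entire _ _ (fun=> 0)) => z; exact: cder_cst. Qed.

Lemma entire_id : entire (@id C).
Proof. by apply: (@cder_entire _ _ (fun=> 1)) => z; exact: cder_id. Qed.

Lemma path_integralE h z : path_integral h z = cint 0 1 (fun t => h ((t%:C)%C * z) * z).
Proof. by []. Qed.

Lemma path_integral0 h : path_integral h 0 = 0.
Proof.
rewrite path_integralE (@eq_cint _ _ _ _ (fun=> 0)) ?cint_cst ?mulr0 // => t _.
by rewrite mulr0.
Qed.

(* Differentiation under the integral sign: the derivative in [w] of [h (t w) w] at [w = z] is
   the derivative in [t] of [t h (t z)]. *)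
Theorem path_integral_cder h : entire h -> forall z, cder (path_integral h) z (h z).
Proof.
move=> eh z; have Hh := entire_cder eh; have edh := entire_cderiv eh.
pose k (t : R) w := h ((t%:C)%C * w) * w.
pose dk (t : R) w := cderiv h ((t%:C)%C * w) * (t%:C)%C * w + h ((t%:C)%C * w) * 1.
have Hk t w : cder (k t) w (dk t w).
  apply: (@cderM _ (fun w => h ((t%:C)%C * w)) id); last exact: cder_id.
  exact: cder_scale.
have [M1 M10 HM1] := @entire_bounded _ h (cabs z + 4) eh.
pose M := M1 * (cabs z + 4).
have HM (t : R) w : 0 <= t <= 1 -> cabs (w - z) <= 4 -> cabs (k t w) <= M.
  move=> /andP[t0 t1] wz; rewrite /k cabsM.
  have wz' : cabs w <= cabs z + 4 by have := cabsD (w - z) z; rewrite subrK; lra.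
  apply: ler_pM => //; apply: HM1; rewrite cabsM cabs_real ger0_norm //.
  by apply: le_trans wz'; rewrite ler_piMl.
have ct t : ccontinuous (dk ^~ z) t.
  have e1 : entire (fun s => cderiv h (s * z) * s * z + h (s * z) * 1).
    have es : entire (fun s : C => s * z) by apply: entireM; [exact: entire_id|exact: entire_cst].
    apply: entireD; last by apply: entireM; [exact: entire_comp|exact: entire_cst].
    apply: entireM; last exact: entire_cst.
    by apply: entireM; [exact: entire_comp|exact: entire_id].
  exact: (entire_ccontinuous_real e1).
have ck w t : ccontinuous (k ^~ w) t.
  have es : entire (fun s : C => h (s * w) * w).
    apply: entireM; last exact: entire_cst; apply: (entire_comp eh).
    by apply: entireM; [exact: entire_id|exact: entire_cst].
  exact: (entire_ccontinuous_real es).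
have ik w : cintegrable 0 1 (k ^~ w) := ccontinuous_cintegrable (fun t _ => ck w t).
have idk : cintegrable 0 1 (dk ^~ z) := ccontinuous_cintegrable (fun t _ => ct t).
have FTC : cint 0 1 (dk ^~ z) = h z.
  have Dg w : cder (fun s => h (s * z) * s) w (cderiv h (w * z) * z * w + h (w * z) * 1).
    apply: (@cderM _ (fun s => h (s * z)) id); last exact: cder_id.
    rewrite mulrC; apply: cder_ext (fun s => congr1 h (mulrC _ _)) _.
    by rewrite [_ * z]mulrC mulrC; apply: cder_scale; rewrite mulrC.
  rewrite (_ : dk ^~ z = (fun t => (fun w => cderiv h (w * z) * z * w + h (w * z) * 1) (t%:C)%C)).
    rewrite (cint_FTC Dg); first by rewrite mul1r mulr1 mulr0 subr0.
    have es : entire (fun s : C => s * z) by apply: entireM; [exact: entire_id|exact: entire_cst].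
    apply: entireD; last by apply: entireM; [exact: entire_comp|exact: entire_cst].
    apply: entireM; last exact: entire_id.
    by apply: entireM; [exact: entire_comp|exact: entire_cst].
  by apply/funext => t; rewrite /dk mulrAC.
rewrite -FTC.
(* The Taylor remainder of [k t] at [z] is uniform in [t] because [M] is; the outer factor [2] is
   that of [cint_bound]. *)
apply: (@cder_quadratic _ _ _ _ (2 * (2 * (16 * (32 * M)))) 1) => // w w1.
rewrite !path_integralE (mulrC _ w) -(cintM w idk) -(cintB (ik (z + w)) (ik z)).
rewrite -cintB; [|exact: cintegrableB|exact: cintegrableM].
have -> : 2 * (2 * (16 * (32 * M))) * cabs w ^+ 2 = 2 * (2 * (16 * (32 * M)) * cabs w ^+ 2) * (1 - 0) by ring.
apply: cint_bound => //.
  by apply: cintegrableB; [exact: cintegrableB|exact: cintegrableM].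
move=> t t01; rewrite (mulrC w).
by apply: (local_taylor (Hk t) (fun u => HM t u t01)); rewrite ?subrr ?cabs0 // ltW.
Qed.

End Primitive.

(** * Sub-mean value inequalities *)

Section PlaneMeasure.
Variable R : realType.
Local Notation C := (R[i]).
Local Notation mu := (@lebesgue_measure R).
Local Notation dm := (mu \x mu)%E.

(** An open set is the countable union of the rational boxes that it contains; the other boxes are
    replaced by [set0]. *)
Lemma measurable_open_plane (A : set (R * R)) : open A -> measurable A.
Proof.
move=> oA.
pose B (q : (rat * rat) * (rat * rat)) : set (R * R) :=
  `]ratr q.1.1, ratr q.1.2[%classic `*` `]ratr q.2.1, ratr q.2.2[%classic.
have -> : A = \bigcup_q (if pselect (B q `<=` A) then B q else set0).
  apply/seteqP; split=> [[x y] Axy|u [q _]]; last by case: pselect => // H /H.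
  have /= : nbhs (x, y) A by move: oA; rewrite openE; apply.
  case=> -[U V] /= [/nbhs_ballP[e1 /= e10 h1] /nbhs_ballP[e2 /= e20 h2]] UV.
  have rt (p e : R) : 0 < e -> exists2 q : rat * rat,
      ratr q.1 < p < ratr q.2 & forall s, ratr q.1 < s < ratr q.2 -> `|p - s| < e.
    move=> e0.
    have [q1] := @rat_in_itvoo R (p - e) p ltac:(by rewrite gtrBl).
    rewrite in_itv /= => /andP[a1 a2].
    have [q2] := @rat_in_itvoo R p (p + e) ltac:(by rewrite ltrDl).
    rewrite in_itv /= => /andP[b1 b2].
    exists (q1, q2) => /=; first by rewrite a2.
    by move=> s /andP[s1 s2]; rewrite ltr_norml; apply/andP; split; move: a1 a2 b1 b2 s1 s2; clear; lra.
  have [q1 x1 H1] := rt x e1 e10; have [q2 y1 H2] := rt y e2 e20.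
  exists (q1, q2) => //; case: pselect => [s|]; first by split; rewrite /= in_itv.
  case; move=> [x' y'] [/=]; rewrite !in_itv /= => /H1 hx /H2 hy.
  by apply: UV; split => /=; [exact: h1|exact: h2].
apply: countable_bigcupT_measurable; first exact: countableP.
move=> q; case: pselect => [s|s]; last exact: measurable0.
by apply: measurableX; exact: measurable_itv.
Qed.

Lemma measurable_continuous_plane (F : R * R -> R) : continuous F -> measurable_fun setT F.
Proof.
move=> /continuousP cF; apply: (measurability _ (RGenOInfty.measurableE R)).
move=> B [D [a ->] <-]; rewrite setTI; apply: measurable_open_plane.
apply: cF; exact: interval_open.
Qed.

Lemma measurable_entire (f : C -> C) : entire f ->
  measurable_fun setT (fun u : R * R => cabs (f (of_pair u))).
Proof. by move=> ef; apply: measurable_continuous_plane; exact: entire_continuous. Qed.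

Section Slices.
Variables (F : R * R -> \bar R) (X Y : set R).
Hypotheses (mF : measurable_fun setT F) (F0 : forall u, (0 <= F u)%E).
Hypotheses (mX : measurable X) (mY : measurable Y).

Let G := F \_ (X `*` Y).

Let mG : measurable_fun setT G.
Proof.
apply/(measurable_restrictT _ _).1; first exact: measurableX.
exact: measurable_funTS.
Qed.

Let G0 u : (0 <= G u)%E.
Proof. by rewrite /G patchE; case: ifP. Qed.

(** A Chebyshev form of Tonelli's theorem. In contrapositive form, a small area integral leaves in
    every large enough [Y'] a slice with a small integral. *)
Lemma slice_y (Y' : set R) (t : \bar R) : measurable Y' -> Y' `<=` Y -> (0 <= t)%E ->
  (forall y, Y' y -> (t <= \int[mu]_(x in X) F (x, y))%E) ->
  (t * mu Y' <= \int[dm]_(u in X `*` Y) F u)%E.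
Proof.
move=> mY' YY t0 H.
rewrite integral_mkcond -/G fubini_tonelli1 // fubini_tonelli //.
rewrite -(integral_cst mu mY') //.
rewrite [leLHS]integral_mkcond; apply: ge0_le_integral => //.
- by move=> y _; rewrite patchE; case: ifP.
- by apply/(measurable_restrictT _ _).1 => //; exact: measurable_cst.
- exact: measurable_fun_fubini_tonelli_G.
move=> y _; rewrite patchE; case: ifPn => [|_]; last exact: integral_ge0.
rewrite inE => yY; apply: le_trans (H _ yY) _.
rewrite /fubini_G [leLHS]integral_mkcond; apply: eq_leW.
apply: eq_integral => x _; rewrite /G !patchE.
have -> : ((x, y) \in X `*` Y) = (x \in X) => //.
apply/idP/idP; rewrite !inE /=; first by case.
by move=> ?; split => //; exact: YY.
Qed.

Lemma slice_x (X' : set R) (t : \bar R) : measurable X' -> X' `<=` X -> (0 <= t)%E ->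
  (forall x, X' x -> (t <= \int[mu]_(y in Y) F (x, y))%E) ->
  (t * mu X' <= \int[dm]_(u in X `*` Y) F u)%E.
Proof.
move=> mX' XX t0 H.
rewrite integral_mkcond -/G fubini_tonelli1 //.
rewrite -(integral_cst mu mX') //.
rewrite [leLHS]integral_mkcond; apply: ge0_le_integral => //.
- by move=> y _; rewrite patchE; case: ifP.
- by apply/(measurable_restrictT _ _).1 => //; exact: measurable_cst.
- exact: measurable_fun_fubini_tonelli_F.
move=> x _; rewrite patchE; case: ifPn => [|_]; last exact: integral_ge0.
rewrite inE => xX; apply: le_trans (H _ xX) _.
rewrite /fubini_F [leLHS]integral_mkcond; apply: eq_leW.
apply: eq_integral => y _; rewrite /G !patchE.
have -> : ((x, y) \in X `*` Y) = (y \in Y) => //.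
apply/idP/idP; rewrite !inE /=; first by case.
by move=> ?; split => //; exact: XX.
Qed.

End Slices.

Definition square (z : C) (r : R) : set (R * R) :=
  `[complex.Re z - r, complex.Re z + r]%classic `*` `[complex.Im z - r, complex.Im z + r]%classic.

Lemma measurable_square z r : measurable (square z r).
Proof. by apply: measurableX; exact: measurable_itv. Qed.

Lemma cint_le_ext (x1 x2 X1 X2 c : R) (k : R -> C) (F : R -> R) : X1 <= x1 -> x2 <= X2 -> 0 <= c ->
  (forall x, ccontinuous k x) -> measurable_fun setT F -> (forall x, 0 <= F x) ->
  (forall x, x1 <= x <= x2 -> cabs (k x) <= c * F x) ->
  ((cabs (cint x1 x2 k))%:E <= (2 * c)%:E * \int[mu]_(x in `[X1, X2]) (F x)%:E)%E.
Proof.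
move=> h1 h2 c0 ck mF F0 kF.
have ik : mu.-integrable `[x1, x2] (EFin \o (@cabs R \o k)).
  by apply: ccontinuous_integrable => // z w; exact: cabsB_le.
have mE D : measurable_fun D (fun x => (F x)%:E).
  by apply/measurable_EFinP; exact: measurable_funTS.
apply: (@le_trans _ _ (2%:E * \int[mu]_(x in `[x1, x2]) (cabs (k x))%:E)%E).
  have := cint_le (ccontinuous_cintegrable (fun x _ => ck x)) ik.
  rewrite -lee_fin EFinM => /le_trans; apply.
  rewrite /Rintegral fineK //; exact: integrable_fin_num ik.
rewrite EFinM -muleA; apply: lee_wpmul2l => //.
rewrite -ge0_integralZl //; last by move=> x _; rewrite lee_fin.
apply: (@le_trans _ _ (\int[mu]_(x in `[x1, x2]) (c%:E * (F x)%:E))%E).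
  apply: ge0_le_integral => //.
  - by move=> x _; rewrite lee_fin.
  - by case/integrableP: ik.
  - by apply: measurable_funeM; exact: mE.
apply: ge0_subset_integral => //.
- by apply: measurable_funeM; exact: mE.
- by move=> x _; rewrite -EFinM lee_fin mulr_ge0.
- by apply: subset_itv; rewrite bnd_simp.
- exact: mE.
Qed.

(* If the inequality fails, there are a line close to each side of the square on which the
   integral of [|f|] is small, and Cauchy's formula fails on the rectangle they bound. *)
Let area_mean_pt (f : C -> C) (a b r : R) : entire f -> 0 < r ->
  ((cabs (f (pt a b)) * r ^+ 2)%:E <= 8%:E *
    \int[dm]_(u in `[(a - r)%R, (a + r)%R] `*` `[(b - r)%R, (b + r)%R]) (cabs (f (of_pair u)))%:E)%E.
Proof.
move=> ef r0.
set I : \bar R := (\int[_]_(_ in _) _)%E.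
(* The chosen lines stay at distance at least [r / 2] from the point, so a side on which [|f|] has
   integral below [t] contributes less than [2 (2 / r) t = |f (a + i b)|] to Cauchy's formula; four
   such sides contradict [cauchy_rect]. If instead every slice over a length [r / 2] has integral at
   least [t], the area integral is at least [t r / 2], whence the constant [8]. *)
pose t := r * cabs (f (pt a b)) / 4.
have [fz0|fz0] := eqVneq (cabs (f (pt a b))) 0.
  by rewrite fz0 mul0r mule_ge0 // integral_ge0 // => u _; rewrite lee_fin.
have fz : 0 < cabs (f (pt a b)) by rewrite lt_neqAle eq_sym fz0 cabs_ge0.
have t0 : 0 < t by rewrite divr_gt0 // mulr_gt0.
have mf : measurable_fun setT (fun u : R * R => (cabs (f (of_pair u)))%:E).
  by apply/measurable_EFinP; exact: measurable_entire.
have f0 (u : R * R) : (0 <= (cabs (f (of_pair u)))%:E)%E by rewrite lee_fin.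
have r20 : 0 < r / 2 by rewrite divr_gt0.
have fin : (t%:E * (r / 2)%:E <= I)%E -> ((cabs (f (pt a b)) * r ^+ 2)%:E <= 8%:E * I)%E.
  move=> H; apply: (@le_trans _ _ (8%:E * (t%:E * (r / 2)%:E))%E); last exact: lee_wpmul2l.
  by rewrite -!EFinM lee_fin /t; apply: eq_leW; field.
have AY (y0 : R) : b - r <= y0 -> y0 + r / 2 <= b + r ->
    (forall y : R, y0 <= y <= y0 + r / 2 -> (t%:E <= \int[mu]_(x in `[(a - r)%R, (a + r)%R]) (cabs (f (pt x y)))%:E)%E) ->
    ((cabs (f (pt a b)) * r ^+ 2)%:E <= 8%:E * I)%E.
  move=> h1 h2 H; apply: fin.
  have -> : (r / 2)%:E = mu `[y0, y0 + r / 2].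
    by rewrite mu_itv ?lerDl ?(ltW r20) //; congr EFin; ring.
  apply: slice_y => //.
  - by apply: subset_itv; rewrite bnd_simp.
  - by rewrite lee_fin ltW.
have AX (x0 : R) : a - r <= x0 -> x0 + r / 2 <= a + r ->
    (forall x : R, x0 <= x <= x0 + r / 2 -> (t%:E <= \int[mu]_(y in `[(b - r)%R, (b + r)%R]) (cabs (f (pt x y)))%:E)%E) ->
    ((cabs (f (pt a b)) * r ^+ 2)%:E <= 8%:E * I)%E.
  move=> h1 h2 H; apply: fin.
  have -> : (r / 2)%:E = mu `[x0, x0 + r / 2].
    by rewrite mu_itv ?lerDl ?(ltW r20) //; congr EFin; ring.
  apply: slice_x => //.
  - by apply: subset_itv; rewrite bnd_simp.
  - by rewrite lee_fin ltW.
have ex (P : R -> \bar R) (y0 : R) : ~ (forall y : R, y0 <= y <= y0 + r / 2 -> (t%:E <= P y)%E) ->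
    exists y, y0 <= y <= y0 + r / 2 /\ (P y < t%:E)%E.
  move=> /existsNP[y /not_implyP[yy /negP]]; rewrite -ltNge => Py; by exists y.
have [|/ex[y1 [/andP[y1l y1u] Y1]]] := pselect (forall y : R, b - r <= y <= b - r + r / 2 -> (t%:E <= \int[mu]_(x in `[(a - r)%R, (a + r)%R]) (cabs (f (pt x y)))%:E)%E).
  by apply: AY; move: r0; clear; lra.
have [|/ex[y2 [/andP[y2l y2u] Y2]]] := pselect (forall y : R, b + r / 2 <= y <= b + r / 2 + r / 2 -> (t%:E <= \int[mu]_(x in `[(a - r)%R, (a + r)%R]) (cabs (f (pt x y)))%:E)%E).
  by apply: AY; move: r0; clear; lra.
have [|/ex[x1 [/andP[x1l x1u] X1]]] := pselect (forall x : R, a - r <= x <= a - r + r / 2 -> (t%:E <= \int[mu]_(y in `[(b - r)%R, (b + r)%R]) (cabs (f (pt x y)))%:E)%E).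
  by apply: AX; move: r0; clear; lra.
have [|/ex[x2 [/andP[x2l x2u] X2]]] := pselect (forall x : R, a + r / 2 <= x <= a + r / 2 + r / 2 -> (t%:E <= \int[mu]_(y in `[(b - r)%R, (b + r)%R]) (cabs (f (pt x y)))%:E)%E).
  by apply: AX; move: r0; clear; lra.
exfalso.
have Hf := entire_cder ef.
have Ho : holo_off f (pt a b) by move=> w _; exists (cderiv f w).
have Hi : holo_off (fun w => (w - pt a b)^-1) (pt a b) by exact: holo_off_inv.
have HH := holo_offM Ho Hi.
have lim e : 0 < e -> exists2 r : R, 0 < r & forall w, w != pt a b ->
     cabs (w - pt a b) < r -> cabs (f w - f (pt a b)) <= e.
  move=> e0; have [d d0 Hd] := cder_lip (Hf (pt a b)).
  have D0 : 0 < cabs (cderiv f (pt a b)) + 1 by rewrite ltr_wpDl.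
  exists (Num.min d (e / (cabs (cderiv f (pt a b)) + 1))); first by rewrite lt_min d0 divr_gt0.
  move=> w _; rewrite lt_min ltr_pdivlMr // => /andP[/Hd]; rewrite subrKC => /le_trans h1 h2.
  by apply: h1; rewrite mulrC ltW.
have := cauchy_rect Ho lim (x1 := x1) (x2 := x2) (y1 := y1) (y2 := y2).
have -> : x1 < a by move: r0 x1u; clear; lra.
have -> : a < x2 by move: r0 x2l; clear; lra.
have -> : y1 < b by move: r0 y1u; clear; lra.
have -> : b < y2 by move: r0 y2l; clear; lra.
move=> /(_ erefl erefl erefl erefl).
have mh y : measurable_fun setT (fun x => cabs (f (pt x y))).
  exact: (measurable_fun_pair1 y (measurable_entire ef)).
have mv x : measurable_fun setT (fun y => cabs (f (pt x y))).
  exact: (measurable_fun_pair2 x (measurable_entire ef)).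
have x2v : x2 <= a + r by move: x2u; clear; lra.
have y2v : y2 <= b + r by move: y2u; clear; lra.
have inv w : r / 2 <= cabs (w - pt a b) -> cabs (f w * (w - pt a b)^-1) <= 2 / r * cabs (f w).
  move=> H; rewrite cabsM cabsV mulrC; apply: ler_wpM2r => //.
  by rewrite -[2 / r]invrK invf_div lef_pV2 // posrE // (lt_le_trans r20).
have r2 : 0 <= 2 / r by rewrite divr_ge0 // ltW.
have ch y : y != b -> forall x, ccontinuous (fun x => f (pt x y) * (pt x y - pt a b)^-1) x.
  move=> yb x; have [|D HD] := HH (pt x y); first by apply: contra yb => /eqP[_ ->].
  exact: (cder_ccontinuous_h HD).
have cv x : x != a -> forall y, ccontinuous (fun y => f (pt x y) * (pt x y - pt a b)^-1) y.
  move=> xa y; have [|D HD] := HH (pt x y); first by apply: contra xa => /eqP[-> _].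
  exact: (cder_ccontinuous_v HD).
have bh y : r / 2 <= `|y - b| -> (\int[mu]_(x in `[(a - r)%R, (a + r)%R]) (cabs (f (pt x y)))%:E < t%:E)%E ->
    cabs (cint x1 x2 (fun x => f (pt x y) * (pt x y - pt a b)^-1)) < 4 / r * t.
  move=> yb It.
  have n : y != b by apply/eqP => E; move: yb; rewrite E subrr normr0 leNgt r20.
  rewrite -lte_fin; apply: (@le_lt_trans _ _ ((2 * (2 / r))%:E * \int[mu]_(x in `[(a - r)%R, (a + r)%R]) (cabs (f (pt x y)))%:E)%E).
    apply: cint_le_ext => //; [exact: ch|].
    by move=> x _; apply: inv; apply: le_trans yb _; exact: (Im_le_cabs (pt x y - pt a b)).
  have -> : (4 / r * t)%:E = ((2 * (2 / r))%:E * t%:E)%E by rewrite -EFinM; congr EFin; ring.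
  by rewrite lte_pmul2l // lte_fin mulr_gt0 // divr_gt0.
have bv x : r / 2 <= `|x - a| -> (\int[mu]_(y in `[(b - r)%R, (b + r)%R]) (cabs (f (pt x y)))%:E < t%:E)%E ->
    cabs (cint y1 y2 (fun y => f (pt x y) * (pt x y - pt a b)^-1)) < 4 / r * t.
  move=> yb It.
  have n : x != a by apply/eqP => E; move: yb; rewrite E subrr normr0 leNgt r20.
  rewrite -lte_fin; apply: (@le_lt_trans _ _ ((2 * (2 / r))%:E * \int[mu]_(y in `[(b - r)%R, (b + r)%R]) (cabs (f (pt x y)))%:E)%E).
    apply: cint_le_ext => //; [exact: cv|].
    by move=> y _; apply: inv; apply: le_trans yb _; exact: (Re_le_cabs (pt x y - pt a b)).
  have -> : (4 / r * t)%:E = ((2 * (2 / r))%:E * t%:E)%E by rewrite -EFinM; congr EFin; ring.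
  by rewrite lte_pmul2l // lte_fin mulr_gt0 // divr_gt0.
have ny1 : r / 2 <= `|y1 - b| by rewrite ltr0_norm; move: r0 y1u; clear; lra.
have ny2 : r / 2 <= `|y2 - b| by rewrite gtr0_norm; move: r0 y2l; clear; lra.
have nx1 : r / 2 <= `|x1 - a| by rewrite ltr0_norm; move: r0 x1u; clear; lra.
have nx2 : r / 2 <= `|x2 - a| by rewrite gtr0_norm; move: r0 x2l; clear; lra.
have := bh _ ny1 Y1; have := bh _ ny2 Y2; have := bv _ nx1 X1; have := bv _ nx2 X2.
have -> : 4 / r * t = cabs (f (pt a b)) by rewrite /t; field; rewrite lt0r_neq0.
move=> b1 b2 b3 b4.
rewrite leNgt => /negP; apply.
rewrite /rint; apply: le_lt_trans (cabsD _ _) _; rewrite cabsM cabsi mul1r.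
have d1 := @cabsBD R; apply: le_lt_trans (lerD (d1 _ _) (d1 _ _)) _.
by move: b1 b2 b3 b4; clear; lra.
Qed.

Lemma area_mean (f : C -> C) (z : C) (r : R) : entire f -> 0 < r ->
  ((cabs (f z) * r ^+ 2)%:E <= 8%:E * \int[dm]_(u in square z r) (cabs (f (of_pair u)))%:E)%E.
Proof. by move=> ef r0; rewrite {1}[z]pt_surj; exact: area_mean_pt. Qed.

End PlaneMeasure.

(** * Sub-mean value inequality for powers of the modulus *)

Section Submean.
Variable R : realType.
Local Notation C := (R[i]).
Local Notation mu := (@lebesgue_measure R).
Local Notation dm := (mu \x mu)%E.
Implicit Types (f : C -> C) (z w : C) (r p : R).

Lemma measurable_entire_powR f p D : entire f ->
  measurable_fun D (fun u : R * R => (cabs (f (of_pair u)) `^ p)%:E).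
Proof.
move=> ef; apply: measurable_funTS; apply/measurable_EFinP.
exact: (measurableT_comp (measurable_powR p) (measurable_entire ef)).
Qed.

Lemma measurable_entire_EFin f D : entire f ->
  measurable_fun D (fun u : R * R => (cabs (f (of_pair u)))%:E).
Proof. by move=> ef; apply: measurable_funTS; apply/measurable_EFinP; exact: measurable_entire. Qed.

Lemma dm_square z r : 0 <= r -> dm (square z r) = (4 * r ^+ 2)%:E.
Proof.
move=> r0; rewrite /square product_measure1E; try exact: measurable_itv.
have h x : mu `[x - r, x + r] = (2 * r)%:E by rewrite mu_itv; [congr EFin; ring|lra].
transitivity ((2 * r)%:E * (2 * r)%:E)%E; first by congr (_ * _)%E; exact: h.
by rewrite -EFinM; congr EFin; ring.
Qed.

Lemma integral_square_cst (l : R) z r : 0 <= r ->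
  (\int[dm]_(u in square z r) l%:E = (l * (4 * r ^+ 2))%:E)%E.
Proof.
move=> r0; rewrite EFinM -(dm_square z r0).
by apply: integral_cst; exact: measurable_square.
Qed.

Lemma powR_pred p r : 0 < r -> r `^ p = r * r `^ (p - 1).
Proof.
move=> r0; rewrite -[X in X * _](powRr1 (ltW r0)) -powRD; last by rewrite (gt_eqF r0) implybT.
by rewrite addrC subrK.
Qed.

Lemma powR_invl p r : 0 < r -> r^-1 `^ p = r `^ (- p).
Proof. by move=> r0; rewrite -powR_inv1 ?ltW // -powRrM mulN1r. Qed.

(* Where [|f|] exceeds [l = |f z| / 64], it is at most [l^(1 - p) |f|^p]; the set where
   [|f| <= l] contributes at most half of the left-hand side of [area_mean]. *)
Lemma submean_ge1 p f z r : 1 <= p -> entire f -> 0 < r ->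
  ((cabs (f z) `^ p * r ^+ 2)%:E <= (16 * 64 `^ (p - 1))%:E *
     \int[dm]_(u in square z r) (cabs (f (of_pair u)) `^ p)%:E)%E.
Proof.
move=> p1 ef r0; have p0 : p != 0 by rewrite gt_eqF // (lt_le_trans ltr01).
set I := (\int[_]_(_ in _) _)%E.
have I0 : (0 <= I)%E by apply: integral_ge0 => u _; rewrite lee_fin powR_ge0.
have C0 : 0 <= 16 * 64 `^ (p - 1) :> R by rewrite mulr_ge0 // powR_ge0.
have [fz0|fz0] := eqVneq (cabs (f z)) 0.
  by rewrite fz0 powR0 // mul0r mule_ge0.
have fz : 0 < cabs (f z) by rewrite lt_neqAle eq_sym fz0 cabs_ge0.
set A := cabs (f z) in fz *.
(* The part where [|f| <= l] contributes at most [8 l (4 r^2) = A r^2 / 2]. *)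
pose l := A / 64; have l0 : 0 < l by rewrite divr_gt0.
have H1 := area_mean z ef r0.
have mS := measurable_square z r.
have H2 : (\int[dm]_(u in square z r) (cabs (f (of_pair u)))%:E <= (l * (4 * r ^+ 2))%:E + (l `^ (1 - p))%:E * I)%E.
  apply: (@le_trans _ _ (\int[dm]_(u in square z r) (l%:E + (l `^ (1 - p))%:E * (cabs (f (of_pair u)) `^ p)%:E))%E).
    apply: ge0_le_integral => //.
    - by move=> u _; rewrite lee_fin.
    - exact: measurable_entire_EFin.
    - apply: emeasurable_funD => //; apply: measurable_funeM; exact: measurable_entire_powR.
    move=> u _; rewrite -EFinM -EFinD lee_fin.
    set a := cabs _.
    have [al|la] := leP a l; first by rewrite (le_trans al) // lerDl mulr_ge0 ?powR_ge0.
    have a0 : 0 < a by exact: lt_trans la.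
    apply: (@le_trans _ _ (l `^ (1 - p) * a `^ p)); last by rewrite lerDr ltW.
    have -> : l `^ (1 - p) * a `^ p = a * (a / l) `^ (p - 1).
      rewrite (powR_pred p a0) powRM ?invr_ge0 ?ltW // (powR_invl _ l0) opprB.
      by move: (_ `^ _) (_ `^ _) => x y; ring.
    apply: ler_peMr; first exact: ltW.
    rewrite -[leLHS](powRr0 (a / l)); apply: ler_powR; last by rewrite subr_ge0.
    by rewrite ler_pdivlMr // mul1r ltW.
  rewrite ge0_integralD //.
  - rewrite (integral_square_cst l z (ltW r0)).
    rewrite ge0_integralZl //; last by rewrite lee_fin powR_ge0.
      exact: measurable_entire_powR.
    by move=> u _; rewrite lee_fin powR_ge0.
  - by move=> u _; rewrite lee_fin ltW.
  - by move=> u _; rewrite -EFinM lee_fin mulr_ge0 // powR_ge0.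
  - by apply: measurable_funeM; exact: measurable_entire_powR.
have [->|Iy] := eqVneq I +oo%E.
  by rewrite gt0_muley ?leey // lte_fin mulr_gt0 // powR_gt0.
have If : I \is a fin_num by rewrite ge0_fin_numE // ltey.
move: H2; rewrite -(fineK If); set i := fine I; rewrite -EFinM -EFinD => H2.
have {H1 H2} := le_trans H1 (lee_wpmul2l _ H2).
rewrite -!EFinM !lee_fin => /(_ (ler0n _ _)) H.
have {H} H : A * r ^+ 2 <= 16 * (l `^ (1 - p) * i).
  move: H; rewrite /l; set j := _ `^ _; set x := j * i.
  by rewrite (_ : 8 * (A / 64 * (4 * r ^+ 2) + x) = A * r ^+ 2 / 2 + 8 * x); [lra|field].
rewrite (powR_pred p fz) mulrAC mulrC; apply: le_trans (ler_wpM2l (powR_ge0 _ _) H) _.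
apply: eq_leW.
rewrite mulrCA -mulrA; congr (_ * _); rewrite mulrA; congr (_ * i).
rewrite /l powRM ?invr_ge0 ?ltW // powR_invl // opprB mulrA -powRD.
  by rewrite addrA subrK subrr powRr0 mul1r.
by rewrite (gt_eqF fz) implybT.
Qed.

(** The sup norm, whose closed balls are the sets [square]. *)
Definition ninf z : R := Num.max `|complex.Re z| `|complex.Im z|.

Lemma squareP z r (u : R * R) : square z r u <-> ninf (of_pair u - z) <= r.
Proof.
case: z => a b; rewrite /square /ninf /= !in_itv /= ge_max !ler_distl; split.
  by case=> -> ->.
by move=> /andP[-> ->].
Qed.

Lemma ninfD z w : ninf (z + w) <= ninf z + ninf w.
Proof.
rewrite /ninf ge_max; case: z => a b; case: w => c d /=.
apply/andP; split; apply: le_trans (ler_normD _ _) _; apply: lerD; rewrite le_max lexx ?orbT //.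
Qed.

Lemma ninf_le_cabs z : ninf z <= cabs z.
Proof. by rewrite /ninf ge_max Re_le_cabs Im_le_cabs. Qed.

Lemma cabs_le_ninf z : cabs z <= 2 * ninf z.
Proof.
apply: le_trans (cabs_le z) _.
have h1 : `|complex.Re z| <= ninf z by rewrite /ninf le_max lexx.
have h2 : `|complex.Im z| <= ninf z by rewrite /ninf le_max lexx orbT.
by lra.
Qed.

Lemma ninf0 : ninf 0 = 0.
Proof. by rewrite /ninf /= normr0 maxxx. Qed.

Lemma ninf_ge0 z : 0 <= ninf z.
Proof. by rewrite /ninf le_max normr_ge0. Qed.

Lemma of_pairK z : of_pair (complex.Re z, complex.Im z) = z.
Proof. by case: z. Qed.

(* Hardy-Littlewood trick: compare with a point almost maximizing
   [|f w| (r - |w - z|)^(2/p)], around which [|f|] is controlled by its value there. *)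
Lemma submean_lt1 p f z r : 0 < p -> p < 1 -> entire f -> 0 < r ->
  ((cabs (f z) `^ p * r ^+ 2)%:E <= (2 `^ p * 4 * 8 * (2 * 4 `^ p^-1) `^ (1 - p))%:E *
     \int[dm]_(u in square z r) (cabs (f (of_pair u)) `^ p)%:E)%E.
Proof.
move=> p0 p1 ef r0; have pn0 : p != 0 by rewrite gt_eqF.
set I := (\int[_]_(_ in _) _)%E.
have I0 : (0 <= I)%E by apply: integral_ge0 => u _; rewrite lee_fin powR_ge0.
set B := 2 * 4 `^ p^-1; set K := 2 `^ p * 4 * 8 * _.
have B0 : 0 < B by rewrite mulr_gt0 // powR_gt0.
have K0 : 0 <= K by rewrite !mulr_ge0 // powR_ge0.
have [fz0|fz0] := eqVneq (cabs (f z)) 0.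
  by rewrite fz0 powR0 // mul0r mule_ge0.
have fz : 0 < cabs (f z) by rewrite lt_neqAle eq_sym fz0 cabs_ge0.
pose g w := cabs (f w) * (r - ninf (w - z)) `^ (2 / p).
pose V := [set g w | w in [set w | ninf (w - z) < r]].
have [M M0 HM] := entire_bounded_at z (2 * r) ef.
have ubV : ubound V (M * r `^ (2 / p)).
  move=> _ [w /= wr <-]; apply: ler_pM => //; rewrite ?powR_ge0 //.
    by apply: HM; apply: le_trans (cabs_le_ninf _) _; rewrite ler_pM2l // ltW.
  apply: ge0_ler_powR; rewrite ?nnegrE ?divr_ge0 ?subr_ge0 ?gerBl ?ninf_ge0 // ltW //.
have Vz : V (g z) by exists z => //=; rewrite subrr ninf0.
have hV : has_sup V by split; [exists (g z)|exists (M * r `^ (2 / p))].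
have gz : g z = cabs (f z) * r `^ (2 / p) by rewrite /g subrr ninf0 subr0.
have gz0 : 0 < g z by rewrite gz mulr_gt0 // powR_gt0.
have S0 : 0 < sup V by apply: lt_le_trans gz0 _; apply: ub_le_sup => //; exact: hV.2.
have [_ [w0 /= w0r <-]] := sup_adherent (divr_gt0 S0 (ltr0n R 2)) hV.
have -> : sup V - sup V / 2 = sup V / 2 by field.
move=> Hw0.
(* On the square of half-side [d] around [w0] the quantity [r - ninf (w - z)] is at least half of
   its value at [w0]. Near-maximality of [g w0] then gives [|f| <= B |f w0|] there, with
   [B = 2 2^(2/p)]. *)
pose d := (r - ninf (w0 - z)) / 2.
have d0 : 0 < d by rewrite divr_gt0 // subr_gt0.
have dE : r - ninf (w0 - z) = 2 * d by rewrite /d; field.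
have Hle w : ninf (w - z) < r -> g w <= 2 * (cabs (f w0) * (2 * d) `^ (2 / p)).
  move=> wr; rewrite -dE; have : g w <= sup V by apply: ub_le_sup; [exact: hV.2|exists w].
  by move: Hw0; rewrite -/(g w0); move: (g w) (g w0) => x y; lra.
have pos2 : (2 * d) `^ (2 / p) = 4 `^ p^-1 * d `^ (2 / p).
  rewrite powRM ?ltW // powRrM; congr (_ `^ _ * _).
  by rewrite powR_mulrn // expr2; ring.
have dp0 : 0 < d `^ (2 / p) by rewrite powR_gt0.
have fw0 : 0 < cabs (f w0).
  have := lt_le_trans gz0 (Hle z _); rewrite subrr ninf0 => /(_ r0).
  rewrite pmulr_rgt0 // pmulr_lgt0 // powR_gt0 // mulr_gt0 //.
have sub w : ninf (w - w0) <= d -> ninf (w - z) + d <= r.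
  move=> wd; have := ninfD (w - w0) (w0 - z); rewrite subrKA => h.
  by move: wd h dE; clear; lra.
have fB w : ninf (w - w0) <= d -> cabs (f w) <= B * cabs (f w0).
  move=> /sub wz; have wr : ninf (w - z) < r by move: wz d0; clear; lra.
  have := Hle w wr; rewrite /g pos2 => H.
  rewrite -(@ler_pM2r _ (d `^ (2 / p))) //.
  apply: le_trans (_ : cabs (f w) * (r - ninf (w - z)) `^ (2 / p) <= _).
    apply: ler_wpM2l => //; have pp : 0 <= 2 / p by rewrite divr_ge0 // ltW.
    by apply: (ge0_ler_powR pp); rewrite ?nnegrE ?subr_ge0; [exact: ltW|exact: ltW|rewrite lerBrDl].
  by apply: le_trans H _; rewrite /B; apply: eq_leW; ring.
have mS := measurable_square w0 d.
(* Writing [|f| = |f|^(1-p) |f|^p] and bounding the first factor by [(B |f w0|)^(1-p)] passes from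
   the first power, which [area_mean] controls, to the power [p]. *)
have H2 : (\int[dm]_(u in square w0 d) (cabs (f (of_pair u)))%:E <= ((B * cabs (f w0)) `^ (1 - p))%:E * I)%E.
  rewrite /I -ge0_integralZl //; last first.
  - by rewrite lee_fin powR_ge0.
  - by move=> u _; rewrite lee_fin powR_ge0.
  - exact: measurable_entire_powR.
  - exact: measurable_square.
  apply: (@le_trans _ _ (\int[dm]_(u in square w0 d) (((B * cabs (f w0)) `^ (1 - p))%:E * (cabs (f (of_pair u)) `^ p)%:E))%E).
    apply: ge0_le_integral => //.
    - by move=> u _; rewrite lee_fin.
    - exact: measurable_entire_EFin.
    - by apply: measurable_funeM; exact: measurable_entire_powR.
    move=> u /squareP/fB fu; rewrite -EFinM lee_fin.
    have [->|fu0] := eqVneq (cabs (f (of_pair u))) 0; first by rewrite mulr_ge0 // powR_ge0.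
    have fup : 0 < cabs (f (of_pair u)) by rewrite lt_neqAle eq_sym fu0 cabs_ge0.
    rewrite -{1}(powRr1 (ltW fup)) -{1}(subrK p 1) powRD; last by rewrite fu0 implybT.
    apply: ler_wpM2r; first exact: powR_ge0.
    by apply: ge0_ler_powR; rewrite ?nnegrE ?subr_ge0 ?mulr_ge0 // ltW.
  apply: ge0_subset_integral => //.
  - exact: measurable_square.
  - by apply: measurable_funeM; exact: measurable_entire_powR.
  - by move=> u _; rewrite -EFinM lee_fin mulr_ge0 // powR_ge0.
  - move=> u /squareP/sub h; apply/squareP; move: h d0; clear; lra.
have [->|Iy] := eqVneq I +oo%E.
  by rewrite gt0_muley ?leey // lte_fin !mulr_gt0 // powR_gt0.
have If : I \is a fin_num by rewrite ge0_fin_numE // ltey.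
have H1 := area_mean w0 ef d0.
have {H1 H2} := le_trans H1 (lee_wpmul2l _ H2).
rewrite -(fineK If) -!EFinM !lee_fin => /(_ (ler0n _ _)); set i := fine I => H.
have i0 : 0 <= i by rewrite fine_ge0.
have {}H : cabs (f w0) `^ p * d ^+ 2 <= 8 * (B `^ (1 - p) * i).
  rewrite -(@ler_pM2l _ (cabs (f w0) `^ (1 - p))) ?powR_gt0 // (mulrA _ (cabs (f w0) `^ p)) -powRD; last first.
    by rewrite (gt_eqF fw0) implybT.
  rewrite subrK powRr1 ?cabs_ge0 //; apply: le_trans H _.
  by rewrite (powRM _ (ltW B0) (ltW fw0)); apply: eq_leW; ring.
(* Back from [w0] to [z]: raised to the power [p], the inequality [g z <= 2 g w0] has [r^2] on the
   left and [(2 d)^2] on the right, thanks to the exponent [2 / p]. *)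
have := Hle z; rewrite subrr ninf0 gz => /(_ r0) Hz.
have := @ge0_ler_powR R p (ltW p0) _ _ _ _ Hz.
rewrite !nnegrE !mulr_ge0 ?powR_ge0 // => /(_ isT isT).
have E x : 0 <= x -> (x `^ (2 / p)) `^ p = x ^+ 2.
  by move=> x0; rewrite -powRrM divfK // powR_mulrn.
have d20 : 0 <= 2 * d by rewrite mulr_ge0 // ltW.
have c2 : 0 <= (2 : R) by [].
rewrite (powRM p (cabs_ge0 _) (powR_ge0 _ _)) (E _ (ltW r0)).
rewrite (powRM p c2 (mulr_ge0 (cabs_ge0 _) (powR_ge0 _ _))) (powRM p (cabs_ge0 _) (powR_ge0 _ _)) (E _ d20) => {}Hz.
apply: le_trans Hz _.
have -> : 2 `^ p * (cabs (f w0) `^ p * (2 * d) ^+ 2) = 2 `^ p * 4 * (cabs (f w0) `^ p * d ^+ 2) by ring.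
have -> : K * i = 2 `^ p * 4 * (8 * (B `^ (1 - p) * i)) by rewrite /K; ring.
by apply: ler_wpM2l => //; rewrite mulr_ge0 // powR_ge0.
Qed.

Theorem submean p : 0 < p -> exists2 K : R, 0 < K & forall f z r, entire f -> 0 < r ->
  ((cabs (f z) `^ p * r ^+ 2)%:E <= K%:E *
     \int[dm]_(u in square z r) (cabs (f (of_pair u)) `^ p)%:E)%E.
Proof.
move=> p0; have [p1|p1] := ltP p 1.
  exists (2 `^ p * 4 * 8 * (2 * 4 `^ p^-1) `^ (1 - p)).
    by rewrite !mulr_gt0 // ?powR_gt0 // mulr_gt0 // powR_gt0.
  by move=> f z r ef r0; exact: submean_lt1.
exists (16 * 64 `^ (p - 1)); first by rewrite mulr_gt0 // powR_gt0.
by move=> f z r ef r0; exact: submean_ge1.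
Qed.

End Submean.

(** * Littlewood-Paley estimates for Gaussian weights *)

(* The library makes [m1 \x m2] canonically sigma-finite only when both factors are
   subprobabilities, hence this copy of the Lebesgue measure of the plane. *)
Definition plane_measure (R : realType) : set (measurableTypeR R * measurableTypeR R) -> \bar R :=
  (@lebesgue_measure R \x @lebesgue_measure R)%E.

Section PlaneTonelli.
Variable R : realType.
Local Notation mu := (@lebesgue_measure R).
Local Notation dm := (mu \x mu)%E.

HB.instance Definition _ := Measure.on (@plane_measure R).

Lemma plane_measure_sigma_finite : sigma_finite setT (@plane_measure R).
Proof.
exists (fun n => square 0 n%:R).
  apply/seteqP; split=> // u _.
  exists (Num.truncn (ninf (of_pair u))).+1 => //.
  by apply/squareP; rewrite subr0 ltW // truncnS_gt.
move=> n; split; first exact: measurable_square.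
by rewrite /plane_measure dm_square // ltry.
Qed.

HB.instance Definition _ :=
  Measure_isSigmaFinite.Build _ _ _ (@plane_measure R) plane_measure_sigma_finite.

Variable H : (R * R) * (R * R) -> \bar R.
Hypotheses (mH : measurable_fun setT H) (H0 : forall x, (0 <= H x)%E).

Lemma plane_tonelli :
  (\int[dm]_u \int[dm]_v H (u, v) = \int[dm]_v \int[dm]_u H (u, v))%E.
Proof.
exact: (@fubini_tonelli _ _ (measurableTypeR R * measurableTypeR R)%type
  (measurableTypeR R * measurableTypeR R)%type R (@plane_measure R) (@plane_measure R) H mH H0).
Qed.

Lemma plane_measurable_F : measurable_fun setT (fun u => \int[dm]_v H (u, v))%E.
Proof.
exact: (@measurable_fun_fubini_tonelli_F _ _ (measurableTypeR R * measurableTypeR R)%type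
  (measurableTypeR R * measurableTypeR R)%type R (@plane_measure R) H mH H0).
Qed.

Lemma plane_measurable_G : measurable_fun setT (fun v => \int[dm]_u H (u, v))%E.
Proof.
exact: (@measurable_fun_fubini_tonelli_G _ _ (measurableTypeR R * measurableTypeR R)%type
  (measurableTypeR R * measurableTypeR R)%type R (@plane_measure R) H mH H0).
Qed.

End PlaneTonelli.

(** * Averages over squares of half-side [N / rho] *)

Section Transfer.
Variable R : realType.
Local Notation C := (R[i]).
Local Notation mu := (@lebesgue_measure R).
Local Notation dm := (mu \x mu)%E.
Local Notation P := (@of_pair R).
Implicit Types (z w : C) (u v : R * R).

Definition rho z : R := 1 + cabs z.

Lemma rho_ge1 z : 1 <= rho z.
Proof. by rewrite /rho lerDl. Qed.

Lemma rho_gt0 z : 0 < rho z.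
Proof. exact: lt_le_trans (rho_ge1 z). Qed.

Lemma measurable_rho : measurable_fun setT (fun u => rho (P u)).
Proof. by apply: measurable_funD => //; apply: (measurable_entire (@entire_id R)). Qed.

Lemma measurable_le_set d (S : measurableType d) (f g : S -> R) :
  measurable_fun setT f -> measurable_fun setT g -> measurable [set x | f x <= g x].
Proof.
move=> mf mg; have := measurable_fun_ler mf mg => /(_ measurableT [set true] I).
by rewrite setTI.
Qed.

Lemma covering_arith1 (x y k k' n t : R) : t <= y + k' -> y <= x + k -> k <= 2 * n -> k' <= 2 * n ->
  t <= x + 4 * n.
Proof. by lra. Qed.

Lemma covering_arith2 (t t' q q' n : R) : 0 < n -> t' <= t + 4 * n -> t <= q -> q' <= 2 * t' -> 0 <= q ->
  1 + q' <= (2 + 8 * n) * (1 + q).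
Proof. by move=> n0 h1 h2 h3 q0; have := mulr_ge0 (ltW n0) q0; lra. Qed.

(* A substitute for the change of variables [v = T u]: as [T] contracts distances by at most a
   factor [2], each [v] lies in the squares of radius [N / rho] around [T u] only for [u] in a
   set of area [O(rho^(-2))]. *)
Section Covering.
Variables (N : R) (T : R * R -> C) (E : set (R * R)).
Hypotheses (N0 : 0 < N) (mE : measurable E).
Hypotheses (mT1 : measurable_fun setT (fun u => complex.Re (T u)))
           (mT2 : measurable_fun setT (fun u => complex.Im (T u))).
Hypothesis expT : forall u v, E u -> E v -> cabs (P u - P v) <= 2 * cabs (T u - T v).
Hypothesis compT : forall u, E u -> cabs (T u) <= cabs (P u) <= 2 * cabs (T u).

Let c := 2 + 8 * N.

Let c0 : 0 < c.
Proof. by rewrite addr_gt0 // mulr_gt0. Qed.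

Let B : set ((R * R) * (R * R)) := [set q | E q.1 /\ square (T q.1) (N / rho (P q.1)) q.2].

Let mB : measurable B.
Proof.
have mr : measurable_fun setT (fun q : (R * R) * (R * R) => N / rho (P q.1)).
  have -> : (fun q : (R * R) * (R * R) => N / rho (P q.1)) = (fun q => N * rho (P q.1) `^ (-1)).
    by apply/funext => q; rewrite powR_inv1 // ltW // rho_gt0.
  apply: measurable_funM => //; apply: (measurableT_comp (measurable_powR _)).
  exact: (measurableT_comp measurable_rho measurable_fst).
have m1 : measurable_fun setT (fun q : (R * R) * (R * R) => complex.Re (T q.1)).
  exact: (measurableT_comp mT1 measurable_fst).
have m2 : measurable_fun setT (fun q : (R * R) * (R * R) => complex.Im (T q.1)).
  exact: (measurableT_comp mT2 measurable_fst).
have w1 : measurable_fun setT (fun q : (R * R) * (R * R) => q.2.1).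
  exact: (measurableT_comp measurable_fst measurable_snd).
have w2 : measurable_fun setT (fun q : (R * R) * (R * R) => q.2.2).
  exact: (measurableT_comp measurable_snd measurable_snd).
have -> : B = (E `*` setT) `&` ([set q | complex.Re (T q.1) - N / rho (P q.1) <= q.2.1] `&`
   [set q | q.2.1 <= complex.Re (T q.1) + N / rho (P q.1)] `&`
   [set q | complex.Im (T q.1) - N / rho (P q.1) <= q.2.2] `&`
   [set q | q.2.2 <= complex.Im (T q.1) + N / rho (P q.1)]).
  apply/seteqP; split=> [[u v] /= [Eu []]|[u v] /= [[Eu _] [[[a1 a2] a3] a4]]].
    by rewrite /= !in_itv /= => /andP[? ?] /andP[? ?].
  by split => //; split; rewrite /= in_itv /= ?a1 ?a2 ?a3 ?a4.
apply: measurableI; first exact: measurableX.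
apply: measurableI; [apply: measurableI; [apply: measurableI|]|]; apply: measurable_le_set => //;
  by [exact: measurable_funB|exact: measurable_funD].
Qed.

(** Both [T u] and [T u'] lie within [2 N] of [v], hence within [4 N] of each other, and [compT]
    carries this over to [u] and [u']. *)
Lemma rho_comparable u u' v : E u -> E u' ->
  square (T u) (N / rho (P u)) v -> square (T u') (N / rho (P u')) v ->
  rho (P u') <= c * rho (P u).
Proof.
move=> Eu Eu' /squareP h /squareP h'.
have /andP[_ b'] := compT Eu'; have /andP[a _] := compT Eu.
have nle x : N / rho (P x) <= N by rewrite ler_pdivrMr ?rho_gt0 // ler_peMr ?rho_ge1 // ltW.
have k : cabs (P v - T u) <= 2 * N by apply: le_trans (cabs_le_ninf _) _; rewrite ler_pM2l // (le_trans h).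
have k' : cabs (P v - T u') <= 2 * N by apply: le_trans (cabs_le_ninf _) _; rewrite ler_pM2l // (le_trans h').
have d : cabs (T u') <= cabs (T u) + 4 * N.
  have -> : T u' = (T u + (P v - T u)) - (P v - T u') by ring.
  exact: (covering_arith1 (cabsBD _ _) (cabsD _ _)).
exact: (covering_arith2 N0 d a b').
Qed.

Let K := 4 * c ^+ 2 * (4 * N * (1 + c)) ^+ 2.

(** Fix one [u0] whose square contains [v]. Any other such [u] has [rho] comparable to that of [u0],
    and by [expT] lies in a square around [u0] of half-side [s = O(1 / rho)]; the area of that
    square balances the factor [rho^2]. *)
Lemma covering v :
  (\int[dm]_u ((rho (P u) ^+ 2 * \1_B (u, v))%:E) <= K%:E)%E.
Proof.
have K0 : 0 <= K by apply: mulr_ge0; [apply: mulr_ge0|]; rewrite ?sqr_ge0.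
have [[u0 [/= Eu0 h0]]|/forallNP nB] := pselect (exists u0, B (u0, v)); last first.
  rewrite integral0_eq ?lee_fin // => u _.
  by rewrite indicE memNset ?mulr0 //; exact: nB.
pose s := 4 * N * (1 + c) / rho (P u0).
have N0' := ltW N0; have c0' := ltW c0.
have s0 : 0 <= s by rewrite /s divr_ge0 ?(ltW (rho_gt0 _)) // !mulr_ge0 // addr_ge0.
apply: (@le_trans _ _ (\int[dm]_(u in square (P u0) s) (c ^+ 2 * rho (P u0) ^+ 2)%:E)%E).
  rewrite [leRHS]integral_mkcond; apply: ge0_le_integral => //.
  - by move=> u _; rewrite lee_fin mulr_ge0 ?sqr_ge0 // indicE.
  - apply/measurable_EFinP; apply: measurable_funM.
      by apply: measurable_funX; exact: measurable_rho.
    apply: (@measurable_fun_pair1 _ _ _ _ _ _ (fun q : (R * R) * (R * R) => \1_B q : R)).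
    exact: measurable_indic.
  - apply/(measurable_restrictT _ _).1; first exact: measurable_square.
    exact: measurable_cst.
  move=> u _; rewrite patchE indicE.
  have [|uB] := boolP ((u, v) \in B); last first.
    by rewrite mulr0; case: ifP => // _; rewrite lee_fin mulr_ge0 ?sqr_ge0.
  rewrite inE => -[/= Eu h].
  have r1 := rho_comparable Eu Eu0 h h0; have r2 := rho_comparable Eu0 Eu h0 h.
  have us : square (P u0) s u.
    apply/squareP; apply: le_trans (ninf_le_cabs _) _; apply: le_trans (expT Eu Eu0) _.
    have iv : N / rho (P u) <= N * c / rho (P u0).
      rewrite ler_pdivrMr ?rho_gt0 // mulrAC ler_pdivlMr ?rho_gt0 // -mulrA.
      by rewrite ler_pM2l.
    have k : cabs (P v - T u) <= 2 * (N * c / rho (P u0)).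
      apply: le_trans (cabs_le_ninf _) _; rewrite ler_pM2l //; apply: le_trans iv.
      by apply/squareP.
    have k0 : cabs (P v - T u0) <= 2 * (N / rho (P u0)).
      by apply: le_trans (cabs_le_ninf _) _; rewrite ler_pM2l //; apply/squareP.
    have -> : T u - T u0 = (P v - T u0) - (P v - T u) by ring.
    have -> : s = 2 * (2 * (N / rho (P u0)) + 2 * (N * c / rho (P u0))) by rewrite /s; field; rewrite lt0r_neq0 // rho_gt0.
    rewrite ler_pM2l //; apply: le_trans (cabsBD _ _) _; exact: lerD.
  rewrite mem_set // mulr1 lee_fin -exprMn.
  by rewrite lerXn2r // nnegrE ?mulr_ge0 // ltW // ?rho_gt0.
rewrite integral_square_cst // lee_fin /K /s; apply: eq_leW.
by field; rewrite lt0r_neq0 // rho_gt0.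
Qed.

Variable F : R * R -> \bar R.
Hypotheses (mF : measurable_fun setT F) (F0 : forall u, (0 <= F u)%E).

Let H (q : (R * R) * (R * R)) : \bar R := ((rho (P q.1) ^+ 2 * \1_B q)%:E * F q.2)%E.

Let H0 q : (0 <= H q)%E.
Proof. by rewrite /H mule_ge0 // lee_fin mulr_ge0 ?sqr_ge0 // indicE. Qed.

Let mH : measurable_fun setT H.
Proof.
apply: emeasurable_funM; last exact: (measurableT_comp mF measurable_snd).
apply/measurable_EFinP; apply: measurable_funM; last exact: measurable_indic.
by apply: measurable_funX; exact: (measurableT_comp measurable_rho measurable_fst).
Qed.

Let G u := ((rho (P u) ^+ 2)%:E * \int[dm]_(v in square (T u) (N / rho (P u))) F v)%E.

Let HG u : (\int[dm]_v H (u, v) = (G \_ E) u)%E.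
Proof.
rewrite patchE; case: ifPn => uE; last first.
  rewrite integral0_eq // => v _; rewrite /H /= indicE memNset ?mulr0 ?mul0e //.
  by move=> [/= Eu _]; move: uE; rewrite notin_setE; apply.
rewrite inE in uE.
rewrite /G -ge0_integralZl //; last 3 first.
- exact: measurable_square.
- exact: measurable_funTS.
- by rewrite lee_fin sqr_ge0.
rewrite [RHS]integral_mkcond; apply: eq_integral => v _; rewrite /H /= patchE indicE.
case: ifPn => hv.
  by rewrite mem_set ?mulr1 //; split => //; rewrite inE in hv.
rewrite memNset ?mulr0 ?mul0e ?mule0 //.
by move=> [/= _ h]; move: hv; rewrite notin_setE; apply.
Qed.

Lemma transfer_measurable : measurable_fun E G.
Proof.
apply: (measurable_restrictT G mE).2.
rewrite (_ : G \_ E = (fun u => \int[dm]_v H (u, v))%E); last by apply/funext => u; rewrite HG.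
exact: (plane_measurable_F mH H0).
Qed.

(** After Tonelli's theorem the inner integral, over [u] for fixed [v], is the one bounded in
    [covering]. *)
Lemma transfer : (\int[dm]_(u in E) G u <= K%:E * \int[dm]_v F v)%E.
Proof.
rewrite integral_mkcond.
under eq_integral do rewrite -HG.
rewrite (plane_tonelli mH H0).
have K0 : (0 <= K%:E)%E by rewrite lee_fin; apply: mulr_ge0; [apply: mulr_ge0|]; rewrite ?sqr_ge0.
rewrite -ge0_integralZl //.
apply: ge0_le_integral => //.
- by move=> v _; apply: integral_ge0 => u _; exact: H0.
- exact: (plane_measurable_G mH H0).
- exact: measurable_funeM.
move=> v _; rewrite /H /=.
rewrite ge0_integralZr //.
- by apply: lee_wpmul2r => //; exact: covering.
- apply/measurable_EFinP; apply: measurable_funM.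
    by apply: measurable_funX; exact: measurable_rho.
  apply: (@measurable_fun_pair1 _ _ _ _ _ _ (fun q : (R * R) * (R * R) => \1_B q : R)).
  exact: measurable_indic.
- by move=> u _; rewrite lee_fin mulr_ge0 ?sqr_ge0 // indicE.
Qed.

End Covering.

End Transfer.

(** * From local suprema to weighted integrals *)

Section LocalControl.
Variable R : realType.
Local Notation C := (R[i]).
Local Notation mu := (@lebesgue_measure R).
Local Notation dm := (mu \x mu)%E.
Local Notation P := (@of_pair R).
Implicit Types (z w : C) (u v : R * R) (a p m N A : R).

(** The case [m = 0] is the Gaussian weight of the Fock norm; [m = p] is the weight for
    derivatives. *)
Definition weight a m z : R := rho z `^ (- m) * expR (- a * cabs z ^+ 2).

Lemma weight_gt0 a m z : 0 < weight a m z.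
Proof. by rewrite mulr_gt0 ?expR_gt0 // powR_gt0 // rho_gt0. Qed.

Lemma weight_ge0 a m z : 0 <= weight a m z.
Proof. exact/ltW/weight_gt0. Qed.

Lemma measurable_weight a m : measurable_fun setT (fun u => weight a m (P u)).
Proof.
apply: measurable_funM.
  exact: (measurableT_comp (measurable_powR _) (@measurable_rho R)).
apply: (measurableT_comp (@measurable_expR R)).
apply: measurable_funM => //; apply: measurable_funX.
exact: (measurable_entire (@entire_id R)).
Qed.

(** For [x = |z|] and [r = 1 / rho z], a displacement of length [2 N r] changes the squared modulus
    by a bounded amount: the cross term [4 N x r] is bounded because [x r <= 1]. *)
Lemma sqr_growth (x y N r : R) : 0 <= x -> 0 <= y -> 0 <= N -> 0 < r -> r * (1 + x) <= 1 ->
  y <= x + 2 * (N * r) -> y ^+ 2 <= x ^+ 2 + (4 * N + 4 * N ^+ 2).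
Proof.
move=> x0 y0 N0 r0 rx yx.
have r1 : r <= 1 by apply: le_trans rx; rewrite ler_peMr ?lerDl // ltW.
have xr : x * r <= 1 by apply: le_trans rx; rewrite mulrC ler_pM2l // lerDr.
have h : y ^+ 2 <= (x + 2 * (N * r)) ^+ 2.
  by rewrite lerXn2r // nnegrE addr_ge0 // !mulr_ge0 // ltW.
apply: le_trans h _.
have -> : (x + 2 * (N * r)) ^+ 2 = x ^+ 2 + (4 * N * (x * r) + 4 * N ^+ 2 * (r * r)) by ring.
rewrite lerD2l; apply: lerD; rewrite -[leRHS]mulr1; apply: ler_wpM2l => //.
- by rewrite mulr_ge0.
- by rewrite mulr_ge0 ?sqr_ge0.
- by rewrite -[leRHS]mulr1 ler_pM // ltW.
Qed.

Lemma near_cabs z w N : ninf (w - z) <= N / rho z -> cabs w <= cabs z + 2 * (N * (rho z)^-1).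
Proof.
move=> h; have := cabsD (w - z) z; rewrite subrK => /le_trans; apply.
by rewrite addrC lerD2l; apply: le_trans (cabs_le_ninf _) _; rewrite ler_pM2l.
Qed.

Lemma weight_comparable a m N : 0 <= a -> 0 <= m -> 0 <= N -> exists2 c, 0 < c & forall z w,
  ninf (w - z) <= N / rho z -> weight a m z <= c * weight a m w.
Proof.
move=> a0 m0 N0.
exists ((1 + 2 * N) `^ m * expR (a * (4 * N + 4 * N ^+ 2))).
  by rewrite mulr_gt0 ?expR_gt0 // powR_gt0 // ltr_pwDl // mulr_ge0.
move=> z w /near_cabs h; rewrite /weight.
have rz := rho_gt0 z; have rw := rho_gt0 w.
have i1 : (rho z)^-1 <= 1 by rewrite invf_le1 // rho_ge1.
have rle : rho w <= (1 + 2 * N) * rho z.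
  have e1 : 2 * (N * (rho z)^-1) <= 2 * N * rho z.
    rewrite mulrA; apply: ler_wpM2l; first by rewrite mulr_ge0.
    exact: le_trans i1 (rho_ge1 z).
  rewrite mulrDl mul1r /rho -/(rho z) -addrA lerD2l.
  exact: le_trans h (lerD (lexx _) e1).
rewrite mulrACA; apply: ler_pM; rewrite ?powR_ge0 ?expR_ge0 //.
  have n2 : 0 <= 1 + 2 * N by rewrite addr_ge0 // mulr_ge0.
  rewrite !powRN ler_pdivlMr ?powR_gt0 // mulrC ler_pdivrMr ?powR_gt0 // -(powRM _ n2 (ltW rz)).
  by apply: (ge0_ler_powR m0); rewrite ?nnegrE ?(ltW rw) ?mulr_ge0 // ltW.
have key : cabs w ^+ 2 <= cabs z ^+ 2 + (4 * N + 4 * N ^+ 2).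
  apply: (@sqr_growth _ _ _ (rho z)^-1) => //; first by rewrite invr_gt0.
  by rewrite mulVf // lt0r_neq0.
rewrite -expRD ler_expR !mulNr -lerBlDr opprK; have := ler_wpM2l a0 key; rewrite mulrDr.
by move: (a * _) (a * _) (a * _) => x1 x2 x3; clear; lra.
Qed.

Lemma square_sub z w s r : ninf (w - z) <= s -> square w r `<=` square z (s + r).
Proof.
move=> h u /squareP hu; apply/squareP.
have := ninfD (P u - w) (w - z); rewrite subrKA => /le_trans; apply.
by rewrite [leRHS]addrC lerD.
Qed.

Lemma measurable_Lp_weight (q : C -> C) a m p : entire q ->
  measurable_fun setT (fun u => (cabs (q (P u)) `^ p * weight a m (P u))%:E).
Proof.
move=> eq; apply/measurable_EFinP; apply: measurable_funM; last exact: measurable_weight.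
exact: (measurableT_comp (measurable_powR p) (measurable_entire eq)).
Qed.

Lemma Lp_weight_ge0 (q : C -> C) a m p u : (0 <= (cabs (q (P u)) `^ p * weight a m (P u))%:E)%E.
Proof. by rewrite lee_fin mulr_ge0 ?powR_ge0 ?weight_ge0. Qed.

(* [X] is to be the modulus of a derivative divided by [rho], or an increment of a primitive
   multiplied by [rho]. *)
Theorem local_control a p m N A : 0 <= a -> 0 < p -> 0 <= m -> 1 <= N -> 0 <= A ->
  exists2 K : R, 0 < K & forall (q : C -> C) (X : C -> R), entire q ->
    measurable_fun setT (fun u => X (P u)) -> (forall z, 0 <= X z) ->
    (forall z M, 0 <= M -> (forall w, ninf (w - z) <= (N - 1) / rho z -> cabs (q w) <= M) -> X z <= A * M) ->
    (\int[dm]_u (X (P u) `^ p * weight a m (P u))%:E <=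
      K%:E * \int[dm]_u (cabs (q (P u)) `^ p * weight a m (P u))%:E)%E.
Proof.
move=> a0 p0 m0 N1 A0; have N0 : 0 < N by exact: lt_le_trans N1.
have [c c0 Hc] := weight_comparable a0 m0 (ltW N0).
have [S S0 HS] := submean p0.
have S0' := ltW S0; have c0' := ltW c0.
pose T u := P u.
have mT1 : measurable_fun setT (fun u => complex.Re (P u)) by exact: measurable_fst.
have mT2 : measurable_fun setT (fun u => complex.Im (P u)) by exact: measurable_snd.
have eT u v : [set: R * R] u -> [set: R * R] v -> cabs (P u - P v) <= 2 * cabs (T u - T v).
  by move=> _ _; have := cabs_ge0 (P u - P v); rewrite /T; lra.
have cT u : [set: R * R] u -> cabs (T u) <= cabs (P u) <= 2 * cabs (T u).
  by move=> _; have := cabs_ge0 (P u); rewrite /T lexx /=; lra.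
set L := 4 * (2 + 8 * N) ^+ 2 * (4 * N * (1 + (2 + 8 * N))) ^+ 2.
have L0 : 0 <= L by apply: mulr_ge0; [apply: mulr_ge0|]; rewrite ?sqr_ge0.
have AS0 : 0 <= A `^ p * S * c by rewrite !mulr_ge0 ?powR_ge0.
exists (A `^ p * S * c * L + 1); first exact: ltr_wpDl (mulr_ge0 AS0 L0) ltr01.
move=> q X eq mX X0 HX.
set F := fun u => (cabs (q (P u)) `^ p * weight a m (P u))%:E.
have mF : measurable_fun setT F by exact: measurable_Lp_weight.
have F0 u : (0 <= F u)%E by exact: Lp_weight_ge0.
have tm := @transfer_measurable R N T setT measurableT mT1 mT2 F mF F0.
have tr := @transfer R N T setT N0 measurableT mT1 mT2 eT cT F mF F0.
apply: (@le_trans _ _ ((A `^ p * S * c)%:E * (L%:E * \int[dm]_v F v))%E); last first.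
  rewrite muleA -EFinM; apply: lee_wpmul2r; first exact: integral_ge0.
  by rewrite lee_fin lerDl.
apply: le_trans (lee_wpmul2l _ tr); last by rewrite lee_fin.
rewrite -ge0_integralZl //; last first.
  by move=> u _; rewrite mule_ge0 ?lee_fin ?sqr_ge0 //; apply: integral_ge0.
apply: ge0_le_integral => //.
- by move=> u _; rewrite lee_fin mulr_ge0 ?powR_ge0 ?weight_ge0.
- apply/measurable_EFinP; apply: measurable_funM; last exact: measurable_weight.
  exact: (measurableT_comp (measurable_powR p) mX).
- exact: measurable_funeM.
move=> u _; set z := P u; set r := (rho z)^-1.
have rz := rho_gt0 z.
have r0 : 0 < r by rewrite invr_gt0.
have mS := measurable_square z (N / rho z).
pose I := (\int[dm]_(v in square z (N / rho z)) (cabs (q (P v)) `^ p)%:E)%E.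
have I0 : (0 <= I)%E by apply: integral_ge0 => v _; rewrite lee_fin powR_ge0.
have WI : ((weight a m z)%:E * I <= c%:E * \int[dm]_(v in square z (N / rho z)) F v)%E.
  rewrite /I -!ge0_integralZl //.
  - apply: ge0_le_integral => //.
    + by move=> v _; rewrite -EFinM lee_fin mulr_ge0 ?weight_ge0 ?powR_ge0.
    + by apply: measurable_funeM; exact: measurable_entire_powR.
    + by apply: measurable_funeM; exact: measurable_funTS.
    move=> v /squareP/Hc h; rewrite /F -!EFinM lee_fin mulrCA mulrC.
    by apply: ler_wpM2l => //; exact: powR_ge0.
  - exact: measurable_funTS.
  - exact: measurable_entire_powR.
  - by move=> v _; rewrite lee_fin powR_ge0.
  - by rewrite lee_fin weight_ge0.
(* It is enough to bound [X z ^ p] by the local average of [|q|^p]: the weight enters through [WI],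
   and [transfer] with the identity for [T] integrates the averages. *)
suff H : ((X z `^ p)%:E <= (A `^ p * S * rho z ^+ 2)%:E * I)%E.
  rewrite EFinM; apply: le_trans (lee_wpmul2r _ H) _; first by rewrite lee_fin weight_ge0.
  rewrite -muleA (muleC I); apply: le_trans (lee_wpmul2l _ WI) _.
    by rewrite lee_fin mulr_ge0 ?sqr_ge0 // !mulr_ge0 ?powR_ge0.
  rewrite !muleA -!EFinM; apply: eq_leW; congr (_%:E * _)%E; ring.
(* Half-side [N] splits as [(N - 1) + 1]: a square of half-side [1 / rho z] around [w] stays inside
   the one of half-side [N / rho z] around [z]. *)
have sup w : ninf (w - z) <= (N - 1) / rho z -> ((cabs (q w) `^ p * r ^+ 2)%:E <= S%:E * I)%E.
  move=> h; apply: le_trans (HS _ w r eq r0) _.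
  apply: lee_wpmul2l; first by rewrite lee_fin ltW.
  apply: ge0_subset_integral => //.
  - exact: measurable_square.
  - exact: measurable_entire_powR.
  - by move=> v _; rewrite lee_fin powR_ge0.
  have -> : N / rho z = (N - 1) / rho z + r by rewrite /r; field; rewrite lt0r_neq0.
  exact: square_sub.
(* For [A = 0] and [I] infinite the right-hand side of the goal is [0], so [X z = 0] is shown
   directly, from a local bound of [q]. *)
have [Ap|Ap] := eqVneq (A `^ p) 0.
  have A00 : A = 0 by apply/eqP; move/eqP: Ap; rewrite powR_eq0 => /andP[].
  have Xz : X z = 0.
    have [M M0 HM] := entire_bounded_at z (2 * ((N - 1) / rho z)) eq.
    apply/eqP; rewrite eq_le X0 andbT; have := HX z M M0; rewrite A00 mul0r; apply.
    by move=> w h; apply: HM; apply: le_trans (cabs_le_ninf _) _; rewrite ler_pM2l.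
  by rewrite Xz powR0 ?gt_eqF // mule_ge0 // lee_fin Ap !mul0r.
have App : 0 < A `^ p by rewrite lt_neqAle eq_sym Ap powR_ge0.
have [->|Iy] := eqVneq I +oo%E.
  by rewrite gt0_muley ?leey // lte_fin !mulr_gt0 // exprn_gt0.
have If : I \is a fin_num by rewrite ge0_fin_numE // ltey.
move: sup; rewrite -(fineK If); set i := fine I => sup.
have i0 : 0 <= i by rewrite fine_ge0.
(* The [p]-th root of the sub-mean value bound, hence a bound for [|q|] itself on the smaller
   square. *)
pose M := (S * i * rho z ^+ 2) `^ p^-1.
have Y0 : 0 <= S * i * rho z ^+ 2 by rewrite mulr_ge0 ?sqr_ge0 // mulr_ge0.
have Mp : M `^ p = S * i * rho z ^+ 2 by rewrite -powRrM mulVf ?gt_eqF // powRr1.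
have XM : X z <= A * M.
  apply: HX; first exact: powR_ge0.
  move=> w /sup; rewrite -EFinM lee_fin => h.
  have h1 : cabs (q w) `^ p <= S * i * rho z ^+ 2.
    move: h; rewrite /r -ler_pdivlMr ?exprn_gt0 ?invr_gt0 //.
    by rewrite exprVn invrK.
  rewrite -(powRr1 (cabs_ge0 (q w))) -(divff (lt0r_neq0 p0)) powRrM.
  by apply: ge0_ler_powR; rewrite ?nnegrE ?powR_ge0 // invr_ge0 ltW.
rewrite -EFinM lee_fin.
apply: le_trans (ge0_ler_powR (ltW p0) _ _ XM) _; rewrite ?nnegrE ?mulr_ge0 ?powR_ge0 //.
rewrite powRM ?powR_ge0 // Mp; apply: eq_leW; ring.
Qed.

End LocalControl.

(** * The bound for derivatives, and the displacement used for primitives *)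

Section LittlewoodPaley.
Variable R : realType.
Local Notation C := (R[i]).
Local Notation mu := (@lebesgue_measure R).
Local Notation dm := (mu \x mu)%E.
Local Notation P := (@of_pair R).
Implicit Types (z w : C) (u v : R * R) (a p : R) (h : C -> C).

Lemma powR_div (x y p : R) : 0 <= x -> 0 < y -> (x / y) `^ p = x `^ p * y `^ (- p).
Proof. by move=> x0 y0; rewrite powRM ?invr_ge0 ?(ltW y0) // powR_invl. Qed.

Lemma measurable_inv_pos (f : R * R -> R) : (forall u, 0 <= f u) -> measurable_fun setT f ->
  measurable_fun setT (fun u => (f u)^-1).
Proof.
move=> f0 mf; rewrite (_ : (fun u => (f u)^-1) = (fun u => f u `^ (-1))).
  exact: (measurableT_comp (measurable_powR _) mf).
by apply/funext => u; rewrite powR_inv1.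
Qed.

(** The Cauchy estimate on the disk of radius [1 / rho z] bounds [|h'| / rho] by [16] times the
    local supremum of [|h|], which is [local_control] with [N = 2] and [A = 16]; dividing by [rho]
    turns [weight a p] into [weight a 0]. *)
Theorem derivative_bound a p : 0 <= a -> 0 < p -> exists2 K : R, 0 < K & forall h, entire h ->
  (\int[dm]_u (cabs (cderiv h (P u)) `^ p * weight a p (P u))%:E <=
    K%:E * \int[dm]_u (cabs (h (P u)) `^ p * weight a 0 (P u))%:E)%E.
Proof.
move=> a0 p0.
have [K K0 HK] := @local_control R a p 0 2 16 a0 p0 (lexx _) (ler1n _ _) (ler0n _ _).
exists K => // h eh; have eh' := entire_cderiv eh.
pose X z := cabs (cderiv h z) / rho z.
have E : (fun u => (cabs (cderiv h (P u)) `^ p * weight a p (P u))%:E) =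
         (fun u => (X (P u) `^ p * weight a 0 (P u))%:E).
  apply/funext => u; rewrite /X powR_div ?rho_gt0 // /weight oppr0 powRr0 mul1r.
  by congr EFin; rewrite mulrA.
rewrite E; apply: HK => //.
- apply: measurable_funM; first exact: measurable_entire.
  by apply: measurable_inv_pos; [move=> u; rewrite ltW // rho_gt0 | exact: measurable_rho].
- by move=> z; rewrite divr_ge0 // ltW // rho_gt0.
move=> z M M0 HM; have rz := rho_gt0 z.
rewrite /X ler_pdivrMr //.
have r0 : 0 < (rho z)^-1 by rewrite invr_gt0.
have := @cauchy_estimate R h (cderiv h) z (rho z)^-1 M r0 (entire_cder eh).
rewrite invrK; apply=> w hw; apply: HM.
by apply: le_trans (ninf_le_cabs _) _; apply: le_trans hw _; rewrite (_ : 2 - 1 = 1) ?mul1r //; ring.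
Qed.

(* Polarization reduces the real and imaginary parts to moduli. *)
Lemma measurable_entire_Re h : entire h -> measurable_fun setT (fun u => complex.Re (h (P u))).
Proof.
move=> eh.
have -> : (fun u => complex.Re (h (P u))) =
   (fun u => (cabs (h (P u) + 1) ^+ 2 - cabs (h (P u) - 1) ^+ 2) / 4).
  by apply/funext => u; rewrite !cabs_sqr; case: (h _) => x y /=; field.
apply: measurable_funM => //; apply: measurable_funB; apply: measurable_funX.
  exact: (measurable_entire (entireD eh (@entire_cst R 1))).
exact: (measurable_entire (entireB eh (@entire_cst R 1))).
Qed.

Lemma measurable_entire_Im h : entire h -> measurable_fun setT (fun u => complex.Im (h (P u))).
Proof.
move=> eh.
have -> : (fun u => complex.Im (h (P u))) =
   (fun u => (cabs (h (P u) + 'i%C) ^+ 2 - cabs (h (P u) - 'i%C) ^+ 2) / 4).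
  by apply/funext => u; rewrite !cabs_sqr; case: (h _) => x y /=; field.
apply: measurable_funM => //; apply: measurable_funB; apply: measurable_funX.
  exact: (measurable_entire (entireD eh (@entire_cst R 'i%C))).
exact: (measurable_entire (entireB eh (@entire_cst R 'i%C))).
Qed.

Lemma measurable_comp_plane (g : R * R -> R) (f : R * R -> C) : measurable_fun setT g ->
  measurable_fun setT (fun u => complex.Re (f u)) -> measurable_fun setT (fun u => complex.Im (f u)) ->
  measurable_fun setT (fun u => g (complex.Re (f u), complex.Im (f u))).
Proof.
move=> mg m1 m2.
exact: (measurableT_comp mg (measurable_fun_pair m1 m2)).
Qed.

Lemma measurable_cabs_comp (f : R * R -> C) :
  measurable_fun setT (fun u => complex.Re (f u)) -> measurable_fun setT (fun u => complex.Im (f u)) ->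
  measurable_fun setT (fun u => cabs (f u)).
Proof.
move=> m1 m2; have := measurable_comp_plane (measurable_entire (@entire_id R)) m1 m2.
by congr (measurable_fun _ _); apply/funext => u; rewrite /= of_pairK.
Qed.

(** Write [s z - t w = t (z - w) + (s - t) z]. The scalar product of [z - w] and [z] is nonnegative
    because [|w| <= |z|], so the second term does not shorten the first. *)
Lemma expanding_radial z w (s t : R) : 2^-1 <= t -> t <= s -> cabs w <= cabs z ->
  cabs (z - w) <= 2 * cabs ((s%:C)%C * z - (t%:C)%C * w).
Proof.
move=> t2 ts wz.
have t0 : 0 < t by apply: lt_le_trans t2; rewrite invr_gt0.
suff H : t * cabs (z - w) <= cabs ((s%:C)%C * z - (t%:C)%C * w).
  have : 2^-1 * cabs (z - w) <= t * cabs (z - w) by apply: ler_wpM2r.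
  by move=> /le_trans /(_ H); rewrite ler_pdivrMl.
rewrite -(@ler_pXn2r _ 2) ?nnegrE ?mulr_ge0 ?(ltW t0) // exprMn !cabs_sqr.
have : cabs w ^+ 2 <= cabs z ^+ 2 by rewrite lerXn2r // nnegrE.
rewrite !cabs_sqr; case: z {wz} => x y; case: w => x' y' /=; rewrite !mul0r !subr0 !addr0 => h.
rewrite -subr_ge0.
have -> : (s * x - t * x') ^+ 2 + (s * y - t * y') ^+ 2 - t ^+ 2 * ((x - x') ^+ 2 + (y - y') ^+ 2) =
   t * (s - t) * ((x - x') ^+ 2 + (y - y') ^+ 2 + (x ^+ 2 + y ^+ 2 - (x' ^+ 2 + y' ^+ 2)))
   + (s - t) ^+ 2 * (x ^+ 2 + y ^+ 2) by ring.
apply: addr_ge0; last by rewrite mulr_ge0 ?sqr_ge0 // addr_ge0 ?sqr_ge0.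
apply: mulr_ge0; first by rewrite mulr_ge0 ?subr_ge0 // ltW.
by rewrite addr_ge0 ?subr_ge0 // addr_ge0 ?sqr_ge0.
Qed.

(* Moving [z] towards [0] by [K / rho z] multiplies [e^(-a |z|^2)] by about [e^(2 a K)] but
   changes a primitive [h] only by about [K |h'| / rho]: for [K] large, the integral of
   [|h o step|^p] is a small multiple of that of [|h|^p]. *)
Section Step.
Variable K : R.
Hypothesis K2 : 2 <= K.

Let K0 : 0 < K.
Proof. exact: lt_le_trans (ltr0n R 2) K2. Qed.

(** From this radius on, the displacement [K / rho z] is at most half of [|z|]. *)
Let R0 : R := 2 * K + 1.

Definition shrink z : R := 1 - K / (cabs z * rho z).

(** Points closer to the origin are sent to [0], where the primitive vanishes, so that they
    contribute nothing to the integral of [|h o step|^p]. *)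
Definition step z : C := if R0 <= cabs z then (((shrink z)%:C)%C * z)%R else 0.

Lemma far_gt0 z : R0 <= cabs z -> 0 < cabs z.
Proof. by apply: lt_le_trans; rewrite ltr_wpDl // mulr_ge0 // ltW. Qed.

Lemma shrink_bounds z : R0 <= cabs z -> 2^-1 <= shrink z <= 1.
Proof.
move=> h; have z0 := far_gt0 h; have rz := rho_gt0 z.
have d0 : 0 < cabs z * rho z by exact: mulr_gt0.
have q0 : 0 <= K / (cabs z * rho z) by apply: divr_ge0; exact: ltW.
have : K / (cabs z * rho z) <= 2^-1.
  rewrite ler_pdivrMr // mulrC ler_pdivlMr // mulrC.
  apply: le_trans (_ : cabs z <= _); first by apply: le_trans h; rewrite lerDl.
  by rewrite ler_peMr // rho_ge1.
by move: q0; rewrite /shrink; move: (K / _) => x; lra.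
Qed.

Lemma shrink_mono z w : R0 <= cabs w -> cabs w <= cabs z -> shrink w <= shrink z.
Proof.
move=> h wz; have w0 := far_gt0 h; have z0 := lt_le_trans w0 wz.
rewrite lerD2l lerN2; apply: ler_wpM2l; first exact: ltW.
rewrite lef_pV2 ?posrE ?mulr_gt0 ?rho_gt0 //.
by apply: ler_pM => //; rewrite ?(ltW (rho_gt0 _)) // /rho lerD2l.
Qed.

Lemma step_expanding z w : R0 <= cabs z -> R0 <= cabs w -> cabs (z - w) <= 2 * cabs (step z - step w).
Proof.
move=> hz hw; rewrite /step hz hw.
have /andP[z1 _] := shrink_bounds hz; have /andP[w1 _] := shrink_bounds hw.
have [wz|/ltW zw] := leP (cabs w) (cabs z).
  by apply: expanding_radial => //; exact: shrink_mono.
by rewrite cabsB (cabsB (_ * z)); apply: expanding_radial => //; exact: shrink_mono.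
Qed.

Lemma cabs_step z : R0 <= cabs z -> cabs (step z) = cabs z - K / rho z.
Proof.
move=> h; rewrite /step h cabsM cabs_real ger0_norm.
  by rewrite /shrink; field; rewrite !lt0r_neq0 ?rho_gt0 // far_gt0.
by have /andP[h1 _] := shrink_bounds h; apply: le_trans h1; rewrite invr_ge0.
Qed.

Lemma step_comparable z : R0 <= cabs z -> cabs (step z) <= cabs z <= 2 * cabs (step z).
Proof.
move=> h; rewrite /step h cabsM cabs_real.
have /andP[h1 h2] := shrink_bounds h.
rewrite ger0_norm; last by apply: le_trans h1; rewrite invr_ge0.
rewrite ler_piMl //= mulrA ler_peMl //.
by move: h1; lra.
Qed.

Lemma step_near z : cabs (z - step z) <= (R0 * (1 + R0)) / rho z.
Proof.
have rz := rho_gt0 z.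
have R00 : 0 < R0 by rewrite ltr_wpDl // mulr_ge0 // ltW.
have KR : K <= R0 * (1 + R0).
  have h1 : K <= R0 by rewrite /R0; move: K0; lra.
  by apply: le_trans h1 _; rewrite ler_peMr ?lerDl // ltW.
rewrite /step; case: ifPn => h.
  have -> : z - ((shrink z)%:C)%C * z = ((1 - shrink z)%:C)%C * z.
    by move: (shrink z) => s; case: (z) => x y; apply: complexP => /=; ring.
  have /andP[_ h2] := shrink_bounds h.
  rewrite cabsM cabs_real ger0_norm ?subr_ge0 //.
  have -> : (1 - shrink z) * cabs z = K / rho z.
    by rewrite /shrink; field; rewrite !lt0r_neq0 ?rho_gt0 // far_gt0.
  by rewrite ler_pM2r // invr_gt0.
rewrite -ltNge in h; rewrite subr0 ler_pdivlMr //.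
by apply: ler_pM; rewrite ?(ltW rz) // ?(ltW h) // /rho lerD2l ltW.
Qed.

(** The first conclusion keeps the averages around [step z] inside any disk about [0] that contains
    [z]. In the second, [e^(- a K / 2)] is the gain from the displacement, and [8 a] the price of
    replacing [step z] by a point [w] of the square around it. *)
Lemma step_weight a z w : 0 <= a -> R0 <= cabs z -> ninf (w - step z) <= 1 / rho z ->
  cabs w <= cabs z /\ weight a 0 z <= expR (8 * a - a * K / 2) * weight a 0 w.
Proof.
move=> a0 hz hw; have rz := rho_gt0 z; set r := (rho z)^-1.
have r0 : 0 < r by rewrite invr_gt0.
have R01 : 1 <= R0 by rewrite lerDr mulr_ge0 // ltW.
have z1 : 1 <= cabs z by exact: le_trans hz.
have rzE : r + r * cabs z = 1 by rewrite -{1}[r]mulr1 -mulrDr mulVf // lt0r_neq0.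
have st := cabs_step hz.
have wle : cabs w <= cabs (step z) + 2 * r.
  have := cabsD (w - step z) (step z); rewrite subrK => /le_trans; apply.
  by rewrite addrC lerD2l; apply: le_trans (cabs_le_ninf _) _; rewrite ler_pM2l // -[r]mul1r.
have /andP[s1 s2] := step_comparable hz.
rewrite -/r in st.
split.
  have : 2 * r <= K * r by rewrite ler_pM2r.
  by move: wle st; lra.
have key : cabs w ^+ 2 <= cabs z ^+ 2 + (8 - K / 2).
  have h1 : cabs w ^+ 2 <= (cabs (step z) + 2 * r) ^+ 2.
    have p0 : 0 <= cabs (step z) + 2 * r by rewrite addr_ge0 // mulr_ge0 // ltW.
    by apply: lerXn2r; rewrite ?nnegrE.
  apply: le_trans h1 _; have s0 := cabs_ge0 (step z).
  have rs : r * cabs (step z) <= 1.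
    apply: le_trans (_ : r * cabs z <= _); first by rewrite ler_pM2l.
    by move: rzE r0; lra.
  have rr : r * r <= 1.
    have r1 : r <= 1 by rewrite invf_le1 // rho_ge1.
    by rewrite -[leRHS]mulr1 ler_pM // ltW.
  have -> : (cabs (step z) + 2 * r) ^+ 2 = cabs (step z) ^+ 2 + 4 * (r * cabs (step z)) + 4 * (r * r) by ring.
  have rz2 : 2^-1 <= r * cabs z by move: rzE (ler_wpM2l (ltW r0) z1); rewrite mulr1; lra.
  (* Squaring [|z| = |step z| + K r] gains [2 K r |step z|], which is at least [K r |z|], hence at
     least [K / 2]. *)
  have sq : cabs (step z) ^+ 2 <= cabs z ^+ 2 - K / 2.
    have -> : cabs z ^+ 2 = (cabs (step z) + K * r) ^+ 2 by rewrite st subrK.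
    have Kr0 : 0 <= K * r by rewrite mulr_ge0 // ltW.
    have : K * (r * cabs z) <= K * r * (2 * cabs (step z)).
      by rewrite (mulrA K r); apply: ler_wpM2l.
    have : K * 2^-1 <= K * (r * cabs z) by rewrite ler_pM2l.
    have := sqr_ge0 (K * r); have := mulr_ge0 Kr0 s0.
    by rewrite sqrrD; lra.
  by move: sq rs rr; lra.
rewrite /weight oppr0 !powRr0 !mul1r -expRD ler_expR.
have := ler_wpM2l a0 key; rewrite mulrDr mulrBr.
have -> : a * (K / 2) = a * K / 2 by rewrite mulrA.
rewrite !mulNr (mulrC 8); by lra.
Qed.

Lemma measurable_far : measurable [set u | R0 <= cabs (P u)].
Proof.
apply: (@measurable_le_set R _ _ (fun=> R0) (fun u => cabs (P u))) => //.
exact: (measurable_entire (@entire_id R)).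
Qed.

Lemma measurable_step :
  measurable_fun setT (fun u => complex.Re (step (P u))) /\
  measurable_fun setT (fun u => complex.Im (step (P u))).
Proof.
have mc : measurable_fun setT (fun u => cabs (P u)) by exact: (measurable_entire (@entire_id R)).
have ms : measurable_fun setT (fun u => shrink (P u)).
  apply: measurable_funB => //; apply: measurable_funM => //.
  apply: measurable_inv_pos; first by move=> u; rewrite mulr_ge0 // ltW // rho_gt0.
  by apply: measurable_funM => //; exact: measurable_rho.
have mb : measurable_fun setT (fun u => R0 <= cabs (P u)).
  by apply: measurable_fun_ler.
split.
  have -> : (fun u => complex.Re (step (P u))) = (fun u => if R0 <= cabs (P u) then shrink (P u) * u.1 else 0).
    by apply/funext => u; rewrite /step; case: ifP => //= _; rewrite mul0r subr0.
  by apply: measurable_fun_ifT => //; apply: measurable_funM => //; exact: measurable_fst.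
have -> : (fun u => complex.Im (step (P u))) = (fun u => if R0 <= cabs (P u) then shrink (P u) * u.2 else 0).
  by apply/funext => u; rewrite /step; case: ifP => //= _; rewrite mul0r addr0.
by apply: measurable_fun_ifT => //; apply: measurable_funM => //; exact: measurable_snd.
Qed.

End Step.
End LittlewoodPaley.

(** * The bound for primitives, by absorption *)

Section PrimitiveBound.
Variable R : realType.
Local Notation C := (R[i]).
Local Notation mu := (@lebesgue_measure R).
Local Notation dm := (mu \x mu)%E.
Local Notation P := (@of_pair R).
Implicit Types (z w : C) (u v : R * R) (a p : R) (h : C -> C).

Lemma integral_exhaust d (S : measurableType d) (m : {measure set S -> \bar R})
    (E : nat -> set S) (f : S -> \bar R) B :
  (forall i j, (i <= j)%N -> E i `<=` E j) -> (forall n, measurable (E n)) -> \bigcup_n E n = setT ->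
  measurable_fun setT f -> (forall x, (0 <= f x)%E) ->
  (forall n, (\int[m]_(x in E n) f x <= B)%E) -> (\int[m]_x f x <= B)%E.
Proof.
move=> nE mE uE mf f0 fB.
have cv : (\int[m]_(x in E n) f x)%E @[n --> \oo] --> (\int[m]_x f x)%E.
  rewrite -uE; apply: ge0_nondecreasing_set_cvg_integral => //.
  - by move=> i j ij; apply/subsetPset; exact: nE.
  - by move=> n; exact: measurable_funTS.
rewrite -(cvg_lim _ cv) //; apply: lime_le; first by apply/cvg_ex; eexists; exact: cv.
exact: nearW.
Qed.

(** A quasi-triangle inequality for every [p > 0]: the sum is at most twice the larger term. *)
Lemma powR_add_le (x y p : R) : 0 <= x -> 0 <= y -> 0 < p ->
  (x + y) `^ p <= 2 `^ p * (x `^ p + y `^ p).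
Proof.
move=> x0 y0 p0; have p0' := ltW p0.
wlog xy : x y x0 y0 / x <= y.
  move=> H; have [xy|/ltW yx] := leP x y; first exact: H.
  by rewrite addrC (addrC (x `^ p)); exact: H.
apply: le_trans (_ : (2 * y) `^ p <= _).
  apply: (ge0_ler_powR p0'); rewrite ?nnegrE ?addr_ge0 ?mulr_ge0 //.
  by rewrite mulr2n mulrDl mul1r lerD2r.
by rewrite powRM // ler_wpM2l ?powR_ge0 // lerDr powR_ge0.
Qed.

Definition disk (r : R) : set (R * R) := [set u | cabs (P u) <= r].

Lemma measurable_disk r : measurable (disk r).
Proof.
apply: (@measurable_le_set R _ _ (fun u => cabs (P u)) (fun=> r)) => //.
exact: (measurable_entire (@entire_id R)).
Qed.

Lemma weight_le1 a m z : 0 <= a -> 0 <= m -> weight a m z <= 1.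
Proof.
move=> a0 m0; rewrite -[leRHS]mulr1; apply: ler_pM; rewrite ?powR_ge0 ?expR_ge0 //.
  rewrite powRN invf_le1 ?powR_gt0 ?rho_gt0 // -[leLHS](powRr0 (rho z)).
  by apply: ler_powR => //; exact: rho_ge1.
by rewrite -expR0 ler_expR mulNr oppr_le0 mulr_ge0 // sqr_ge0.
Qed.

Lemma disk_integral_finite h a p r : 0 <= a -> 0 < p -> entire h ->
  (\int[dm]_(u in disk r) (cabs (h (P u)) `^ p * weight a 0 (P u))%:E < +oo)%E.
Proof.
move=> a0 p0 eh.
pose m := Num.max 0 r.
have [M M0 HM] := entire_bounded (m) eh.
have r0 : 0 <= m by rewrite le_max lexx.
have Q : (\int[dm]_(u in disk r) (cabs (h (P u)) `^ p * weight a 0 (P u))%:E <= \int[dm]_(u in square 0%R m) (M `^ p)%:E)%E.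
  rewrite [leLHS]integral_mkcond [leRHS]integral_mkcond.
  have mS := measurable_square 0 (m); have mD := measurable_disk r.
  apply: ge0_le_integral => //.
  - by move=> u _; rewrite patchE; case: ifP => // _; exact: Lp_weight_ge0.
  - by apply/(measurable_restrictT _ _).1 => //; apply: measurable_funTS; exact: measurable_Lp_weight.
  - by apply/(measurable_restrictT _ _).1 => //; exact: measurable_cst.
  move=> u _; rewrite !patchE; case: ifPn => [|_]; last first.
    by case: ifP => // _; rewrite lee_fin powR_ge0.
  rewrite inE /disk /= => ur.
  have ur' : cabs (P u) <= m by rewrite le_max ur orbT.
  rewrite ifT.
    rewrite lee_fin -[leRHS]mulr1; apply: ler_pM; rewrite ?powR_ge0 ?weight_ge0 //.
      by apply: (ge0_ler_powR (ltW p0)); rewrite ?nnegrE //; exact: HM.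
    exact: weight_le1.
  rewrite inE; apply/squareP; rewrite subr0; exact: le_trans (ninf_le_cabs _) ur'.
by apply: (le_lt_trans Q); rewrite integral_square_cst // ltry.
Qed.

Section Absorb.
Variables (a p K : R).
Hypotheses (a0 : 0 < a) (p0 : 0 < p) (K2 : 2 <= K).
Variable h : C -> C.
Hypotheses (eh : entire h) (h0 : h 0 = 0).

Let a0' : 0 <= a. Proof. exact: ltW. Qed.

Lemma measurable_h_step : measurable_fun setT (fun u => cabs (h (step K (P u)))).
Proof.
have [m1 m2] := measurable_step K.
have := measurable_comp_plane (measurable_entire eh) m1 m2.
by congr (measurable_fun _ _); apply/funext => u; rewrite of_pairK.
Qed.

(** The displacement has length [O(1 / rho)], so the factor [rho] makes this comparable to the local
    supremum of [|h'|]. *)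
Definition jump z : R := cabs (h z - h (step K z)) * rho z.

Lemma measurable_jump : measurable_fun setT (fun u => jump (P u)).
Proof.
have [m1 m2] := measurable_step K.
apply: measurable_funM; last exact: measurable_rho.
have r1 : measurable_fun setT (fun u => complex.Re (h (step K (P u)))).
  have := measurable_comp_plane (measurable_entire_Re eh) m1 m2.
  by congr (measurable_fun _ _); apply/funext => u; rewrite of_pairK.
have r2 : measurable_fun setT (fun u => complex.Im (h (step K (P u)))).
  have := measurable_comp_plane (measurable_entire_Im eh) m1 m2.
  by congr (measurable_fun _ _); apply/funext => u; rewrite of_pairK.
apply: measurable_cabs_comp.
  have -> : (fun u => complex.Re (h (P u) - h (step K (P u)))) =
     (fun u => complex.Re (h (P u)) - complex.Re (h (step K (P u)))).
    by apply/funext => u; case: (h _) => x y; case: (h _).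
  by apply: measurable_funB => //; exact: measurable_entire_Re.
have -> : (fun u => complex.Im (h (P u) - h (step K (P u)))) =
   (fun u => complex.Im (h (P u)) - complex.Im (h (step K (P u)))).
  by apply/funext => u; case: (h _) => x y; case: (h _).
by apply: measurable_funB => //; exact: measurable_entire_Im.
Qed.

Let N0 : R := (2 * K + 1) * (1 + (2 * K + 1)).

Lemma jump_le z M : 0 <= M -> (forall w, ninf (w - z) <= N0 / rho z -> cabs (cderiv h w) <= M) ->
  jump z <= 2 * N0 * M.
Proof.
move=> M0 HM; have rz := rho_gt0 z.
have st := step_near K2 z.
rewrite /jump -ler_pdivlMr //.
have := @mean_value R h (cderiv h) z (step K z - z) M (entire_cder eh).
rewrite subrKC cabsB => H.
apply: le_trans (H _) _.
  move=> t /andP[t0 t1]; apply: HM.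
  rewrite addrC addKr; apply: le_trans (ninf_le_cabs _) _.
  rewrite cabsM cabs_real ger0_norm // (cabsB (step K z)).
  by apply: le_trans st; rewrite ler_piMl.
rewrite cabsB (_ : 2 * N0 * M / rho z = 2 * M * (N0 / rho z)); last by ring.
by apply: ler_wpM2l => //; rewrite mulr_ge0.
Qed.

Lemma jump_ge0 z : 0 <= jump z.
Proof. by rewrite mulr_ge0 // ltW // rho_gt0. Qed.

(** The factor [rho^p] in [jump^p] cancels [rho^(-p)] in [weight a p]. *)
Lemma split_jump z : cabs (h z) `^ p * weight a 0 z <=
  2 `^ p * (cabs (h (step K z)) `^ p * weight a 0 z) + 2 `^ p * (jump z `^ p * weight a p z).
Proof.
have rz := rho_gt0 z.
have -> : jump z `^ p * weight a p z = cabs (h z - h (step K z)) `^ p * weight a 0 z.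
  rewrite /jump powRM ?(ltW rz) // /weight oppr0 powRr0 mul1r mulrA -(mulrA _ (rho z `^ p)) -powRD.
    by rewrite subrr powRr0 mulr1.
  by rewrite (gt_eqF rz) implybT.
rewrite -mulrDr -mulrDl mulrA; apply: ler_wpM2r; first exact: weight_ge0.
apply: le_trans (powR_add_le _ _ p0) => //.
apply: (ge0_ler_powR (ltW p0)); rewrite ?nnegrE ?addr_ge0 //.
by have := cabsD (h (step K z)) (h z - h (step K z)); rewrite subrKC.
Qed.

Let S1 (S : R) := forall z r, 0 < r ->
  ((cabs (h z) `^ p * r ^+ 2)%:E <= S%:E *
     \int[dm]_(u in square z r) (cabs (h (P u)) `^ p)%:E)%E.

Let c1 : R := expR (8 * a - a * K / 2).
Let L : R := 4 * (2 + 8 * 1) ^+ 2 * (4 * 1 * (1 + (2 + 8 * 1))) ^+ 2.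

(** The sub-mean value inequality is applied at [step z] on the square of half-side [1 / rho z], and
    the averages are integrated by [transfer] with [T = step]. Among the constants only [c1] depends
    on [K], and it decays exponentially in [K]. *)
Lemma step_integral (S r : R) : 0 < S -> S1 S ->
  (\int[dm]_(u in disk r) (cabs (h (step K (P u))) `^ p * weight a 0 (P u))%:E <=
   (S * c1 * L)%:E * \int[dm]_(u in disk r) (cabs (h (P u)) `^ p * weight a 0 (P u))%:E)%E.
Proof.
move=> S0 HS.
pose F := (fun u => (cabs (h (P u)) `^ p * weight a 0 (P u))%:E) \_ (disk r).
pose E := [set u | 2 * K + 1 <= cabs (P u)] `&` disk r.
have mD := measurable_disk r.
have mE : measurable E by apply: measurableI => //; exact: (measurable_far K).
have mF : measurable_fun setT F.
  by apply/(measurable_restrictT _ _).1 => //; apply: measurable_funTS; exact: measurable_Lp_weight.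
have F0 u : (0 <= F u)%E by rewrite /F patchE; case: ifP => // _; exact: Lp_weight_ge0.
have [m1 m2] := measurable_step K.
have eT u v : E u -> E v -> cabs (P u - P v) <= 2 * cabs (step K (P u) - step K (P v)).
  by move=> [/= Eu _] [/= Ev _]; exact: step_expanding.
have cT u : E u -> cabs (step K (P u)) <= cabs (P u) <= 2 * cabs (step K (P u)).
  by move=> [/= Eu _]; exact: step_comparable.
have tm := @transfer_measurable R 1 (fun u => step K (P u)) E mE m1 m2 F mF F0.
have tr := @transfer R 1 (fun u => step K (P u)) E ltr01 mE m1 m2 eT cT F mF F0.
have Sc0 : 0 <= S * c1 by rewrite mulr_ge0 ?expR_ge0 // ltW.
rewrite [X in (_ <= _ * X)%E]integral_mkcond -/F.
apply: (@le_trans _ _ ((S * c1)%:E * (L%:E * \int[dm]_v F v))%E); last by rewrite muleA -EFinM.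
apply: le_trans (lee_wpmul2l _ tr); last by rewrite lee_fin.
rewrite -ge0_integralZl //; last first.
  by move=> u _; rewrite mule_ge0 ?lee_fin ?sqr_ge0 //; apply: integral_ge0.
rewrite [leLHS]integral_mkcond [leRHS]integral_mkcond; apply: ge0_le_integral => //.
- by move=> u _; rewrite patchE; case: ifP => // _; rewrite lee_fin mulr_ge0 ?powR_ge0 ?weight_ge0.
- apply/(measurable_restrictT _ _).1 => //; apply: measurable_funTS; apply/measurable_EFinP.
  apply: measurable_funM; last exact: measurable_weight.
  exact: (measurableT_comp (measurable_powR p) measurable_h_step).
- by apply/(measurable_restrictT _ _).1 => //; apply: measurable_funeM.
move=> u _; rewrite patchE; case: ifPn => uD; last first.
  rewrite patchE; case: ifP => // _; apply: mule_ge0; first by rewrite lee_fin.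
  by apply: mule_ge0; [rewrite lee_fin sqr_ge0|exact: integral_ge0].
rewrite inE in uD.
(* Near the origin [step] is [0], and the left-hand side vanishes because [h 0 = 0]. *)
have [far|near] := boolP (2 * K + 1 <= cabs (P u)); last first.
  rewrite /step (negbTE near) h0 cabs0 powR0 ?gt_eqF // mul0r patchE; case: ifP => // _.
  apply: mule_ge0; first by rewrite lee_fin.
  by apply: mule_ge0; [rewrite lee_fin sqr_ge0|exact: integral_ge0].
rewrite patchE ifT; last by rewrite inE.
set z := P u in far uD *; have rz := rho_gt0 z.
have ri : 0 < 1 / rho z by rewrite divr_gt0.
have mS := measurable_square (step K z) (1 / rho z).
pose I := (\int[dm]_(v in square (step K z) (1 / rho z)) (cabs (h (P v)) `^ p)%:E)%E.
have I0 : (0 <= I)%E by apply: integral_ge0 => v _; rewrite lee_fin powR_ge0.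
have WI : ((weight a 0 z)%:E * I <= c1%:E * \int[dm]_(v in square (step K z) (1 / rho z)) F v)%E.
  rewrite /I -!ge0_integralZl //.
  - apply: ge0_le_integral => //.
    + by move=> v _; rewrite -EFinM lee_fin mulr_ge0 ?weight_ge0 ?powR_ge0.
    + by apply: measurable_funeM; exact: measurable_entire_powR.
    + by apply: measurable_funeM; exact: measurable_funTS.
    (* As [|v| <= |z|], the truncation of [F] to the disk loses nothing here. *)
    move=> v /squareP/(step_weight K2 a0' far)[vz h1].
    rewrite /F patchE ifT; last by rewrite inE /disk /=; exact: le_trans vz uD.
    rewrite -!EFinM lee_fin mulrCA mulrC.
    by apply: ler_wpM2l => //; exact: powR_ge0.
  - exact: measurable_funTS.
  - by rewrite lee_fin expR_ge0.
  - exact: measurable_entire_powR.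
  - by move=> v _; rewrite lee_fin powR_ge0.
  - by rewrite lee_fin weight_ge0.
have H : ((cabs (h (step K z)) `^ p)%:E <= (S * rho z ^+ 2)%:E * I)%E.
  have := HS (step K z) _ ri; rewrite -/I.
  have -> : (cabs (h (step K z)) `^ p)%:E = ((rho z ^+ 2)%:E * (cabs (h (step K z)) `^ p * (1 / rho z) ^+ 2)%:E)%E.
    by rewrite -EFinM; congr EFin; field; rewrite lt0r_neq0.
  move=> H1; apply: le_trans (lee_wpmul2l _ H1) _; first by rewrite lee_fin sqr_ge0.
  by rewrite muleA -EFinM (mulrC S).
rewrite EFinM; apply: le_trans (lee_wpmul2r _ H) _; first by rewrite lee_fin weight_ge0.
rewrite -muleA (muleC I); apply: le_trans (lee_wpmul2l _ WI) _.
  by rewrite lee_fin mulr_ge0 ?sqr_ge0 // ltW.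
rewrite !muleA -!EFinM; apply: eq_leW; congr (_%:E * _)%E; ring.
Qed.

End Absorb.

(** With [K = 2 + 4 Q / a] the exponent is [a + 2 Q], and [e^(a + 2 Q) >= 1 + a + 2 Q]. *)
Lemma absorb_constant (Q a : R) : 0 <= Q -> 0 < a ->
  Q * expR (- (a * (2 + 4 * Q / a) / 2)) <= 2^-1.
Proof.
move=> Q0 a0.
have -> : a * (2 + 4 * Q / a) / 2 = a + 2 * Q by field; rewrite lt0r_neq0.
rewrite expRN ler_pdivrMr ?expR_gt0 // mulrC ler_pdivlMr //.
apply: le_trans (expR_ge1Dx _); lra.
Qed.

(** The integral of [|h|^p] over a disk is at most [2^p] times the sum of those of [|h o step|^p]
    and [|h - h o step|^p]. The first term is at most half of the left-hand side by the choice of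
    [K], and is absorbed; the second is bounded by [local_control]. The bound does not depend on the
    disk. *)
Theorem primitive_bound a p : 0 < a -> 0 < p -> exists2 K : R, 0 < K & forall h, entire h -> h 0 = 0 ->
  (\int[dm]_u (cabs (h (P u)) `^ p * weight a 0 (P u))%:E <=
    K%:E * \int[dm]_u (cabs (cderiv h (P u)) `^ p * weight a p (P u))%:E)%E.
Proof.
move=> a0 p0; have a0' := ltW a0; have p0' := ltW p0.
have [S S0 HS] := submean p0.
pose L : R := 4 * (2 + 8 * 1) ^+ 2 * (4 * 1 * (1 + (2 + 8 * 1))) ^+ 2.
have L0 : 0 <= L by apply: mulr_ge0; [apply: mulr_ge0|]; rewrite ?sqr_ge0.
(* The coefficient of the term to be absorbed, without its factor [e^(- a K / 2)]; it does not
   involve [K]. *)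
pose Q := 2 `^ p * (S * expR (8 * a) * L).
have Q0 : 0 <= Q by rewrite mulr_ge0 ?powR_ge0 // mulr_ge0 // mulr_ge0 ?expR_ge0 // ltW.
pose K := 2 + 4 * Q / a.
have K2 : 2 <= K by rewrite lerDl divr_ge0 // mulr_ge0.
have K0 : 0 < K by exact: lt_le_trans (ltr0n R 2) K2.
pose N0 := (2 * K + 1) * (1 + (2 * K + 1)).
have N00 : 0 <= N0.
  by have t : 0 <= 2 * K + 1; [rewrite addr_ge0 // mulr_ge0 // ltW|rewrite mulr_ge0 // addr_ge0].
have N1 : 1 <= N0 + 1 by rewrite lerDr.
have A0 : 0 <= 2 * N0 by rewrite mulr_ge0.
have [K1 K10 HK1] := local_control a0' p0 p0' N1 A0.
exists (2 * 2 `^ p * K1); first by rewrite !mulr_gt0 // powR_gt0.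
move=> h eh h0; have eh' := entire_cderiv eh.
set I := (\int[dm]_u (cabs (cderiv h (P u)) `^ p * weight a p (P u))%:E)%E.
set F := fun u => (cabs (h (P u)) `^ p * weight a 0 (P u))%:E.
have I0 : (0 <= I)%E by apply: integral_ge0 => u _; exact: Lp_weight_ge0.
have mF : measurable_fun setT F by exact: measurable_Lp_weight.
have F0 u : (0 <= F u)%E by exact: Lp_weight_ge0.
have jumpI : (\int[dm]_u (jump K h (P u) `^ p * weight a p (P u))%:E <= K1%:E * I)%E.
  apply: HK1 => //.
  - exact: measurable_jump.
  - by move=> z; exact: jump_ge0.
  - by move=> z M M0; rewrite addrK; exact: jump_le.
(* On a disk the integral to be absorbed is finite. *)
have bound r : (\int[dm]_(u in disk r) F u <= (2 * 2 `^ p * K1)%:E * I)%E.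
  have mD := measurable_disk r.
  set A := (\int[dm]_(u in disk r) F u)%E.
  have A00 : (0 <= A)%E by exact: integral_ge0.
  have Af : A \is a fin_num by rewrite ge0_fin_numE //; exact: disk_integral_finite.
  have st := @step_integral a p K a0 p0 K2 h eh h0 S r S0 (fun z s s0 => HS h z s eh s0).
  have mst : measurable_fun (disk r) (fun u => (cabs (h (step K (P u))) `^ p * weight a 0 (P u))%:E).
    apply: measurable_funTS; apply/measurable_EFinP.
    apply: measurable_funM; last exact: measurable_weight.
    exact: (measurableT_comp (measurable_powR p) (measurable_h_step K eh)).
  have mjT : measurable_fun setT (fun u => (jump K h (P u) `^ p * weight a p (P u))%:E).
    apply/measurable_EFinP; apply: measurable_funM; last exact: measurable_weight.
    exact: (measurableT_comp (measurable_powR p) (measurable_jump K eh)).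
  have mj : measurable_fun (disk r) (fun u => (jump K h (P u) `^ p * weight a p (P u))%:E).
    exact: measurable_funTS.
  have p20 : 0 <= 2 `^ p :> R by exact: powR_ge0.
  have [->|Iy] := eqVneq I +oo%E.
    by rewrite gt0_muley ?leey // lte_fin !mulr_gt0 // powR_gt0.
  have If : I \is a fin_num by rewrite ge0_fin_numE // ltey.
  have : (A <= (2 `^ p)%:E * ((S * expR (8 * a - a * K / 2) * L)%:E * A) + (2 `^ p)%:E * (K1%:E * I))%E.
    apply: (@le_trans _ _ (\int[dm]_(u in disk r) ((2 `^ p)%:E * (cabs (h (step K (P u))) `^ p * weight a 0 (P u))%:E +
       (2 `^ p)%:E * (jump K h (P u) `^ p * weight a p (P u))%:E))%E).
      apply: ge0_le_integral => //.
      - exact: measurable_funTS.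
      - by apply: emeasurable_funD; exact: measurable_funeM.
      by move=> u _; rewrite -!EFinM -EFinD lee_fin; exact: split_jump.
    rewrite ge0_integralD //; last 4 first.
    - by move=> u _; rewrite -EFinM lee_fin !mulr_ge0 ?powR_ge0 ?weight_ge0.
    - exact: measurable_funeM.
    - by move=> u _; rewrite -EFinM lee_fin !mulr_ge0 ?powR_ge0 ?weight_ge0.
    - exact: measurable_funeM.
    rewrite !ge0_integralZl //; try by move=> u _; rewrite lee_fin mulr_ge0 ?powR_ge0 ?weight_ge0.
    apply: leeD; apply: lee_wpmul2l => //.
    apply: le_trans jumpI; apply: ge0_subset_integral => //.
    by move=> u _; rewrite lee_fin mulr_ge0 ?powR_ge0 ?weight_ge0.
  rewrite -(fineK Af) -(fineK If); set x := fine A; set y := fine I.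
  rewrite -!EFinM -EFinD !lee_fin => H.
  have x0 : 0 <= x by rewrite fine_ge0.
  have H2 : 2 `^ p * (S * expR (8 * a - a * K / 2) * L * x) <= 2^-1 * x.
    rewrite expRD.
    have -> : 2 `^ p * (S * (expR (8 * a) * expR (- (a * K / 2))) * L * x) = Q * expR (- (a * K / 2)) * x.
      by rewrite /Q; ring.
    by apply: ler_wpM2r => //; exact: absorb_constant.
  have -> : 2 * 2 `^ p * K1 * y = 2 * (2 `^ p * (K1 * y)) by ring.
  by move: H H2; move: (2 `^ p * (K1 * y)) (2 `^ p * _) => b c; clear; lra.
have T : \bigcup_n disk n%:R = setT.
  apply/seteqP; split=> // u _; exists (Num.truncn (cabs (P u))).+1 => //=.
  by rewrite /disk /= ltW // truncnS_gt.
apply: (@integral_exhaust _ _ dm (fun n => disk n%:R)) => //.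
- by move=> m n mn u; rewrite /disk /= => /le_trans; apply; rewrite ler_nat.
- by move=> n; exact: measurable_disk.
Qed.

End PrimitiveBound.

(** * Test functions *)

Section ComplexExponential.
Variable R : realType.
Local Notation C := (R[i]).
Implicit Types (z w : C).

Lemma is_derive_eps (u : R -> R) (t d : R) : is_derive t 1 u d ->
  forall e : R, 0 < e -> exists2 r : R, 0 < r &
    forall s : R, `|s| < r -> `|u (t + s) - u t - d * s| <= e * `|s|.
Proof.
case=> /cvg_ex[l Hl] ud e e0.
have ld : l = d by rewrite -ud /derive; apply/esym/cvg_lim.
rewrite {}ld {l ud} in Hl; move/cvgrPdist_le: Hl => /(_ e e0).
rewrite /dnbhs /= /within /= => -[r /= r0 Hr]; exists r => // s sr.
have [->|s0] := eqVneq s 0; first by rewrite addr0 mulr0 subrr subr0 normr0 mulr0.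
have := Hr s; rewrite /ball /= sub0r normrN => /(_ sr s0).
rewrite /GRing.scale /= mulr1 => H.
rewrite (_ : u (t + s) - u t - d * s = - ((d - s^-1 * (u (s + t) - u t)) * s)); last first.
  by rewrite (addrC s t); field.
by rewrite normrN normrM ler_pM2r // normr_gt0.
Qed.

Lemma cexpD z w : cexp (z + w) = cexp z * cexp w.
Proof.
case: z => x y; case: w => x' y'; rewrite /cexp /= expRD cosD sinD.
by apply: complexP => /=; ring.
Qed.

Lemma cabs_cexp z : cabs (cexp z) = expR (complex.Re z).
Proof.
case: z => x y; rewrite /cexp /= cabsM cabs_real ger0_norm ?expR_ge0 //.
rewrite [X in _ * X](_ : _ = 1) ?mulr1 //.
apply/eqP; rewrite -(@eqrXn2 _ 2) // ?cabs_ge0 // cabs_sqr /= cos2Dsin2 expr1n //.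
Qed.

Lemma cexp0 : cexp (0 : C) = 1.
Proof. by rewrite /cexp /= expR0 cos0 sin0 mul1r. Qed.

Lemma cexp_cder0 : cder (@cexp R) 0 1.
Proof.
move=> e e0.
(* Seven tenths are spent: [2 + 1] on the real part, [2 + 2] on the imaginary part. *)
have e1 : 0 < e / 10 by rewrite divr_gt0.
have [r1 r10 H1] := is_derive_eps (is_derive_expR (0 : R)) e1.
have [r2 r20 H2] := is_derive_eps (is_derive_cos (0 : R)) e1.
have [r3 r30 H3] := is_derive_eps (is_derive_sin (0 : R)) e1.
have [r4 r40 H4] := is_derive_eps (is_derive_expR (0 : R)) (ltr01 : 0 < (1 : R)).
exists (Num.min (Num.min (Num.min r1 r2) (Num.min r3 r4)) (Num.min 2^-1 (e / 10))).
  by rewrite !lt_min r10 r20 r30 r40 e1 invr_gt0 ltr0n.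
move=> h; rewrite !lt_min => /andP[/andP[/andP[h1 h2] /andP[h3 h4]] /andP[h5 h6]].
set x := complex.Re h; set y := complex.Im h.
have xh : `|x| <= cabs h by exact: Re_le_cabs.
have yh : `|y| <= cabs h by exact: Im_le_cabs.
have := H1 x (le_lt_trans xh h1); rewrite add0r expR0 mul1r => {}H1.
have := H2 y (le_lt_trans yh h2); rewrite add0r cos0 sin0 oppr0 mul0r subr0 => {}H2.
have := H3 y (le_lt_trans yh h3); rewrite add0r cos0 sin0 subr0 mul1r => {}H3.
have := H4 x (le_lt_trans xh h4); rewrite add0r expR0 !mul1r => {}H4.
have ex : `|expR x - 1| <= 2 * cabs h.
  have -> : expR x - 1 = (expR x - 1 - x) + x by ring.
  by apply: le_trans (ler_normD _ _) _; move: H4 xh; clear; lra.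
have ex2 : `|expR x| <= 2.
  have -> : expR x = (expR x - 1) + 1 by ring.
  by apply: le_trans (ler_normD _ _) _; rewrite normr1; move: ex h5; clear; lra.
rewrite add0r cexp0.
have E : cexp h - 1 - h = pt (expR x * (cos y - 1) + (expR x - 1 - x))
    (expR x * (sin y - y) + (expR x - 1) * y).
  rewrite /x /y; case: (h) => p q; apply: complexP; rewrite /cexp /=; ring.
rewrite E; apply: le_trans (cabs_le _) _ => /=.
have T1 : `|expR x * (cos y - 1)| <= 2 * (e / 10 * cabs h).
  rewrite normrM; apply: ler_pM => //; apply: le_trans H2 _; rewrite ler_pM2l //.
have T2 : `|expR x * (sin y - y)| <= 2 * (e / 10 * cabs h).
  rewrite normrM; apply: ler_pM => //; apply: le_trans H3 _; rewrite ler_pM2l //.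
have T3 : `|(expR x - 1) * y| <= 2 * (e / 10 * cabs h).
  rewrite normrM; apply: le_trans (_ : 2 * cabs h * cabs h <= _); first exact: ler_pM.
  by rewrite -mulrA ler_pM2l // ler_wpM2r // ltW.
have T4 : `|expR x - 1 - x| <= e / 10 * cabs h.
  by apply: le_trans H1 _; rewrite ler_pM2l.
apply: le_trans (lerD (ler_normD _ _) (ler_normD _ _)) _.
have -> : e * cabs h = 10 * (e / 10 * cabs h) by field.
have : 0 <= e / 10 * cabs h by rewrite mulr_ge0 // ltW.
by move: T1 T2 T3 T4; move: (e / 10 * cabs h); clear; move=> q; lra.
Qed.

Lemma cexp_cder z : cder (@cexp R) z (cexp z).
Proof.
have H := cder_shift (f := @cexp R) (z := 0) (c := 0).
have D : cder (fun w => cexp z * cexp (w - z)) z (cexp z * 1).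
  apply: cderZ; rewrite -[1]mulr1; apply: (@cder_comp R (@cexp R) (fun w => w - z)).
    by rewrite subrr; exact: cexp_cder0.
  rewrite -[X in cder _ _ X]subr0; apply: cderB; [exact: cder_id|exact: cder_cst].
rewrite -[X in cder _ _ X]mulr1; apply: cder_ext D => w.
by rewrite -cexpD addrC subrK.
Qed.

Lemma entire_cexp : entire (@cexp R).
Proof. exact: (cder_entire cexp_cder). Qed.

End ComplexExponential.

(* [b] selects the lattice [2 Z + b] that has a point within [1 / 2] of [- t]. *)
Lemma near_index (R : realType) (t : R) : exists b : bool, forall M, ((Num.truncn `|t|).+2 <= M)%N ->
  exists2 i0, (i0 < (2 * M).+1)%N & `|t + (2 * (i0%:R - M%:R) + b%:R)| <= 2^-1.
Proof.
pose N0 := (Num.truncn `|t|).+2.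
have tN : `|t| + 1 < N0%:R.
  by rewrite /N0 -natr1 ltrD2r truncnS_gt.
have [t1 t2] : - N0%:R + 1 < t /\ t < N0%:R - 1.
  by have := ler_norm t; have := ler_norm (- t); rewrite normrN; lra.
have p0 : 0 <= 2 * N0%:R - t + 2^-1 by lra.
pose q := Num.truncn (2 * N0%:R - t + 2^-1).
have /andP[q1 q2] := truncn_itv p0; rewrite -/q in q1 q2; rewrite -[q.+1%:R]natr1 in q2.
(* [q] is [2 N0 - t] rounded to an integer, and its parity selects the lattice. With the index given
   here, [2 (i0 - M) + b = q - 2 N0]. *)
exists (odd q); rewrite -/N0 => M NM; exists (q./2 + (M - N0))%N.
  have qN : (q < 3 * N0)%N by rewrite -(ltr_nat R) natrM; lra.
  by lia.
have E : q%:R = (odd q)%:R + 2 * (q./2)%:R :> R.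
  by rewrite -{1}(odd_double_half q) natrD -muln2 natrM; ring.
rewrite natrD natrB //; rewrite E in q1 q2.
by rewrite ler_norml; move: q1 q2; lra.
Qed.

(** * Gaussian sums of theta type *)

Section TestFunctions.
Variables (R : realType) (al : R).
Hypothesis al0 : 0 < al.
Local Notation C := (R[i]).
Implicit Types (z w : C) (r : R) (M : nat).

(** The exponent [al z^2 / 2 + 2 i n sqrt(al) z - n^2] is chosen so that the weighted modulus
    depends on [Im z] only: it is a Gaussian ridge along the line [sqrt(al) Im z = - n]. *)
Definition theta_term (n : R) z : C :=
  cexp ((al / 2)%:C%C * (z * z) + (pt 0 (2 * n * Num.sqrt al) * z + ((- n ^+ 2)%:C)%C)).

(** Ridges indexed by the points of [2 Z + r] between [r - 2 M] and [r + 2 M]: up to the factor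
    [e^(al z^2 / 2)], a partial sum of a Jacobi theta function. *)
Definition theta_sum r M z : C :=
  \sum_(0 <= i < (2 * M).+1) theta_term (2 * (i%:R - M%:R) + r) z.

Lemma entire_theta_term n : entire (theta_term n).
Proof.
apply: (entire_comp (@entire_cexp R)).
apply: entireD.
  apply: entireM; first exact: entire_cst.
  by apply: entireM; exact: entire_id.
apply: entireD; last exact: entire_cst.
by apply: entireM; [exact: entire_cst|exact: entire_id].
Qed.

Lemma entire_theta_sum r M : entire (theta_sum r M).
Proof.
rewrite /theta_sum; elim: (2 * M).+1 => [|L IH].
  have -> : (fun z => \sum_(0 <= i < 0) theta_term (2 * (i%:R - M%:R) + r) z) = (fun=> 0).
    by apply/funext => z; rewrite big_nil.
  exact: entire_cst.
have -> : (fun z => \sum_(0 <= i < L.+1) theta_term (2 * (i%:R - M%:R) + r) z) =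
  (fun z => \sum_(0 <= i < L) theta_term (2 * (i%:R - M%:R) + r) z + theta_term (2 * (L%:R - M%:R) + r) z).
  by apply/funext => z; rewrite big_nat_recr.
exact: (entireD IH (@entire_theta_term _)).
Qed.

Lemma cabs_theta_term n z :
  cabs (theta_term n z) * expR (- (al / 2) * cabs z ^+ 2) =
  expR (- (Num.sqrt al * complex.Im z + n) ^+ 2).
Proof.
rewrite cabs_cexp -expRD cabs_sqr; congr expR; case: z => x y /=.
have E : Num.sqrt al ^+ 2 = al by rewrite sqr_sqrtr // ltW.
by rewrite -{1 3}E; set s := Num.sqrt al; field.
Qed.

Lemma gauss_le (x : R) : expR (- x ^+ 2) <= (1 + x ^+ 2)^-1.
Proof.
rewrite expRN lef_pV2 ?posrE ?expR_gt0 ?expR_ge1Dx //.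
by rewrite ltr_pwDl // sqr_ge0.
Qed.

(* Bounded by [1], so that the Gaussian sums telescope to at most [6]. *)
Let G (x : R) : R := x / (1 + `|x|).

(** Over a step of length [2] the increasing function [G] gains at least a third of
    [1 / (1 + x^2)]. *)
Lemma gauss_telescope (x : R) : expR (- x ^+ 2) <= 3 * (G (x + 2) - G x).
Proof.
apply: le_trans (gauss_le x) _.
have p0 : 0 < 1 + x ^+ 2 by rewrite ltr_pwDl // sqr_ge0.
have key (y : R) : 0 <= y -> 2 / ((1 + y) * (3 + y)) = (y + 2) / (3 + y) - y / (1 + y).
  by move=> y0; field; apply/andP; split; apply: lt0r_neq0; lra.
have key2 (y : R) : 0 <= y -> (1 + y ^+ 2)^-1 <= 3 * (2 / ((1 + y) * (3 + y))).
  move=> y0; have q : 0 < 1 + y ^+ 2 by rewrite ltr_pwDl // sqr_ge0.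
  have q2 : 0 < (1 + y) * (3 + y) by rewrite mulr_gt0 //; lra.
  rewrite mulrA ler_pdivlMr // mulrC ler_pdivrMr //.
  by have := sqr_ge0 (y - 1); have := sqr_ge0 y; lra.
have [x0|x0] := leP 0 x.
  rewrite /G !ger0_norm //; last by lra.
  have -> : 1 + (x + 2) = 3 + x by ring.
  by rewrite -key //; exact: key2.
(* The reflection of [x] to [- x - 2], which swaps the two ends of the step, reduces [x <= - 2] to
   the case [x >= 0]. *)
have [x2|x2] := leP x (- 2).
  rewrite /G !ler0_norm; try lra.
  have y0 : 0 <= - x - 2 by lra.
  have E : (x + 2) / (1 - (x + 2)) - x / (1 - x) = (- x - 2 + 2) / (3 + (- x - 2)) - (- x - 2) / (1 + (- x - 2)).
    by field; rewrite ?lt0r_neq0 //; lra.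
  rewrite E -key //; apply: le_trans (key2 _ y0).
  rewrite lef_pV2 ?posrE //; last by rewrite ltr_pwDl // sqr_ge0.
  by rewrite lerD2l; lra.
(* In between, both denominators are at most [3], so the increment of [G] is at least [2 / 3], while
   the left-hand side is at most [1]. *)
rewrite /G (ger0_norm (_ : 0 <= x + 2)); last by lra.
rewrite (ltr0_norm x0).
apply: le_trans (_ : 1 <= _).
  by rewrite invf_le1 // lerDl sqr_ge0.
have d1 : 0 < 1 + (x + 2) by lra.
have d2 : 0 < 1 - x by lra.
have a1 : (x + 2) / 3 <= (x + 2) / (1 + (x + 2)).
  apply: ler_wpM2l; first by lra.
  by rewrite lef_pV2 ?posrE //; lra.
have a2 : (- x) / 3 <= (- x) / (1 - x).
  apply: ler_wpM2l; first by lra.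
  by rewrite lef_pV2 ?posrE //; lra.
rewrite !mulNr in a2; move: a1 a2; move: (x / (1 - x)) ((x + 2) / (1 + (x + 2))) => p q; lra.
Qed.

Lemma gauss_sum (t : R) L : \sum_(0 <= i < L) expR (- (t + 2 * i%:R) ^+ 2) <= 6.
Proof.
apply: le_trans (_ : 3 * (G (t + 2 * L%:R) - G t) <= _).
  elim: L => [|L IH]; first by rewrite big_nil mulr0 addr0 subrr mulr0.
  rewrite big_nat_recr //=; apply: le_trans (lerD IH (gauss_telescope _)) _.
  have -> : t + 2 * L.+1%:R = t + 2 * L%:R + 2 by rewrite -natr1; ring.
  by move: (G _) (G _) (G _) => p q s; lra.
have Gle (x : R) : -1 <= G x <= 1.
  rewrite -ler_norml /G normrM normfV (ger0_norm (_ : 0 <= 1 + `|x|)) ?addr_ge0 //.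
  by rewrite ler_pdivrMr ?ltr_pwDl // mul1r lerDr.
have := Gle (t + 2 * L%:R); have := Gle t; move: (G _) (G _) => p q; lra.
Qed.

Lemma theta_sum_upper r M z : cabs (theta_sum r M z) * expR (- (al / 2) * cabs z ^+ 2) <= 6.
Proof.
apply: le_trans (gauss_sum (Num.sqrt al * complex.Im z - 2 * M%:R + r) (2 * M).+1).
rewrite /theta_sum; elim: (2 * M).+1 => [|L IH]; first by rewrite !big_nil cabs0 mul0r.
rewrite !big_nat_recr //=.
apply: le_trans (ler_wpM2r (expR_ge0 _) (cabsD _ _)) _; rewrite mulrDl; apply: lerD => //.
by rewrite cabs_theta_term; apply: eq_leW; congr (expR (- _ ^+ 2)); ring.
Qed.

Lemma geometric_up L : \sum_(0 <= j < L) (4^-1 : R) ^+ j.+1 <= 3^-1.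
Proof.
elim: L => [|L IH]; first by rewrite big_nil invr_ge0.
rewrite big_nat_recl //.
have -> : \sum_(0 <= i < L) (4^-1 : R) ^+ i.+2 = 4^-1 * \sum_(0 <= i < L) 4^-1 ^+ i.+1.
  by rewrite big_distrr; apply: eq_bigr => i _; rewrite exprS.
by rewrite expr1; move: IH; move: (\sum_(0 <= i < L) _) => s; lra.
Qed.

Lemma geometric_down L : \sum_(0 <= j < L) (4^-1 : R) ^+ (L - j) <= 3^-1.
Proof.
elim: L => [|L IH]; first by rewrite big_nil invr_ge0.
rewrite big_nat_recr //= subSnn expr1.
have -> : \sum_(0 <= i < L) (4^-1 : R) ^+ (L.+1 - i) = 4^-1 * \sum_(0 <= i < L) 4^-1 ^+ (L - i).
  rewrite big_distrr; apply: eq_big_nat => i /andP[_ iL]; rewrite subSn; [exact: exprS|exact: ltnW].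
by move: IH; move: (\sum_(0 <= i < L) _) => s; lra.
Qed.

(** [x^2 >= (2 k - 1/2)^2 >= 2 k + 1/4] for [k >= 1], and [e >= 2]. The [k]-th neighbour of the
    dominant term is thus smaller by [4^(-k)]. *)
Lemma gauss_far (x : R) (k : nat) : (0 < k)%N -> 2 * k%:R - 2^-1 <= `|x| ->
  expR (- x ^+ 2) <= expR (- 4^-1) * 4^-1 ^+ k.
Proof.
move=> k0 kx.
have k1 : 1 <= k%:R :> R by rewrite ler1n.
have x2 : 2 * k%:R + 4^-1 <= x ^+ 2.
  rewrite -real_normK ?num_real //.
  have : (2 * k%:R - 2^-1) ^+ 2 <= `|x| ^+ 2 by rewrite lerXn2r // nnegrE; move: k1; lra.
  by have := ler_pM (ler0n R 1) (ler0n R 1) k1 k1; nra.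
apply: le_trans (_ : expR (- (2 * k%:R + 4^-1)) <= _); first by rewrite ler_expR lerN2.
rewrite opprD expRD mulrC; apply: ler_wpM2l; first exact: expR_ge0.
have -> : - (2 * k%:R) = k%:R * (- 2) :> R by ring.
rewrite expRM_natl; apply: lerXn2r; rewrite ?nnegrE ?expR_ge0 ?invr_ge0 //.
rewrite expRN lef_pV2 ?posrE ?expR_gt0 //.
have -> : (4 : R) = 2 * 2 by ring.
have -> : (2 : R) = 1 + 1 by ring.
by rewrite expRD; apply: ler_pM; rewrite ?addr_ge0 // expR_ge1Dx.
Qed.

(** The term [i0] is at least [e^(-1/4)], and the geometric tails on its two sides are at most a
    third of that each; one third survives. *)
Lemma theta_sum_lower r M z i0 : (i0 < (2 * M).+1)%N ->
  `|Num.sqrt al * complex.Im z + (2 * (i0%:R - M%:R) + r)| <= 2^-1 ->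
  expR (- 4^-1) / 3 <= cabs (theta_sum r M z) * expR (- (al / 2) * cabs z ^+ 2).
Proof.
move=> iM near; set E := expR (- (al / 2) * _).
have E0 : 0 <= E by exact: expR_ge0.
pose t i := theta_term (2 * (i%:R - M%:R) + r) z.
have tE i : cabs (t i) * E = expR (- (Num.sqrt al * complex.Im z + (2 * (i%:R - M%:R) + r)) ^+ 2).
  by rewrite /E /t cabs_theta_term.
have tri a b : cabs (\sum_(a <= i < b) t i) * E <= \sum_(a <= i < b) cabs (t i) * E.
  rewrite -big_distrl /=; apply: ler_wpM2r => //.
  elim/big_ind2: _ => [|x1 x2 y1 y2 h1 h2|//]; first by rewrite cabs0.
  by apply: le_trans (cabsD _ _) _; apply: lerD.
have -> : theta_sum r M z = \sum_(0 <= i < i0) t i + (t i0 + \sum_(i0.+1 <= i < (2 * M).+1) t i).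
  by rewrite /theta_sum -/t (big_cat_nat (n := i0)) //= ?(ltnW iM) // [X in _ + X]big_ltn.
set A := \sum_(0 <= i < i0) t i; set B := \sum_(i0.+1 <= i < _) t i.
have near' := near.
have HA : cabs A * E <= expR (- 4^-1) / 3.
  apply: le_trans (tri _ _) _.
  apply: le_trans (ler_wpM2l (expR_ge0 (- 4^-1)) (geometric_down i0)); rewrite big_distrr /=.
  rewrite !big_nat; apply: ler_sum => i /andP[_ ii]; rewrite tE; apply: gauss_far; first by rewrite subn_gt0.
  rewrite natrB ?(ltnW ii) //; move: near; rewrite ler_norml => /andP[n1 n2].
  by rewrite -normrN; apply: le_trans (ler_norm _); move: n1 n2; lra.
have HB : cabs B * E <= expR (- 4^-1) / 3.
  apply: le_trans (tri _ _) _.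
  apply: le_trans (ler_wpM2l (expR_ge0 (- 4^-1)) (geometric_up ((2 * M).+1 - i0.+1))); rewrite big_distrr /=.
  rewrite -{1}[i0.+1]add0n big_addn.
  apply: ler_sum => i _; rewrite tE; apply: gauss_far => //.
  move: near; rewrite ler_norml => /andP[n1 n2].
  by apply: le_trans (ler_norm _); rewrite natrD -[i.+1%:R]natr1 -[i0.+1%:R]natr1; move: n1 n2; lra.
have Hc : expR (- 4^-1) <= cabs (t i0) * E.
  rewrite tE ler_expR lerN2 -real_normK ?num_real //.
  have -> : 4^-1 = 2^-1 ^+ 2 :> R by rewrite exprVn; congr (_^-1); ring.
  by apply: lerXn2r; rewrite ?nnegrE ?invr_ge0.
have : cabs (t i0) <= cabs (A + (t i0 + B)) + cabs A + cabs B.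
  pose W := A + (t i0 + B).
  have e : t i0 = W - A - B by rewrite /W; ring.
  rewrite -/W {1}e.
  by apply: le_trans (cabsBD _ _) _; rewrite lerD2r; exact: cabsBD.
move=> /(ler_wpM2r E0); rewrite !mulrDl.
by move: HA HB Hc; move: (_ * E) (_ * E) (_ * E) (_ * E) => x1 x2 x3 x4; lra.
Qed.

End TestFunctions.

(** * Montel's theorem *)

Section Montel.
Variable R : realType.
Local Notation C := (R[i]).
Implicit Types (z w : C).

(** The limit is the supremum of the [x] with [x <= u n] for [U]-most [n]. Either [u n] is at most
    that supremum plus [e] for [U]-most [n], or the supremum is exceeded. *)
Lemma ultra_real_limit (U : set_system nat) (u : nat -> R) (b : R) : UltraFilter U ->
  (forall n, `|u n| <= b) -> exists l, forall e : R, 0 < e -> U [set n | `|u n - l| <= e].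
Proof.
move=> UU ub; pose A := [set x | U [set n | x <= u n]].
have An : A (- b).
  by apply: (filterS _ filterT) => n _ /=; have := ub n; rewrite ler_norml => /andP[].
have Ab : ubound A b.
  move=> x /filter_ex[n /= xn]; apply: le_trans xn _.
  by have := ub n; rewrite ler_norml => /andP[].
have hA : has_sup A by split; [exists (- b)|exists b].
exists (sup A) => e e0.
have [x Ax xs] := sup_adherent e0 hA.
have [Ue|Ue] := in_ultra_setVsetC [set n | u n <= sup A + e] UU.
  apply: filterS2 Ax Ue => n /= h1 h2; rewrite ler_norml; apply/andP; split; lra.
exfalso; have : A (sup A + e) by apply: filterS Ue => n /= /negP; rewrite -ltNge => /ltW.
by move=> /(ub_le_sup hA.2); lra.
Qed.

Lemma ultra_complex_limit (U : set_system nat) (u : nat -> C) (b : R) : UltraFilter U ->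
  (forall n, cabs (u n) <= b) -> exists l, forall e : R, 0 < e -> U [set n | cabs (u n - l) <= e].
Proof.
move=> UU ub.
have [l1 H1] := ultra_real_limit UU (fun n => le_trans (Re_le_cabs (u n)) (ub n)).
have [l2 H2] := ultra_real_limit UU (fun n => le_trans (Im_le_cabs (u n)) (ub n)).
exists (pt l1 l2) => e e0; have e20 : 0 < e / 2 by rewrite divr_gt0.
apply: filterS2 (H1 _ e20) (H2 _ e20) => n /= h1 h2.
apply: le_trans (cabs_le _) _.
have -> : complex.Re (u n - pt l1 l2) = complex.Re (u n) - l1 by case: (u n).
have -> : complex.Im (u n - pt l1 l2) = complex.Im (u n) - l2 by case: (u n).
lra.
Qed.

Definition rational_point (i : nat) : C :=
  if (unpickle i : option (rat * rat)) is Some q then pt (ratr q.1) (ratr q.2) else 0.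

Lemma rational_point_dense z (e : R) : 0 < e -> exists i, cabs (z - rational_point i) <= e.
Proof.
move=> e0; have e20 : 0 < e / 2 by rewrite divr_gt0.
have [q1] := @rat_in_itvoo R (complex.Re z) (complex.Re z + e / 2) ltac:(by rewrite ltrDl).
rewrite in_itv /= => /andP[a1 a2].
have [q2] := @rat_in_itvoo R (complex.Im z) (complex.Im z + e / 2) ltac:(by rewrite ltrDl).
rewrite in_itv /= => /andP[b1 b2].
exists (pickle (q1, q2)); rewrite /rational_point pickleK /=.
apply: le_trans (cabs_le _) _.
have -> : complex.Re (z - pt (ratr q1) (ratr q2)) = complex.Re z - ratr q1 by case: (z).
have -> : complex.Im (z - pt (ratr q1) (ratr q2)) = complex.Im z - ratr q2 by case: (z).
rewrite !ltr0_norm; lra.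
Qed.

(* Limits along a free ultrafilter exist at all points at once; the subsequence is extracted
   from convergence at the rational points, as the [f n] are locally equi-Lipschitz. *)
Theorem montel (f : nat -> C -> C) (B : R -> R) : (forall n, entire (f n)) ->
  (forall n r w, cabs w <= r -> cabs (f n w) <= B r) ->
  exists2 s : nat -> nat, {homo s : m n / (m < n)%N} & exists2 g : C -> C, entire g &
    forall z (e : R), 0 < e -> exists N, forall n, (N <= n)%N -> cabs (f (s n) z - g z) <= e.
Proof.
move=> ef HB.
have [U [UU oU]] := @ultraFilterLemma nat \oo _.
have hI V W : U V -> U W -> U (V `&` W) by move=> ? ?; exact: filterI.
pose M z := B (cabs z + 4).
have HM n z w : cabs (w - z) <= 4 -> cabs (f n w) <= M z.
  move=> wz; apply: HB; have := cabsD (w - z) z; rewrite subrK; lra.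
have Hf n := entire_cder (ef n).
have M0 z : 0 <= M z by apply: le_trans (HM 0%N z z _) => //; rewrite subrr cabs0.
have ldf n z : cabs (cderiv (f n) z) <= 16 * M z.
  by apply: (local_df (Hf n) (HM n z)); rewrite subrr cabs0.
have /choice[g Hg] : forall z, exists l, forall e : R, 0 < e -> U [set n | cabs (f n z - l) <= e].
  by move=> z; apply: (@ultra_complex_limit _ _ (M z)) => n; apply: HM; rewrite subrr cabs0.
have /choice[dg Hdg] : forall z, exists l, forall e : R, 0 < e -> U [set n | cabs (cderiv (f n) z - l) <= e].
  by move=> z; apply: (@ultra_complex_limit _ _ (16 * M z)) => n.
(* The Taylor bound for [f n] is uniform in [n]. If it failed for [g], a single [n] at which the
   values at [z] and [z + h] and the derivative at [z] are close to their limits would contradict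
   it. *)
have eg : entire g.
  apply/entireP => z; exists (dg z).
  apply: (@cder_quadratic R g z (dg z) (2 * (16 * (32 * M z))) 1) => // h h1.
  rewrite leNgt; apply/negP => H.
  set Q := 2 * (16 * (32 * M z)) * cabs h ^+ 2 in H.
  set D := cabs (g (z + h) - g z - dg z * h) in H.
  pose e := (D - Q) / 4.
  have e0 : 0 < e by rewrite divr_gt0 // subr_gt0.
  have /filter_ex[n [[/= n1 n2] n3]] := hI _ _ (hI _ _ (Hg (z + h) e e0) (Hg z e e0)) (Hdg z e e0).
  have T := local_taylor (Hf n) (HM n z) (w := z) (h := h).
  rewrite subrr cabs0 in T; have {T} T := T ler01 (ltW h1).
  rewrite -/Q in T.
  have : D <= Q + e + e + e.
    rewrite /D.
    have -> : g (z + h) - g z - dg z * h = (f n (z + h) - f n z - cderiv (f n) z * h)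
      - (f n (z + h) - g (z + h)) + (f n z - g z) + (cderiv (f n) z - dg z) * h by ring.
    have n3' : cabs ((cderiv (f n) z - dg z) * h) <= e.
      by rewrite cabsM -[leRHS]mulr1; apply: ler_pM => //; exact: ltW.
    apply: le_trans (cabsD _ _) _; apply: lerD => //.
    apply: le_trans (cabsD _ _) _; apply: lerD => //.
    by apply: le_trans (cabsBD _ _) _; apply: lerD.
  by rewrite /e; lra.
(* The indices for which [f n] is within [1 / (j + 1)] of [g] at the first [j] rational points. *)
pose A j := [set n | forall i, (i < j)%N -> cabs (f n (rational_point i) - g (rational_point i)) <= j.+1%:R^-1].
have UA j : U (A j).
  have e0 : 0 < j.+1%:R^-1 :> R by rewrite invr_gt0.
  rewrite /A; move: (j.+1%:R^-1) e0 => e e0.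
  elim: j => [|j IH]; first by apply: filterS filterT.
  apply: filterS2 IH (Hg (rational_point j) e e0) => n /= h1 h2 i.
  by rewrite ltnS leq_eqVlt => /predU1P[->//|]; exact: h1.
(* As [U] refines the filter at infinity, an index in [A j] can be taken beyond the previous one. *)
have next (jm : nat * nat) : exists n, (jm.2 < n)%N /\ A jm.1 n.
  have Um : U [set n | (jm.2 < n)%N] by apply: oU; exists jm.2.+1.
  by have /filter_ex[n [n1 n2]] := hI _ _ Um (UA jm.1); exists n.
have [nx Hnx] := choice next.
pose s := fix F j := if j is k.+1 then nx (k.+1, F k) else nx (0%N, 0%N).
have sA j : A j (s j) by case: j => [|j]; [exact: (Hnx (0%N, 0%N)).2|exact: (Hnx (j.+1, s j)).2].
exists s; first by apply: homo_ltn; [exact: ltn_trans|move=> j; exact: (Hnx (j.+1, s j)).1].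
exists g => // z e e0.
have [Mg Mg0 HMg] := entire_bounded_at z 4 eg.
have Hdg' := entire_cder eg.
(* A common Lipschitz constant at [z] for all [f n] and for [g], by [local_lip]. *)
pose L := 32 * (M z + Mg) + 1.
have L0 : 0 < L by rewrite ltr_wpDl // mulr_ge0 // addr_ge0.
pose d := Num.min 1 (e / (4 * L)).
have d0 : 0 < d by rewrite lt_min ltr01 divr_gt0 // mulr_gt0.
have [i Hi] := rational_point_dense z d0.
set q := rational_point i in Hi.
have d1 : d <= 1 by rewrite ge_min lexx.
have dL : d * L <= e / 4.
  have dl : d <= e / (4 * L) by rewrite ge_min lexx orbT.
  apply: le_trans (ler_wpM2r (ltW L0) dl) _.
  by apply: eq_leW; field; rewrite lt0r_neq0.
have lip (k : C -> C) (Mk : R) : entire k -> 0 <= Mk -> Mk <= M z + Mg ->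
   (forall w, cabs (w - z) <= 4 -> cabs (k w) <= Mk) -> cabs (k z - k q) <= e / 4.
  move=> ek Mk0 Mkle Hk; rewrite cabsB.
  have := @local_lip R k (cderiv k) z Mk (entire_cder ek) Hk z (q - z).
  rewrite subrr cabs0 subrKC (cabsB q) => H.
  apply: le_trans (H _ _) _ => //; first exact: le_trans d1.
  apply: le_trans dL; rewrite mulrC; apply: ler_pM => //; first by rewrite mulr_ge0.
  apply: le_trans (_ : 32 * (M z + Mg) <= _); first by rewrite ler_pM2l.
  by rewrite lerDl.
have /filter_ex[N0 HN0] := near_infty_natSinv_lt (PosNum (divr_gt0 e0 (ltr0n R 2))).
rewrite /= in HN0.
exists (maxn i.+1 N0) => n; rewrite geq_max => /andP[ni nN].
have -> : f (s n) z - g z = (f (s n) z - f (s n) q) + (f (s n) q - g q) - (g z - g q) by ring.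
have l1 : cabs (f (s n) z - f (s n) q) <= e / 4.
  by apply: (lip _ _ (ef (s n)) (M0 z)); [rewrite lerDl|exact: HM].
have l2 : cabs (g z - g q) <= e / 4 by apply: (lip _ _ eg Mg0) => //; rewrite lerDr.
have l3 : cabs (f (s n) q - g q) <= e / 2.
  apply: le_trans (sA n i ni) _; apply: le_trans (ltW HN0).
  by rewrite lef_pV2 ?posrE ?ltr0n // ler_nat.
apply: le_trans (cabsBD _ _) _; apply: le_trans (lerD (cabsD _ _) (lexx _)) _.
by move: l1 l2 l3; clear; lra.
Qed.

End Montel.

(** * Integral of the Berezin transform *)

Section Gaussian.
Variable R : realType.
Local Notation C := (R[i]).
Local Notation mu := (@lebesgue_measure R).
Local Notation dm := (mu \x mu)%E.
Local Notation P := (@of_pair R).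
Implicit Types (z w : C) (u v : R * R).

(** [k] is the inverse of the normalizing factor of the normal law of variance [1 / (2 a)], whose
    mean [m] is arbitrary. *)
Lemma gaussian_line (a : R) : 0 < a -> exists2 k : R, 0 < k & forall m : R,
  (\int[mu]_x (expR (- a * (m - x) ^+ 2))%:E = k%:E)%E.
Proof.
move=> a0; pose s := Num.sqrt (2 * a)^-1.
have ia0 : 0 < (2 * a)^-1 by rewrite invr_gt0 mulr_gt0.
have s0 : s != 0 by rewrite sqrtr_eq0 -ltNge.
have ss : s ^+ 2 = (2 * a)^-1 by rewrite sqr_sqrtr // ltW.
have pk0 : 0 < normal_peak s.
  by rewrite invr_gt0 sqrtr_gt0 mulrn_wgt0 // mulr_gt0 ?pi_gt0 // ss.
exists (normal_peak s)^-1; first by rewrite invr_gt0.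
move=> m; have := integral_normal_pdf m s.
rewrite normal_pdfE // => H.
have e x : (normal_peak s * normal_fun m s x)%:E = ((normal_peak s)%:E * (expR (- a * (m - x) ^+ 2))%:E)%E.
  rewrite -EFinM /normal_fun ss; congr (_ * expR _)%:E.
  by field; rewrite lt0r_neq0.
have mg : measurable_fun setT (fun x : R => (expR (- a * (m - x) ^+ 2))%:E).
  apply/measurable_EFinP; apply: (measurableT_comp (@measurable_expR R)).
  apply: measurable_funM => //; apply: measurable_funX; exact: measurable_funB.
have J : ((normal_peak s)%:E * \int[mu]_x (expR (- a * (m - x) ^+ 2))%:E = 1)%E.
  rewrite -(@ge0_integralZl _ _ _ mu _ measurableT _ mg).
  - by rewrite -H; apply: eq_integral => x _; rewrite -e.
  - by move=> x _; rewrite lee_fin expR_ge0.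
  - by rewrite lee_fin ltW.
rewrite -[RHS]mule1 -J muleA -EFinM mulVf ?mul1e //; exact: lt0r_neq0.
Qed.

Lemma gaussian_plane (a : R) : 0 < a -> exists2 k : R, 0 < k & forall z,
  (\int[dm]_v (expR (- a * cabs (z - P v) ^+ 2))%:E = k%:E)%E.
Proof.
move=> a0; have [k k0 Hk] := gaussian_line a0.
exists (k * k); first exact: mulr_gt0.
case=> x y.
have mg (m : R) : measurable_fun setT (fun x : R => (expR (- a * (m - x) ^+ 2))%:E).
  apply/measurable_EFinP; apply: (measurableT_comp (@measurable_expR R)).
  by apply: measurable_funM => //; apply: measurable_funX; exact: measurable_funB.
have e v : (expR (- a * cabs (pt x y - P v) ^+ 2))%:E =
    ((expR (- a * (x - v.1) ^+ 2))%:E * (expR (- a * (y - v.2) ^+ 2))%:E)%E.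
  by rewrite cabs_sqr -EFinM -expRD -mulrDr.
rewrite (@fubini_tonelli1 _ _ _ _ _ mu mu); last by move=> v; rewrite lee_fin expR_ge0.
  rewrite /fubini_F.
  transitivity (\int[mu]_s ((expR (- a * (x - s) ^+ 2))%:E * k%:E))%E.
    apply: eq_integral => s _; rewrite -(Hk y).
    under eq_integral do rewrite e /=.
    rewrite ge0_integralZl //; exact: mg.
  rewrite (@ge0_integralZr _ _ _ mu _ measurableT _ (mg x)); first by rewrite Hk -EFinM.
  - by move=> t _; rewrite lee_fin expR_ge0.
  - by rewrite lee_fin ltW.
rewrite (_ : (fun v => _) = (fun v : R * R => ((expR (- a * (x - v.1) ^+ 2))%:E * (expR (- a * (y - v.2) ^+ 2))%:E)%E)); last by apply/funext => v; rewrite e.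
apply: emeasurable_funM.
  exact: (measurableT_comp (mg x) measurable_fst).
exact: (measurableT_comp (mg y) measurable_snd).
Qed.

End Gaussian.

(** * The Berezin transform and its integral *)

Section BerezinMass.
Variable R : realType.
Local Notation C := (R[i]).
Local Notation mu := (@lebesgue_measure R).
Local Notation dm := (mu \x mu)%E.
Local Notation P := (@of_pair R).
Implicit Types (z w : C) (u v : R * R).

Variables (al p : R) (psi g : C -> C).
Hypotheses (al0 : 0 < al) (p0 : 0 < p) (epsi : entire psi) (eg : entire g).
Let a := al * p / 2.

Definition mass_density z : R :=
  cabs (cderiv g z) `^ p * weight a p z * expR (a * cabs (psi z) ^+ 2).

Definition mass : \bar R := (\int[dm]_u (mass_density (P u))%:E)%E.

Lemma mass_density_ge0 z : 0 <= mass_density z.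
Proof. by rewrite !mulr_ge0 ?powR_ge0 ?weight_ge0 ?expR_ge0. Qed.

Lemma mass_ge0 : (0 <= mass)%E.
Proof. by apply: integral_ge0 => u _; rewrite lee_fin mass_density_ge0. Qed.

Lemma measurable_mass_density : measurable_fun setT (fun u => mass_density (P u)).
Proof.
apply: measurable_funM.
  have /measurable_EFinP := @measurable_Lp_weight R (cderiv g) a p p (entire_cderiv eg); exact.
apply: (measurableT_comp (@measurable_expR R)); apply: measurable_funM => //.
by apply: measurable_funX; exact: measurable_entire.
Qed.

Lemma cabs_fock_kernel w z :
  cabs (fock_kernel al w z) = expR (al / 2 * cabs z ^+ 2 - al / 2 * cabs (z - w) ^+ 2).
Proof.
rewrite /fock_kernel cabs_cexp; congr expR.
by case: z w => x y [s t]; rewrite !cabs_sqr /=; field.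
Qed.

Lemma berezin_integrand w z :
  cabs (fock_kernel al w (psi z) * cderiv g z) `^ p /
     ((1 + cabs z) * expR (al / 2 * cabs z ^+ 2)) `^ p =
  mass_density z * expR (- a * cabs (psi z - w) ^+ 2).
Proof.
rewrite cabsM cabs_fock_kernel !powRM ?expR_ge0 //; last by exact: ltW (rho_gt0 z).
rewrite -!expRM -/(rho z) invfM -!expRN -powRN /mass_density /weight.
rewrite (_ : expR ((al / 2 * cabs (psi z) ^+ 2 - al / 2 * cabs (psi z - w) ^+ 2) * p) =
  expR (a * cabs (psi z) ^+ 2) * expR (- a * cabs (psi z - w) ^+ 2)); last first.
  by rewrite -expRD; congr expR; rewrite /a; field.
rewrite (_ : - (al / 2 * cabs z ^+ 2 * p) = - a * cabs z ^+ 2); last by rewrite /a; field.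
by ring.
Qed.

Let H (q : (R * R) * (R * R)) : \bar R :=
  ((mass_density (P q.1))%:E * (expR (- a * cabs (psi (P q.1) - P q.2) ^+ 2))%:E)%E.

Let H0 q : (0 <= H q)%E.
Proof. by rewrite /H mule_ge0 // lee_fin ?expR_ge0 ?mass_density_ge0. Qed.

Let mH : measurable_fun setT H.
Proof.
apply: emeasurable_funM; apply/measurable_EFinP.
  exact: (measurableT_comp measurable_mass_density measurable_fst).
apply: (measurableT_comp (@measurable_expR R)); apply: measurable_funM => //.
rewrite (_ : (fun q => _) = (fun q : (R * R) * (R * R) => (complex.Re (psi (P q.1)) - q.2.1) ^+ 2 +
   (complex.Im (psi (P q.1)) - q.2.2) ^+ 2)); last first.
  apply/funext => q; rewrite -[psi _ - _]/(psi (P q.1) - P q.2).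
  by case: (psi _) => x y; rewrite cabs_sqr.
apply: measurable_funD; apply: measurable_funX; apply: measurable_funB.
- exact: (measurableT_comp (measurable_entire_Re epsi) measurable_fst).
- exact: (measurableT_comp measurable_fst measurable_snd).
- exact: (measurableT_comp (measurable_entire_Im epsi) measurable_fst).
- exact: (measurableT_comp measurable_snd measurable_snd).
Qed.

Lemma berezinE w : berezin al psi g p w =
  (\int[dm]_u ((mass_density (P u))%:E * (expR (- a * cabs (psi (P u) - w) ^+ 2))%:E))%E.
Proof. by apply: eq_integral => u _; rewrite berezin_integrand EFinM. Qed.

Lemma berezin_ge0 w : (0 <= berezin al psi g p w)%E.
Proof.
rewrite berezinE; apply: integral_ge0 => u _.
by rewrite mule_ge0 // lee_fin ?expR_ge0 ?mass_density_ge0.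
Qed.

Lemma measurable_berezin : measurable_fun setT (berezin al psi g p \o P).
Proof.
rewrite (_ : _ \o _ = (fun v => \int[dm]_u H (u, v))%E); first exact: (plane_measurable_G mH H0).
by apply/funext => v; rewrite /= berezinE.
Qed.

Lemma berezin_L1 : L1C (berezin al psi g p) <-> (integralC (berezin al psi g p) < +oo)%E.
Proof.
have e : (\int[dm]_u `|(berezin al psi g p \o P) u| = integralC (berezin al psi g p))%E.
  by apply: eq_integral => u _; rewrite gee0_abs // berezin_ge0.
split=> [/integrableP[_]|h]; first by rewrite e.
by apply/integrableP; split; [exact: measurable_berezin|rewrite e].
Qed.

Lemma integral_berezin k : (forall z, (\int[dm]_v (expR (- a * cabs (z - P v) ^+ 2))%:E = k%:E)%E) ->
  integralC (berezin al psi g p) = (k%:E * mass)%E.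
Proof.
move=> Hk.
have k0 : 0 <= k.
  by rewrite -lee_fin -(Hk 0); apply: integral_ge0 => v _; rewrite lee_fin expR_ge0.
transitivity (\int[dm]_v \int[dm]_u H (u, v))%E; first by apply: eq_integral => v _; rewrite berezinE.
rewrite -(plane_tonelli mH H0) /mass.
have mD : measurable_fun setT (fun u => (mass_density (P u))%:E).
  by apply/measurable_EFinP; exact: measurable_mass_density.
rewrite -ge0_integralZl //; last by move=> u _; rewrite lee_fin mass_density_ge0.
apply: eq_integral => u _; rewrite /H /= ge0_integralZl //.
- by rewrite Hk muleC.
- apply/measurable_EFinP.
  apply: (measurableT_comp (@measurable_expR R)); apply: measurable_funM => //.
  apply: measurable_funX.
  exact: (measurable_entire (entireB (@entire_cst R (psi (P u))) (@entire_id R))).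
- by rewrite lee_fin mass_density_ge0.
Qed.

End BerezinMass.

(** * The Volterra operator *)

Section FockNorms.
Variable R : realType.
Local Notation C := (R[i]).
Local Notation mu := (@lebesgue_measure R).
Local Notation dm := (mu \x mu)%E.
Local Notation P := (@of_pair R).
Implicit Types (z w : C) (u v : R * R).

Variables (al p : R).
Hypotheses (al0 : 0 < al) (p0 : 0 < p).
Let a := al * p / 2.
Let c := al * p / (2 * pi).

(** The [p]-th power of the Fock norm up to its constant; estimates on it avoid [p]-th roots. *)
Definition Lp_mass (f : C -> C) : \bar R := (\int[dm]_u (cabs (f (P u)) `^ p * weight a 0 (P u))%:E)%E.

Lemma Lp_mass_ge0 f : (0 <= Lp_mass f)%E.
Proof. by apply: integral_ge0 => u _; exact: Lp_weight_ge0. Qed.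

Lemma fock_constant_gt0 : 0 < c.
Proof. by rewrite divr_gt0 ?mulr_gt0 ?pi_gt0. Qed.

Let c0 := fock_constant_gt0.

Let cN0 f : (0 <= c%:E * Lp_mass f)%E.
Proof. by rewrite mule_ge0 ?Lp_mass_ge0 // lee_fin ltW. Qed.

Lemma fock_normE f : fock_norm al p f = ((c%:E * Lp_mass f) `^ p^-1)%E.
Proof.
congr ((_ * _) `^ _)%E; apply: eq_integral => u _.
by rewrite /weight oppr0 powRr0 mul1r.
Qed.

Lemma fock_norm_ge0 f : (0 <= fock_norm al p f)%E.
Proof. exact: poweR_ge0. Qed.

Lemma fock_norm_pow f : (fock_norm al p f `^ p = c%:E * Lp_mass f)%E.
Proof. by rewrite fock_normE -poweRrM mulVf ?lt0r_neq0 // poweRe1. Qed.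

Lemma fock_norm_le f (A : R) : 0 <= A ->
  (fock_norm al p f <= A%:E)%E <-> (c%:E * Lp_mass f <= (A `^ p)%:E)%E.
Proof.
move=> A0; split=> h.
  rewrite -fock_norm_pow -poweR_EFin; apply: (gt0_ler_poweR (ltW p0)) => //.
    by rewrite in_itv /= fock_norm_ge0 leey.
  by rewrite in_itv /= lee_fin A0 leey.
rewrite fock_normE.
have -> : A%:E = ((A `^ p)%:E `^ p^-1)%E.
  by rewrite poweR_EFin -powRrM mulfV ?lt0r_neq0 // powRr1.
apply: gt0_ler_poweR => //; first by rewrite invr_ge0 ltW.
  by rewrite in_itv /= cN0 leey.
by rewrite in_itv /= lee_fin powR_ge0 leey.
Qed.

Lemma fock_norm_lty f : (fock_norm al p f < +oo)%E <-> (Lp_mass f < +oo)%E.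
Proof.
split=> h; last first.
  rewrite fock_normE; apply: poweR_lty; apply: lte_mul_pinfty => //.
  by rewrite lee_fin ltW.
have := poweR_lty p h; rewrite fock_norm_pow.
by rewrite !ltey; apply: contra => /eqP ->; rewrite gt0_muley.
Qed.

Lemma fock_norm_oo_le f (A : R) :
  (fock_norm_oo al f <= A%:E)%E <-> forall z, cabs (f z) * expR (- (al / 2) * cabs z ^+ 2) <= A.
Proof.
split=> [h z|h].
  by rewrite -lee_fin; apply: le_trans h; apply: ereal_sup_ubound; exists z.
by apply: ge_ereal_sup => _ [z _ <-]; rewrite lee_fin.
Qed.

Lemma fock_norm_oo_ge0 f : (0 <= fock_norm_oo al f)%E.
Proof.
apply: (@le_trans _ _ (cabs (f 0) * expR (- (al / 2) * cabs 0 ^+ 2))%:E).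
  by rewrite lee_fin mulr_ge0 ?expR_ge0.
by apply: ereal_sup_ubound; exists 0.
Qed.

Section Volterra.
Variables (psi g f : C -> C).
Hypotheses (epsi : entire psi) (eg : entire g) (ef : entire f).

Lemma volterra_cder z : cder (volterra g psi f) z (f (psi z) * cderiv g z).
Proof.
apply: (@path_integral_cder R (fun w => f (psi w) * cderiv g w)).
exact: entireM (entire_comp ef epsi) (entire_cderiv eg).
Qed.

Lemma entire_volterra : entire (volterra g psi f).
Proof. by apply/entireP => z; exists (f (psi z) * cderiv g z); exact: volterra_cder. Qed.

Lemma cderiv_volterra z : cderiv (volterra g psi f) z = f (psi z) * cderiv g z.
Proof. exact: cder_cderiv (volterra_cder z). Qed.

Lemma volterra_density (A : R) z : 0 <= A ->
  (forall w, cabs (f w) * expR (- (al / 2) * cabs w ^+ 2) <= A) ->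
  cabs (f (psi z) * cderiv g z) `^ p * weight a p z <= A `^ p * mass_density al p psi g z.
Proof.
move=> A0 /(_ (psi z)); rewrite mulNr expRN ler_pdivrMr ?expR_gt0 // => H.
have := @ge0_ler_powR _ p (ltW p0) (cabs (f (psi z))) _ _ _ H; rewrite !nnegrE.
rewrite (mulr_ge0 A0 (expR_ge0 _)) => /(_ (cabs_ge0 _) isT).
rewrite (powRM _ A0 (expR_ge0 _)) -expRM cabsM powRM // => H1.
rewrite /mass_density -/a (_ : a * _ = al / 2 * cabs (psi z) ^+ 2 * p); last by rewrite /a; field.
rewrite -mulrA (mulrC (_ * weight _ _ _)) [leRHS]mulrA.
by apply: ler_wpM2r; rewrite ?mulr_ge0 ?powR_ge0 ?weight_ge0.
Qed.

End Volterra.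

End FockNorms.

(** * Comparison of [mass] with images under the operator *)

Section MassBounds.
Variable R : realType.
Local Notation C := (R[i]).
Local Notation mu := (@lebesgue_measure R).
Local Notation dm := (mu \x mu)%E.
Local Notation P := (@of_pair R).
Implicit Types (z w : C) (u v : R * R).

Variables (al p : R).
Hypotheses (al0 : 0 < al) (p0 : 0 < p).
Let a := al * p / 2.
Let a0 : 0 < a. Proof. by rewrite divr_gt0 ?mulr_gt0. Qed.

Lemma volterra_upper : exists2 K : R, 0 < K & forall (psi g f : C -> C) (A : R),
  entire psi -> entire g -> entire f -> 0 <= A ->
  (forall w, cabs (f w) * expR (- (al / 2) * cabs w ^+ 2) <= A) ->
  (Lp_mass al p (volterra g psi f) <= (K * A `^ p)%:E * mass al p psi g)%E.
Proof.
have [K K0 HK] := primitive_bound a0 p0.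
exists K => // psi g f A epsi eg ef A0 HA.
have eV := entire_volterra epsi eg ef.
apply: le_trans (HK _ eV (path_integral0 _)) _.
rewrite EFinM -muleA; apply: lee_wpmul2l; first by rewrite lee_fin ltW.
have mm : measurable_fun setT (fun u => (mass_density al p psi g (P u))%:E).
  by apply/measurable_EFinP; exact: measurable_mass_density.
rewrite /mass -ge0_integralZl //; last 2 first.
- by move=> u _; rewrite lee_fin mass_density_ge0.
- by rewrite lee_fin powR_ge0.
apply: ge0_le_integral => //.
- by move=> u _; exact: Lp_weight_ge0.
- exact: measurable_Lp_weight (entire_cderiv eV).
- exact: measurable_funeM.
move=> u _; rewrite -EFinM lee_fin cderiv_volterra //.
exact: volterra_density.
Qed.

Lemma volterra_lower : exists2 K : R, 0 < K & forall (psi g f : C -> C),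
  entire psi -> entire g -> entire f ->
  (\int[dm]_u (cabs (f (psi (P u)) * cderiv g (P u)) `^ p * weight a p (P u))%:E <=
    K%:E * Lp_mass al p (volterra g psi f))%E.
Proof.
have [K K0 HK] := derivative_bound (ltW a0) p0.
exists K; first exact: K0.
move=> psi g f epsi eg ef.
apply: le_trans (HK _ (entire_volterra epsi eg ef)).
by apply: eq_leW; apply: eq_integral => u _; rewrite cderiv_volterra.
Qed.

(** The factor [1 / 6] normalizes the bound of [theta_sum_upper]. Ridges are at distance [2] in the
    variable [sqrt(al) Im z], so the two values of [b] differ by half a period. *)
Definition test_function (b : bool) (M : nat) z : C := (6^-1)%:C%C * theta_sum al b%:R M z.

Lemma entire_test_function b M : entire (test_function b M).
Proof. exact: (entireM (@entire_cst R _) (@entire_theta_sum R al _ _)). Qed.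

Lemma test_function_upper b M z :
  cabs (test_function b M z) * expR (- (al / 2) * cabs z ^+ 2) <= 1.
Proof.
rewrite /test_function cabsM cabs_real ger0_norm // -mulrA mulrC ler_pdivrMr // mul1r.
exact: theta_sum_upper.
Qed.

(** The lower bound [e^(-1/4) / 3] of [theta_sum_lower], divided by the normalization [6]. *)
Let delta : R := expR (- 4^-1) / 18.

Let delta0 : 0 < delta. Proof. by rewrite divr_gt0 ?expR_gt0. Qed.

Lemma test_function_lower z n : `|Num.sqrt al * complex.Im z| <= n%:R -> exists b, forall M, (n.+2 <= M)%N ->
  delta <= cabs (test_function b M z) * expR (- (al / 2) * cabs z ^+ 2).
Proof.
move=> zn; have [b Hb] := near_index (Num.sqrt al * complex.Im z).
exists b => M nM.
have [|i0 i0M Hi] := Hb M.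
  apply: leq_trans nM; rewrite !ltnS truncn_le_nat.
    by apply: le_lt_trans zn _; rewrite ltr_nat.
rewrite /test_function cabsM cabs_real ger0_norm // -mulrA mulrC ler_pdivlMr //.
have -> : delta * 6 = expR (- 4^-1) / 3 by rewrite /delta; field.
exact: (theta_sum_lower al0 i0M Hi).
Qed.

(** At [psi z] one of the two test functions is large; which one depends on [z], so both are added.
    Their lengths [M true] and [M false] are independent, so that each may run through a subsequence
    of its own. *)
Lemma mass_density_le_test psi g z n (M : bool -> nat) : (forall b, (n.+2 <= M b)%N) ->
  `|Num.sqrt al * complex.Im (psi z)| <= n%:R ->
  mass_density al p psi g z <= delta `^ (- p) *
   (cabs (test_function true (M true) (psi z) * cderiv g z) `^ p * weight a p z +
    cabs (test_function false (M false) (psi z) * cderiv g z) `^ p * weight a p z).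
Proof.
move=> nM zn; have [b /(_ _ (nM b))] := test_function_lower zn.
rewrite mulNr expRN ler_pdivlMr ?expR_gt0 // => H.
set f := fun b => test_function b (M b) (psi z).
apply: (@le_trans _ _ (delta `^ (- p) * (cabs (f b * cderiv g z) `^ p * weight a p z))); last first.
  apply: ler_wpM2l; first exact: powR_ge0.
  have t0 c : 0 <= cabs (f c * cderiv g z) `^ p * weight a p z.
    by rewrite mulr_ge0 ?powR_ge0 ?weight_ge0.
  by case: b {H}; [rewrite lerDl|rewrite lerDr]; exact: t0.
have := @ge0_ler_powR _ p (ltW p0) _ _ _ _ H; rewrite !nnegrE.
rewrite (mulr_ge0 (ltW delta0) (expR_ge0 _)) => /(_ isT (cabs_ge0 _)).
rewrite (powRM _ (ltW delta0) (expR_ge0 _)) -expRM => H1.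
rewrite /mass_density cabsM powRM // (mulrC (_ * weight _ _ _)).
rewrite -(mulrA (_ `^ p) (_ `^ p) (weight a p z)) (mulrA (delta `^ (- p))).
apply: ler_wpM2r; first by rewrite mulr_ge0 ?powR_ge0 ?weight_ge0.
rewrite powRN [leRHS]mulrC ler_pdivlMr ?powR_gt0 // [leLHS]mulrC.
by rewrite (_ : al * p / 2 * _ = al / 2 * cabs (psi z) ^+ 2 * p) //; field.
Qed.

Lemma mass_le_test : exists2 K : R, 0 < K & forall (psi g : C -> C) (s : bool -> nat -> nat) (A : R),
  entire psi -> entire g -> (forall b n, (n <= s b n)%N) ->
  (forall b n, (Lp_mass al p (volterra g psi (test_function b (s b n))) <= A%:E)%E) ->
  (mass al p psi g <= (K * A)%:E)%E.
Proof.
have [K K0 HK] := volterra_lower.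
have d0 : 0 < delta `^ (- p) by rewrite powR_gt0.
exists (delta `^ (- p) * (2 * K)); first by rewrite !mulr_gt0.
move=> psi g s A epsi eg sn HA.
(* The preimages under [psi] of growing horizontal strips. *)
pose E n := [set u | `|Num.sqrt al * complex.Im (psi (P u))| <= n%:R].
have mE n : measurable (E n).
  apply: measurable_le_set => //; apply: measurableT_comp => //.
  by apply: measurable_funM => //; exact: measurable_entire_Im.
have mm : measurable_fun setT (fun u => (mass_density al p psi g (P u))%:E).
  by apply/measurable_EFinP; exact: measurable_mass_density.
apply: (@integral_exhaust _ _ _ dm E) => //.
- by move=> i j ij u /= /le_trans; apply; rewrite ler_nat.
- apply/seteqP; split=> // u _; exists (Num.truncn `|Num.sqrt al * complex.Im (psi (P u))|).+1 => //=.
  by rewrite /E /= ltW // truncnS_gt.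
- by move=> u; rewrite lee_fin mass_density_ge0.
(* As [s b n.+2 >= n.+2], the sums are long enough for the strip of [E n]. The bound obtained does
   not depend on [n], and the strips exhaust the plane. *)
move=> n; pose F b u := (cabs (test_function b (s b n.+2) (psi (P u)) * cderiv g (P u)) `^ p * weight a p (P u))%:E.
have F0 b u : (0 <= F b u)%E by rewrite lee_fin mulr_ge0 ?powR_ge0 ?weight_ge0.
have mF b : measurable_fun setT (F b).
  apply: (@measurable_Lp_weight R (fun z => test_function b (s b n.+2) (psi z) * cderiv g z)).
  exact: (entireM (entire_comp (@entire_test_function b (s b n.+2)) epsi) (entire_cderiv eg)).
have IF b : (\int[dm]_u F b u <= (K * A)%:E)%E.
  apply: le_trans (HK _ _ _ epsi eg (@entire_test_function b (s b n.+2))) _.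
  by rewrite EFinM; apply: lee_wpmul2l; [rewrite lee_fin ltW|exact: HA].
apply: (@le_trans _ _ (\int[dm]_u ((delta `^ (- p))%:E * (F true u + F false u)))%E).
  rewrite integral_mkcond; apply: ge0_le_integral => //.
  - by move=> u _; rewrite patchE; case: ifP => // _; rewrite lee_fin mass_density_ge0.
  - by apply/(measurable_restrictT _ _).1; [exact: mE|exact: measurable_funTS].
  - by apply: measurable_funeM; apply: emeasurable_funD; exact: mF.
  move=> u _; rewrite patchE; case: ifPn; last first.
    by move=> _; rewrite mule_ge0 ?adde_ge0 // lee_fin ltW.
  rewrite inE => Eu; rewrite -EFinD -EFinM lee_fin.
  exact: (@mass_density_le_test psi g (P u) n (fun b => s b n.+2)).
rewrite ge0_integralZl //; last 3 first.
- by apply: emeasurable_funD; exact: mF.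
- by move=> u _; rewrite adde_ge0.
- by rewrite lee_fin ltW.
have -> : (\int[dm]_u (F true u + F false u) = \int[dm]_u F true u + \int[dm]_u F false u)%E.
  by apply: ge0_integralD => //; exact: mF.
rewrite -mulrA EFinM; apply: lee_wpmul2l; first by rewrite lee_fin ltW.
by rewrite -mulrA mulrDl mul1r EFinD leeD.
Qed.

End MassBounds.

Section NullSequences.
Variable R : realType.

Lemma cvge0P (u : nat -> \bar R) : (forall n, (0 <= u n)%E) ->
  u n @[n --> \oo] --> 0%E <->
  forall e : R, 0 < e -> exists N, forall n, (N <= n)%N -> (u n <= e%:E)%E.
Proof.
move=> u0; split=> [/fine_cvgP[fu /cvgrPdist_le cu] e e0|h].
  have [N _ HN] := filterI fu (cu e e0).
  exists N => n /HN[fn]; rewrite sub0r normrN => h.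
  by rewrite -(fineK fn) lee_fin; apply: le_trans h; exact: ler_norm.
apply/fine_cvgP; split.
  have [N HN] := h 1 ltr01; exists N => // n /= /HN un.
  by rewrite ge0_fin_numE //; apply: le_lt_trans un _; exact: ltry.
apply/cvgrPdist_le => e e0; have [N HN] := h e e0.
exists N => // n /= /HN un; rewrite sub0r normrN ger0_norm ?fine_ge0 //.
by rewrite -lee_fin fineK // ge0_fin_numE //; apply: le_lt_trans un _; exact: ltry.
Qed.

End NullSequences.

(** * Boundedness, compactness and operator norm in terms of [mass] *)

Section VolterraCriterion.
Variable R : realType.
Local Notation C := (R[i]).
Local Notation mu := (@lebesgue_measure R).
Local Notation dm := (mu \x mu)%E.
Local Notation P := (@of_pair R).
Implicit Types (z w : C) (u v : R * R).

Variables (al p : R).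
Hypotheses (al0 : 0 < al) (p0 : 0 < p).
Let a := al * p / 2.
Let a0 : 0 < a. Proof. by rewrite divr_gt0 ?mulr_gt0. Qed.
Let c := al * p / (2 * pi).
Let c0 : 0 < c. Proof. exact: fock_constant_gt0. Qed.
Local Notation Noo := (fock_norm_oo al).
Local Notation Np := (fock_norm al p).
Local Notation Lp := (Lp_mass al p).
Local Notation mass := (mass al p).
Local Notation test := (test_function al).

Lemma fock_norm_oo_test b M : (Noo (test b M) <= 1)%E.
Proof. by apply/fock_norm_oo_le => z; exact: test_function_upper. Qed.

Lemma test_in_space b M : entire_space Noo (test b M).
Proof.
split; first exact: entire_test_function.
exact: (le_lt_trans (fock_norm_oo_test b M) (ltry 1)).
Qed.

Lemma Lp_mass_le f A : 0 <= A -> (Np f <= A%:E)%E -> (Lp f <= (A `^ p / c)%:E)%E.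
Proof.
move=> A0 /(fock_norm_le al0 p0 f A0) H.
by rewrite (mulrC _ c^-1) EFinM lee_pdivlMl.
Qed.

Lemma volterra_fock_norm : exists2 K : R, 0 < K & forall (psi g f : C -> C) (A : R),
  entire psi -> entire g -> entire f -> 0 <= A -> (Noo f <= A%:E)%E ->
  (c%:E * Lp (volterra g psi f) <= (K * A `^ p)%:E * mass psi g)%E.
Proof.
have [K K0 HK] := volterra_upper al0 p0.
exists (c * K); first exact: mulr_gt0.
move=> psi g f A epsi eg ef A0 /fock_norm_oo_le HA.
rewrite -(mulrA c) (EFinM c) -muleA; apply: lee_wpmul2l; first by rewrite lee_fin ltW.
exact: HK.
Qed.

Lemma volterra_bounded psi g : entire psi -> entire g -> (mass psi g < +oo)%E ->
  bounded_op Noo Np (volterra g psi).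
Proof.
move=> epsi eg mf; have [K K0 HK] := volterra_fock_norm.
have mfin : mass psi g \is a fin_num by rewrite ge0_fin_numE // mass_ge0.
pose m := fine (mass psi g).
have m0 : 0 <= m by rewrite fine_ge0 // mass_ge0.
have key f : entire_space Noo f -> (Np (volterra g psi f) <= ((K * m) `^ p^-1)%:E * Noo f)%E.
  move=> [ef fin]; have N0 := fock_norm_oo_ge0 al f.
  have Nf : Noo f \is a fin_num by rewrite ge0_fin_numE.
  rewrite -(fineK Nf) -EFinM; set A := fine _; have A0 : 0 <= A by rewrite fine_ge0.
  apply/(fock_norm_le al0 p0); first by rewrite mulr_ge0 ?powR_ge0.
  apply: le_trans (HK psi g f A epsi eg ef A0 _) _; first by rewrite fineK.
  rewrite -(fineK mfin) -/m -EFinM lee_fin (powRM _ (powR_ge0 _ _) A0) -powRrM mulVf ?lt0r_neq0 //.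
  by rewrite powRr1 ?mulr_ge0 ?(ltW K0) // mulrAC.
split; last by exists ((K * m) `^ p^-1) => f /key.
move=> f Hf; have [ef fin] := Hf; split; first exact: (entire_volterra epsi eg ef).
apply: le_lt_trans (key f Hf) _; apply: lte_mul_pinfty; last exact: fin.
  by rewrite lee_fin powR_ge0.
by [].
Qed.

(** Boundedness supplies these bounds along the full sequences; compactness only along subsequences,
    possibly different for the two values of [b]. *)
Lemma mass_of_tests psi g : entire psi -> entire g ->
  (forall b, exists (s : nat -> nat) (A : R), (forall n, (n <= s n)%N) /\
     forall n, (Lp (volterra g psi (test b (s n))) <= A%:E)%E) ->
  (mass psi g < +oo)%E.
Proof.
move=> epsi eg H; have [K K0 HK] := mass_le_test al0 p0.
have [s1 [A1 [sn1 H1]]] := H true; have [s2 [A2 [sn2 H2]]] := H false.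
have := HK psi g (fun b : bool => if b then s1 else s2) (Num.max A1 A2) epsi eg.
move=> /(_ _ _)/le_lt_trans; apply; last exact: ltry.
  by case.
by case=> n; [apply: le_trans (H1 n) _|apply: le_trans (H2 n) _]; rewrite lee_fin le_max lexx ?orbT.
Qed.

Lemma bounded_mass psi g : entire psi -> entire g ->
  bounded_op Noo Np (volterra g psi) -> (mass psi g < +oo)%E.
Proof.
move=> epsi eg [_ [K HK]]; apply: mass_of_tests => // b.
(* The constant in [bounded_op] is any real, hence the absolute value. *)
exists id, (`|K| `^ p / c); split=> // n.
apply: Lp_mass_le => //; apply: le_trans (HK _ (test_in_space b n)) _.
have N0 := fock_norm_oo_ge0 al (test b n).
apply: (@le_trans _ _ (`|K|%:E * Noo (test b n))%E).
  by apply: lee_wpmul2r => //; rewrite lee_fin ler_norm.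
rewrite -[leRHS]mule1; apply: lee_wpmul2l; first by rewrite lee_fin.
exact: fock_norm_oo_test.
Qed.

Lemma homo_ge_id (s : nat -> nat) : {homo s : m n / (m < n)%N} -> forall n, (n <= s n)%N.
Proof. by move=> hs; elim=> // n IH; exact: leq_ltn_trans IH (hs n n.+1 (ltnSn n)). Qed.

Lemma Lp_mass_diff (f h : C -> C) : entire f -> entire h ->
  (Lp f <= (2 `^ p)%:E * (Lp (fun z => (f z - h z)%R) + Lp h))%E.
Proof.
move=> ef eh; have ed := entireB ef eh.
have m1 := @measurable_Lp_weight R _ a 0 p ed; have m2 := @measurable_Lp_weight R _ a 0 p eh.
have n1 u := @Lp_weight_ge0 R (fun z => f z - h z) a 0 p u.
have n2 u := @Lp_weight_ge0 R h a 0 p u.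
rewrite /Lp_mass -/a -(@ge0_integralD _ _ _ dm _ measurableT _ _ (fun u _ => n1 u) m1 (fun u _ => n2 u) m2).
have mS := emeasurable_funD m1 m2.
rewrite -(@ge0_integralZl _ _ _ dm _ measurableT _ mS); last 2 first.
- by move=> u _; exact: adde_ge0 (n1 u) (n2 u).
- by rewrite lee_fin powR_ge0.
apply: (@ge0_le_integral _ _ _ dm _ measurableT).
- by move=> u _; exact: Lp_weight_ge0.
- exact: measurable_Lp_weight.
- exact: measurable_funeM mS.
move=> u _; rewrite -EFinD -EFinM lee_fin -mulrDl mulrA.
apply: ler_wpM2r; first exact: weight_ge0.
apply: le_trans (powR_add_le (cabs_ge0 _) (cabs_ge0 _) p0).
apply: (ge0_ler_powR (ltW p0)); rewrite ?nnegrE ?addr_ge0 //.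
by have := cabsD (f (P u) - h (P u)) (h (P u)); rewrite subrK.
Qed.

(** A convergent subsequence of the images is eventually within [1] of its limit, and [Lp_mass_diff]
    turns this into a uniform bound for every [p]. *)
Lemma compact_mass psi g : entire psi -> entire g ->
  compact_op Noo Np (volterra g psi) -> (mass psi g < +oo)%E.
Proof.
move=> epsi eg [_ HT]; apply: mass_of_tests => // b.
have [|s hs [h [eh hf]]] := HT (test b) 1.
  by move=> n; split; [exact: test_in_space|exact: fock_norm_oo_test].
move=> /(cvge0P (fun n => fock_norm_ge0 _ _ _))/(_ 1 ltr01)[N HN].
have hfin : Lp h \is a fin_num by rewrite ge0_fin_numE ?Lp_mass_ge0 //; exact/(fock_norm_lty al0 p0).
(* The shift by [N] keeps only the terms within [1] of the limit. *)
exists (fun n => s (n + N)%N), (2 `^ p * (1 `^ p / c + fine (Lp h))); split=> n.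
  exact: leq_trans (leq_addr N n) (homo_ge_id hs _).
have eV : entire (volterra g psi (test b (s (n + N)%N))).
  exact: (entire_volterra epsi eg (@entire_test_function R al b _)).
apply: le_trans (Lp_mass_diff eV eh) _.
rewrite (EFinM (2 `^ p)) EFinD fineK //; apply: lee_wpmul2l; first by rewrite lee_fin powR_ge0.
apply: leeD => //; apply: Lp_mass_le => //.
by apply: HN; exact: leq_addl.
Qed.

Lemma fock_montel (f : nat -> C -> C) K : (forall n, entire (f n)) -> (forall n, (Noo (f n) <= K%:E)%E) ->
  exists2 s : nat -> nat, {homo s : m n / (m < n)%N} & exists g : C -> C,
    [/\ entire g, (Noo g <= K%:E)%E &
      forall z e, 0 < e -> exists N, forall n, (N <= n)%N -> cabs (f (s n) z - g z) <= e].
Proof.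
move=> ef HK.
have K0 : 0 <= K by rewrite -lee_fin; exact: le_trans (fock_norm_oo_ge0 al (f 0%N)) (HK 0%N).
have fK n w : cabs (f n w) <= K * expR (al / 2 * cabs w ^+ 2).
  have /fock_norm_oo_le/(_ w) := HK n.
  by rewrite mulNr expRN ler_pdivrMr ?expR_gt0.
have [n r w wr|s hs [g eg Hg]] := @montel R f (fun r => K * expR (al / 2 * r ^+ 2)) ef.
  apply: le_trans (fK n w) _; apply: ler_wpM2l => //; rewrite ler_expR.
  apply: ler_wpM2l; first by rewrite divr_ge0 // ltW.
  by apply: lerXn2r; rewrite ?nnegrE //; exact: le_trans (cabs_ge0 w) wr.
exists s => //; exists g; split=> //.
apply/fock_norm_oo_le => z; rewrite mulNr expRN ler_pdivrMr ?expR_gt0 //.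
apply/ler_addgt0Pr => e e0; have [N /(_ N (leqnn _)) HN] := Hg z e e0.
have := cabsBD (f (s N) z) (f (s N) z - g z); rewrite subKr => /le_trans; apply.
exact: lerD (fK _ _) HN.
Qed.

Lemma volterra_compact psi g : entire psi -> entire g -> (mass psi g < +oo)%E ->
  compact_op Noo Np (volterra g psi).
Proof.
move=> epsi eg mf; have [Vsp _] := volterra_bounded epsi eg mf.
split=> // f K Hf.
have ef n : entire (f n) by exact: (Hf n).1.1.
have [s hs [f0 [ef0 Nf0 Hf0]]] := fock_montel ef (fun n => (Hf n).2).
exists s => //; exists (volterra g psi f0).
  by apply: Vsp; split=> //; exact: le_lt_trans Nf0 (ltry _).
apply/(cvge0P (fun n => fock_norm_ge0 _ _ _)) => e e0.
(* The differences [D n] are entire and vanish at [0], so it suffices that the weighted integrals of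
   their derivatives [q n] tend to [0]. *)
have [K1 K10 HK1] := primitive_bound a0 p0.
pose q n z := (f (s n) (psi z) - f0 (psi z)) * cderiv g z.
have eq n : entire (q n).
  exact: entireM (entireB (entire_comp (ef _) epsi) (entire_comp ef0 epsi)) (entire_cderiv eg).
pose D n z := volterra g psi (f (s n)) z - volterra g psi f0 z.
have eV n := entire_volterra epsi eg (ef (s n)).
have eV0 := entire_volterra epsi eg ef0.
have eD n : entire (D n) by exact: entireB (eV n) eV0.
have dD n z : cderiv (D n) z = q n z.
  apply: cder_cderiv; rewrite /q mulrBl.
  exact: cderB (volterra_cder epsi eg (ef _) z) (volterra_cder epsi eg ef0 z).
have D0 n : D n 0 = 0 by rewrite /D /volterra !path_integral0 subrr.
pose F n u := (cabs (q n (P u)) `^ p * weight a p (P u))%:E.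
have LpD n : (Lp (D n) <= K1%:E * \int[dm]_u F n u)%E.
  have <- : (\int[dm]_u (cabs (cderiv (D n) (P u)) `^ p * weight a p (P u))%:E = \int[dm]_u F n u)%E.
    by apply: eq_integral => u _; rewrite dD.
  exact: HK1 _ (eD n) (D0 n).
have IF : (\int[dm]_u F n u)%E @[n --> \oo] --> 0%E.
  have K0 : 0 <= K by rewrite -lee_fin; exact: le_trans (fock_norm_oo_ge0 al f0) Nf0.
  have K20 : 0 <= 2 * K by rewrite mulr_ge0.
  have dK n w : cabs (f (s n) w - f0 w) * expR (- (al / 2) * cabs w ^+ 2) <= 2 * K.
    have /fock_norm_oo_le/(_ w) h1 := (Hf (s n)).2.
    have /fock_norm_oo_le/(_ w) h2 := Nf0.
    apply: (@le_trans _ _ ((cabs (f (s n) w) + cabs (f0 w)) * expR (- (al / 2) * cabs w ^+ 2))).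
      by apply: ler_wpM2r; [exact: expR_ge0|exact: cabsBD].
    by rewrite mulrDl mulrDl mul1r; exact: lerD.
  have mm : measurable_fun setT (fun u => (mass_density al p psi g (P u))%:E).
    by apply/measurable_EFinP; exact: measurable_mass_density.
  have mF n : measurable_fun setT (F n) by exact: measurable_Lp_weight (eq n).
  (* The dominating function: [f (s n) - f0] has norm at most [2 K], and [mass] is finite. *)
  have ig : dm.-integrable setT (fun u => (((2 * K) `^ p)%:E * (mass_density al p psi g (P u))%:E)%E).
    apply: integrableZl => //; apply/integrableP; split=> //.
    rewrite (_ : (\int[dm]_u _)%E = mass psi g) //.
    by apply: eq_integral => u _; rewrite gee0_abs // lee_fin mass_density_ge0.
  have cF u : F n u @[n --> \oo] --> 0%E.
    apply/(cvge0P (fun n => Lp_weight_ge0 (q n) a p p u)) => r r0.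
    pose W := cabs (cderiv g (P u)) `^ p * weight a p (P u).
    have W0 : 0 <= W by rewrite mulr_ge0 ?powR_ge0 ?weight_ge0.
    have W1 : 0 < W + 1 by rewrite ltr_wpDl.
    (* Then [d^p W = r W / (W + 1) <= r], also when [W = 0]. *)
    pose d := (r / (W + 1)) `^ p^-1.
    have [N HN] := Hf0 (psi (P u)) d ltac:(by rewrite powR_gt0 // divr_gt0).
    exists N => n /HN h; rewrite lee_fin /q cabsM powRM // -mulrA -/W.
    apply: (@le_trans _ _ (r / (W + 1) * W)).
      apply: ler_wpM2r => //.
      have -> : r / (W + 1) = d `^ p.
        by rewrite /d -powRrM mulVf ?lt0r_neq0 // powRr1 // divr_ge0 // ltW.
      by apply: (ge0_ler_powR (ltW p0)); rewrite ?nnegrE ?powR_ge0.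
    rewrite mulrAC ler_pdivrMr // ler_wpM2l ?(ltW r0) // lerDl.
    exact: ler01.
  have := @dominated_convergence _ _ R dm setT measurableT F (cst 0%E) _ mF (measurable_cst _) _ ig _.
  case.
  - by apply: aeW => u _; exact: cF.
  - apply: aeW => u n _.
    rewrite gee0_abs; last exact: Lp_weight_ge0.
    rewrite -EFinM lee_fin.
    exact: (@volterra_density R al p p0 psi g (fun w => f (s n) w - f0 w) _ (P u) K20 (dK n)).
  by move=> _ _; rewrite integral0.
have e'0 : 0 < e `^ p / (c * K1) by apply: divr_gt0; [exact: powR_gt0|exact: mulr_gt0].
have I0 n : (0 <= \int[dm]_u F n u)%E by apply: integral_ge0 => u _; exact: Lp_weight_ge0.
have [N HN] := (cvge0P I0).1 IF _ e'0.
exists N => n /HN h; apply/(fock_norm_le al0 p0); first exact: ltW.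
apply: (@le_trans _ _ (c%:E * (K1%:E * (e `^ p / (c * K1))%:E))%E).
  apply: lee_wpmul2l; first by rewrite lee_fin ltW.
  apply: le_trans (LpD n) _; apply: lee_wpmul2l => //.
  by rewrite lee_fin ltW.
rewrite -!EFinM lee_fin; apply: eq_leW.
by field; rewrite !lt0r_neq0.
Qed.

Lemma op_norm_test psi g b M : (Np (volterra g psi (test b M)) <= op_norm Noo Np (volterra g psi))%E.
Proof.
apply: ereal_sup_ubound; exists (test b M) => //.
by split; [exact: test_in_space|exact: fock_norm_oo_test].
Qed.

Lemma op_norm_ge0 psi g : (0 <= op_norm Noo Np (volterra g psi))%E.
Proof. exact: le_trans (fock_norm_ge0 _ _ _) (op_norm_test psi g true 0%N). Qed.

Lemma op_norm_upper : exists2 K : R, 0 < K & forall psi g : C -> C, entire psi -> entire g ->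
  (op_norm Noo Np (volterra g psi) `^ p <= K%:E * mass psi g)%E.
Proof.
have [K K0 HK] := volterra_fock_norm.
exists K => // psi g epsi eg.
have M0 : (0 <= K%:E * mass psi g)%E by rewrite mule_ge0 ?mass_ge0 // lee_fin ltW.
have op0 := op_norm_ge0 psi g.
have -> : (K%:E * mass psi g = ((K%:E * mass psi g) `^ p^-1) `^ p)%E.
  by rewrite -poweRrM mulVf ?lt0r_neq0 // poweRe1.
apply: (gt0_ler_poweR (ltW p0)); rewrite ?in_itv /= ?leey ?andbT ?poweR_ge0 //.
apply: ge_ereal_sup => _ [f [[ef _] f1] <-].
rewrite fock_normE; apply: gt0_ler_poweR; rewrite ?invr_ge0 ?(ltW p0) //.
- by rewrite in_itv /= leey mule_ge0 // ?Lp_mass_ge0 // lee_fin ltW.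
- by rewrite in_itv /= leey M0.
by have := HK psi g f 1 epsi eg ef ler01 f1; rewrite powR1 mulr1.
Qed.

(** Boundedness makes the operator norm a real number; as the test functions lie in the unit ball,
    it bounds all their images, and [mass_le_test] applies to the full sequences. *)
Lemma op_norm_lower : exists2 K : R, 0 < K & forall psi g : C -> C, entire psi -> entire g ->
  bounded_op Noo Np (volterra g psi) ->
  (mass psi g <= K%:E * op_norm Noo Np (volterra g psi) `^ p)%E.
Proof.
have [K K0 HK] := mass_le_test al0 p0.
exists (K / c); first by rewrite divr_gt0.
move=> psi g epsi eg [_ [B HB]]; set V := op_norm _ _ _.
have V0 : (0 <= V)%E by exact: op_norm_ge0.
have Vfin : V \is a fin_num.
  rewrite ge0_fin_numE //; apply: (@le_lt_trans _ _ `|B|%:E); last exact: ltry.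
  apply: ge_ereal_sup => _ [f [Hf f1] <-].
  have N0 := fock_norm_oo_ge0 al f.
  apply: le_trans (HB f Hf) _; apply: (@le_trans _ _ (`|B|%:E * Noo f)%E).
    by apply: lee_wpmul2r => //; rewrite lee_fin ler_norm.
  by rewrite -[leRHS]mule1; apply: lee_wpmul2l => //; rewrite lee_fin.
pose A := fine V; have A0 : 0 <= A by rewrite fine_ge0.
rewrite -(fineK Vfin) -/A poweR_EFin -EFinM -mulrA (mulrC c^-1).
apply: (HK psi g (fun _ => id) _ epsi eg) => // b n.
by apply: Lp_mass_le => //; rewrite /A fineK //; exact: op_norm_test.
Qed.

End VolterraCriterion.

Theorem theorem2p3 (R : realType) (alpha p : R)
  (alpha_gt0 : 0 < alpha) (p_gt0 : 0 < p) :
  let Noo := fock_norm_oo alpha in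
  let Np := fock_norm alpha p in
  (forall psi g : R[i] -> R[i], entire psi -> entire g ->
     (bounded_op Noo Np (volterra g psi) <->
      compact_op Noo Np (volterra g psi)) /\
     (bounded_op Noo Np (volterra g psi) <->
      L1C (berezin alpha psi g p))) /\
  (exists2 K : R, 0 < K &
   forall psi g : R[i] -> R[i], entire psi -> entire g ->
     bounded_op Noo Np (volterra g psi) ->
     let V := (op_norm Noo Np (volterra g psi) `^ p)%E in
     let I := integralC (berezin alpha psi g p) in
     ((K^-1)%:E * I <= V)%E /\ (V <= K%:E * I)%E).
Proof.
move=> Noo Np.
have a0 : 0 < alpha * p / 2 by rewrite divr_gt0 ?mulr_gt0.
have [k k0 Hk] := gaussian_plane a0.
have Ik psi g : entire psi -> entire g ->
    integralC (berezin alpha psi g p) = (k%:E * mass alpha p psi g)%E.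
  by move=> epsi eg; exact: integral_berezin.
split=> [psi g epsi eg|].
  have BM : bounded_op Noo Np (volterra g psi) <-> (mass alpha p psi g < +oo)%E.
    by split; [exact: bounded_mass|exact: volterra_bounded].
  have CM : compact_op Noo Np (volterra g psi) <-> (mass alpha p psi g < +oo)%E.
    by split; [exact: compact_mass|exact: volterra_compact].
  split; first by rewrite BM CM.
  rewrite BM berezin_L1 // Ik //; split=> h.
    by apply: lte_mul_pinfty => //; rewrite lee_fin ltW.
  by move: h; rewrite !ltey; apply: contra => /eqP ->; rewrite gt0_muley.
have [K1 K10 upper] := op_norm_upper alpha_gt0 p_gt0.
have [K2 K20 lower] := op_norm_lower alpha_gt0 p_gt0.
(* [K1 / k] serves the upper bound, [k K2] the lower one. *)
exists (K1 / k + k * K2); first by rewrite addr_gt0 ?divr_gt0 ?mulr_gt0.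
move=> psi g epsi eg bV V I.
have M0 : (0 <= mass alpha p psi g)%E by exact: mass_ge0.
have V0 : (0 <= V)%E by exact: poweR_ge0.
have K0 : 0 < K1 / k + k * K2 by rewrite addr_gt0 ?divr_gt0 ?mulr_gt0.
split.
  rewrite lee_pdivrMl // /I Ik //.
  apply: (@le_trans _ _ ((k * K2)%:E * V)%E).
    rewrite EFinM -muleA; apply: lee_wpmul2l; first by rewrite lee_fin ltW.
    exact: lower.
  by apply: lee_wpmul2r => //; rewrite lee_fin lerDr divr_ge0 ?ltW.
apply: le_trans (upper psi g epsi eg) _.
rewrite /I Ik // muleA -EFinM; apply: lee_wpmul2r => //.
rewrite lee_fin mulrDl divfK ?lt0r_neq0 // lerDl.
by rewrite !mulr_ge0 // ltW.
Qed.
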